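(* The space $\mathcal{S}^*_\dagger(\mathbb{R}^d)$ is nuclear; that is, both locally convex spaces $\mathcal{S}^{(M_p)}_{(A_p)}(\mathbb{R}^d)$ and $\mathcal{S}^{\{M_p\}}_{\{A_p\}}(\mathbb{R}^d)$ are nuclear.
   Context: $\mathbb{N}=\{0,1,2,\dots\}$, $\mathbb{Z}_+=\{1,2,\dots\}$. $\{M_p\}_{p\in\mathbb{N}}$ and $\{A_p\}_{p\in\mathbb{N}}$ are sequences of positive numbers with $M_0=M_1=A_0=A_1=1$. Both satisfy (M.1) $M_p^2\leq M_{p-1}M_{p+1}$ for $p\in\mathbb{Z}_+$, and (M.2) there are $c_0,H\geq 1$ with $M_p\leq c_0H^p\min_{0\leq q\leq p}\{M_{p-q}M_q\}$ for $p\in\mathbb{N}$ (and likewise for $A_p$, with the same constants). $M_p$ satisfies (M.5): there exists $q>0$ and $c_0\geq1$ such that $\sum_{j=p+1}^{\infty}M_{j-1}^q/M_j^q\leq c_0\,p\,M_p^q/M_{p+1}^q$ for all $p\in\mathbb{Z}_+$. $A_p$ satisfies (M.6): there are $c_0,L_0\geq1$ with $p!\leq c_0L_0^pA_p$ for all $p\in\mathbb{N}$. For a multi-index $\alpha$, $M_\alpha=M_{|\alpha|}$, $D^\alpha=(-i)^{|\alpha|}\partial^\alpha$. $A(\rho)=\sup_{p\in\mathbb{N}}\log_+(\rho^p/A_p)$. For $h>0$, $\mathcal{S}^{M_p,h}_{A_p,h}$ is the Banach space of all $\varphi\in C^\infty(\mathbb{R}^d)$ with $\sigma_h(\varphi)=\sup_\alpha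 h^{|\alpha|}\|e^{A(h|\cdot|)}D^\alpha\varphi\|_{L^\infty(\mathbb{R}^d)}/M_\alpha<\infty$, normed by $\sigma_h$. $\mathcal{S}^{(M_p)}_{(A_p)}(\mathbb{R}^d)=\varprojlim_{h\to\infty}\mathcal{S}^{M_p,h}_{A_p,h}$ (Beurling case) and $\mathcal{S}^{\{M_p\}}_{\{A_p\}}(\mathbb{R}^d)=\varinjlim_{h\to0}\mathcal{S}^{M_p,h}_{A_p,h}$ (Roumieu case), as locally convex spaces; $\mathcal{S}^*_\dagger(\mathbb{R}^d)$ is the common notation for both. *)

(* Defs.v *)
From HB Require Import structures.
From mathcomp Require Import all_boot all_order all_algebra.
From mathcomp Require Import all_classical all_reals all_analysis.
From mathcomp Require Import complex.

Set Implicit Arguments.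
Unset Strict Implicit.
Unset Printing Implicit Defensive.

Import Order.TTheory GRing.Theory Num.Theory.
Import numFieldNormedType.Exports.

Local Open Scope classical_set_scope.
Local Open Scope ring_scope.

Record seminorm (K : numFieldType) (E : lmodType K) := Seminorm {
  seminorm_fun :> E -> K ;
  seminormD : forall x y, seminorm_fun (x + y) <= seminorm_fun x + seminorm_fun y ;
  seminormZ : forall a x, seminorm_fun (a *: x) = `|a| * seminorm_fun x }.

HB.instance Definition _ (K : numFieldType) (E : lmodType K) :=
  gen_eqMixin (seminorm E).
HB.instance Definition _ (K : numFieldType) (E : lmodType K) :=
  gen_choiceMixin (seminorm E).

Section seminorm_theory.
Context (K : numFieldType) (E : lmodType K).
Implicit Types (p : seminorm E) (x y : E).

Lemma seminorm0 p : p 0 = 0.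
Proof. by rewrite -(scale0r 0) seminormZ normr0 mul0r. Qed.

Lemma seminormN p x : p (- x) = p x.
Proof. by rewrite -scaleN1r seminormZ normrN1 mul1r. Qed.

Lemma seminorm_ge0 p x : 0 <= p x.
Proof.
have := seminormD p x (- x).
by rewrite subrr seminorm0 seminormN -mulr2n pmulrn_lge0.
Qed.

Lemma seminormB p x y : p (x - y) = p (y - x).
Proof. by rewrite -opprB seminormN. Qed.

End seminorm_theory.

Section seminorm_comp.
Context (K : numFieldType) (E F : lmodType K) (p : seminorm F) (u : {linear E -> F}).

Local Lemma compD x y : p (u (x + y)) <= p (u x) + p (u y).
Proof. by rewrite linearD seminormD. Qed.

Local Lemma compZ a x : p (u (a *: x)) = `|a| * p (u x).
Proof. by rewrite linearZ seminormZ. Qed.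

Definition seminorm_comp : seminorm E :=
  @Seminorm K E (fun x => p (u x)) compD compZ.

End seminorm_comp.

(* The vector space E with the locally convex topology generated by the set P
   of seminorms. *)
Definition lcs (K : numFieldType) (E : lmodType K) (P : set (seminorm E)) : Type := E.

HB.instance Definition _ (K : numFieldType) (E : lmodType K)
  (P : set (seminorm E)) := GRing.Lmodule.on (lcs P).

Section lcs_topology.
Context (K : numFieldType) (E : lmodType K) (P : set (seminorm E)).
Implicit Types (D : set (seminorm E * K)) (x y : E).

Definition lcs_ball D x : set (lcs P) :=
  [set y | forall q, D q -> q.1 (y - x) < q.2].

Definition lcs_index D :=
  finite_set D /\ D `<=` [set q | P q.1 /\ 0 < q.2].

Definition lcs_nbhs (x : lcs P) : set_system (lcs P) :=
  filter_from lcs_index (lcs_ball^~ x).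

HB.instance Definition _ := hasNbhs.Build (lcs P) lcs_nbhs.

Lemma lcs_ball_center D x : lcs_index D -> lcs_ball D x x.
Proof. by move=> [_ DP] q /DP[_ q0]; rewrite subrr seminorm0. Qed.

Lemma lcs_ball_refine D x y : lcs_index D -> lcs_ball D x y ->
  exists2 D', lcs_index D' & lcs_ball D' y `<=` lcs_ball D x.
Proof.
move=> [finD DP] xy; pose f (q : seminorm E * K) := (q.1, q.2 - q.1 (y - x)).
exists (f @` D).
  split; first exact: finite_image.
  by move=> _ [q Dq <-] /=; split; [have [] := DP _ Dq|rewrite subr_gt0 xy].
move=> z zD q Dq; have /= := zD (f q) (imageP _ Dq).
rewrite ltrBrDr; apply: le_lt_trans.
by rewrite (le_trans _ (seminormD _ _ _))// addrA subrK.
Qed.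

Local Lemma lcs_filter (x : lcs P) : ProperFilter (nbhs x).
Proof.
apply: filter_from_proper; last first.
  by move=> D iD; exists x; exact: lcs_ball_center.
apply: filter_from_filter.
  by exists set0; split=> //; exact: finite_set0.
move=> D D' [fD DP] [fD' DP']; exists (D `|` D').
  by split; [rewrite finite_setU|rewrite subUset].
by move=> y yDD'; split=> q Dq; apply: yDD'; [left|right].
Qed.

Local Lemma lcs_singleton (x : lcs P) (A : set (lcs P)) : nbhs x A -> A x.
Proof. by move=> [D iD]; apply; exact: lcs_ball_center. Qed.

Local Lemma lcs_nbhs_nbhs (x : lcs P) (A : set (lcs P)) :
  nbhs x A -> nbhs x (nbhs^~ A).
Proof.
move=> [D iD DA]; exists D => // y xy.
have [D' iD' D'D] := lcs_ball_refine iD xy.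
by exists D' => //; exact: subset_trans DA.
Qed.

HB.instance Definition _ := Nbhs_isNbhsTopological.Build (lcs P)
  lcs_filter lcs_singleton lcs_nbhs_nbhs.

Lemma lcs_cvgP (F : set_system (lcs P)) (x : lcs P) : Filter F ->
  F --> x <->
  (forall p : seminorm E, P p -> forall e : K, 0 < e ->
    \forall y \near F, p (y - x) < e).
Proof.
move=> FF; split.
  move=> Fx p Pp e e0.
  apply: (Fx [set y : lcs P | p (y - x) < e]).
  exists [set (p, e)]; first by split; [exact: finite_set1|move=> _ ->].
  by move=> y /(_ (p, e) erefl).
move=> Fx A [D [finD DP] DA]; suff : F (lcs_ball D x) by exact: filterS DA.
have -> : lcs_ball D x =
    \bigcap_(q in D) [set y : lcs P | q.1 (y - x : E) < q.2].
  by apply/seteqP; split.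
rewrite -[D]fset_setK//; apply: filter_bigI => q.
by rewrite in_fset_set// inE => /DP[Pq q0]; exact: Fx.
Qed.

Lemma lcs_near (x : lcs P) (p : seminorm E) (e : K) : P p -> 0 < e ->
  \forall y \near x, p (y - x : E) < e.
Proof.
move=> Pp e0; have [/(_ (@cvg_refl _ (nbhs x))) xP _] :=
  @lcs_cvgP (nbhs x) x _.
exact: xP.
Qed.

Local Lemma near_fst (X Y : topologicalType) (x : X) (y : Y) (A : set X) :
  nbhs x A -> \forall z \near (x, y), A z.1.
Proof.
by move=> xA; exists (A, setT); [split=> //; exact: filterT|move=> z []].
Qed.

Local Lemma near_snd (X Y : topologicalType) (x : X) (y : Y) (A : set Y) :
  nbhs y A -> \forall z \near (x, y), A z.2.
Proof.
by move=> yA; exists (setT, A); [split=> //; exact: filterT|move=> z []].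
Qed.

Lemma lcs_add_continuous : continuous (fun z : lcs P * lcs P => z.1 + z.2).
Proof.
move=> [x y]; apply/lcs_cvgP => p Pp e e0.
have e20 : 0 < e / 2 by rewrite divr_gt0.
have fx : \forall z \near (x, y), p (z.1 - x : E) < e / 2.
  exact: (near_fst y (lcs_near x Pp e20)).
have fy : \forall z \near (x, y), p (z.2 - y : E) < e / 2.
  exact: (near_snd x (lcs_near y Pp e20)).
suff : \forall z \near (x, y),
  p ((z.1 : E) + (z.2 : E) - ((x : E) + (y : E))) < e by [].
near=> z; rewrite opprD addrACA (le_lt_trans (seminormD _ _ _))//.
by rewrite (splitr e) ltrD//; near: z.
Unshelve. all: by end_near. Qed.

Lemma lcs_scale_continuous : continuous (fun z : K^o * lcs P => z.1 *: z.2).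
Proof.
move=> [k x]; apply/lcs_cvgP => p Pp e e0.
have px0 := seminorm_ge0 p x.
pose M := `|k| + 1; pose N := p x + 1.
have M0 : 0 < M by rewrite ltr_wpDl.
have N0 : 0 < N by rewrite ltr_wpDl.
have fx : \forall z \near (k : K^o, x), p (z.2 - x : E) < e / 2 / M.
  have e0' : 0 < e / 2 / M by rewrite !divr_gt0.
  exact: (near_snd (k : K^o) (lcs_near x Pp e0')).
have fk : \forall z \near (k : K^o, x), `|k - z.1| < e / 2 / N.
  have e0' : 0 < e / 2 / N by rewrite !divr_gt0.
  exact: (near_fst x (@nbhsx_ballx K K^o k _ e0')).
have fM : \forall z \near (k : K^o, x), `|k - z.1| < 1.
  exact: (near_fst x (@nbhsx_ballx K K^o k _ ltr01)).
suff : \forall z \near (k : K^o, x),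
  p (z.1 *: (z.2 : E) - k *: (x : E)) < e by [].
near=> z.
have -> : z.1 *: (z.2 : E) - k *: (x : E) =
    z.1 *: (z.2 - x : E) + (z.1 - k) *: (x : E).
  by rewrite scalerBr scalerBl addrA subrK.
rewrite (le_lt_trans (seminormD _ _ _))// !seminormZ (splitr e).
have zM : `|z.1| <= M.
  rewrite -[z.1](subrK k) addrC (le_trans (ler_normD _ _))// lerD2l ltW//.
  by rewrite distrC; near: z.
rewrite ltr_leD//.
- rewrite (@le_lt_trans _ _ (M * p (z.2 - x : E)))//.
    by rewrite ler_wpM2r// seminorm_ge0.
  by rewrite mulrC -ltr_pdivlMr//; near: z.
- rewrite (@le_trans _ _ (`|z.1 - k| * N))// ?ler_wpM2l// ?lerDl//.
  rewrite -ler_pdivlMr// ltW// distrC; near: z; exact: fk.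
Unshelve. all: by end_near. Qed.

Local Lemma convex_lcs_ball D x : convex_set (lcs_ball D x).
Proof.
apply/convex_setW => y z; rewrite !inE => Dy Dz k k0 k1; rewrite inE => q Dq.
have kz : 0 < 1 - k%:num by rewrite subr_gt0.
suff : q.1 (k%:num *: (y : E) + (1 - k%:num) *: (z : E) - (x : E)) < q.2 by [].
have -> : k%:num *: (y : E) + (1 - k%:num) *: (z : E) - (x : E)
    = k%:num *: (y - x : E) + (1 - k%:num) *: (z - x : E).
  rewrite !scalerBr addrACA -opprD -scalerDl [in k%:num + _]addrC subrK.
  by rewrite scale1r.
rewrite (le_lt_trans (seminormD _ _ _))// !seminormZ.
rewrite (gtr0_norm k0) (gtr0_norm kz).
have -> : q.2 = k%:num * q.2 + (1 - k%:num) * q.2.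
  by rewrite -mulrDl addrC subrK mul1r.
by rewrite ltrD// ltr_pM2l//; [exact: Dy|exact: Dz].
Qed.

Lemma lcs_locally_convex : exists2 B : set_system (lcs P),
  (forall b, b \in B -> convex_set b) & basis B.
Proof.
exists [set b | exists D x, lcs_index D /\ b = lcs_ball D x].
  by move=> b; rewrite inE => -[D [x [_ ->]]]; exact: convex_lcs_ball.
split.
  move=> b [D [x [iD ->]]]; rewrite openE => y xy.
  by have [D' iD' D'D] := lcs_ball_refine iD xy; exists D'.
move=> x A [D iD DA]; exists (lcs_ball D x) => //.
by split; [exists D, x|exact: lcs_ball_center].
Qed.

HB.instance Definition _ := PreTopologicalLmod_isTvs.Build K (lcs P)
  lcs_add_continuous lcs_scale_continuous lcs_locally_convex.
HB.instance Definition _ :=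
  PreTopologicalNmodule_isTopologicalNmodule.Build (lcs P) lcs_add_continuous.
HB.instance Definition _ :=
  TopologicalNmodule_isTopologicalLmodule.Build K (lcs P) lcs_scale_continuous.
HB.instance Definition _ := Uniform_isTvs.Build K (lcs P) lcs_locally_convex.

End lcs_topology.

Section limits.
Context (K : numFieldType) (E : lmodType K) (I : Type) (F : I -> tvsType K).

(* Initial locally convex topology on E for the linear maps u. *)
Definition proj_lim (u : forall i, {linear E -> F i}) : tvsType K :=
  lcs [set p : seminorm E | exists i (q : seminorm (F i)),
    continuous (q : F i -> K) /\ p = seminorm_comp q (u i)].

(* Finest locally convex topology on E for which the linear maps u are
   continuous: a seminorm is continuous iff all its composites with u are. *)
Definition ind_lim (u : forall i, {linear F i -> E}) : tvsType K :=
  lcs [set p : seminorm E | forall i, continuous (fun x => p (u i x))].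

End limits.

Section nuclearity.
Context (K : numFieldType).

(* T = sum_n lam_n <f_n, .> y_n with lam summable, (f_n) bounded in the dual of
   X and (y_n) bounded in Y. *)
Definition nuclear_map (X Y : normedModType K) (T : X -> Y) :=
  exists (lam : nat -> K^o) (f : nat -> {linear X -> K^o}) (y : nat -> Y),
  [/\ cvgn (series (fun n => `|lam n| : K^o)),
      exists C, forall n x, `|f n x| <= C * `|x|,
      exists C, forall n, `|y n| <= C &
      forall x, series (fun n => (lam n * f n x) *: y n) @ \oo --> T x].

(* (B, j) is the Banach space associated with (E, p): the completion of the
   quotient of E by the kernel of p, determined up to isometry. *)
Definition is_completion (E : lmodType K) (p : seminorm E)
    (B : completeNormedModType K) (j : {linear E -> B}) :=
  (forall x, `|j x| = p x) /\ dense (range j).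

(* The canonical map from the completion of (E, q) to that of (E, p), i.e. the
   continuous extension of the identity of E, is nuclear. As is customary,
   nuclear spaces are Hausdorff. *)
Definition nuclear_space (E : tvsType K) :=
  hausdorff_space E /\
  forall p : seminorm E, continuous (p : E -> K) ->
  exists q : seminorm E,
    [/\ continuous (q : E -> K), forall x, p x <= q x &
        exists (Eq Ep : completeNormedModType K)
          (jq : {linear E -> Eq}) (jp : {linear E -> Ep})
          (T : {linear Eq -> Ep}),
        [/\ is_completion q jq, is_completion p jp, continuous T,
            forall x, T (jq x) = jp x & nuclear_map T]].

End nuclearity.

Section linear_subspace.
Context (K : numFieldType) (E : lmodType K).

Record subspace_of (V : submodClosed E) := SubspaceOf {
  subspace_val :> E ; _ : subspace_val \in V }.

Context (V : submodClosed E).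

HB.instance Definition _ := [isSub for @subspace_val V].
HB.instance Definition _ := [Choice of subspace_of V by <:].
HB.instance Definition _ := [SubChoice_isSubLmodule of subspace_of V by <:].

End linear_subspace.

Section inclusion.
Context (K : numFieldType) (E : lmodType K) (V W : submodClosed E).
Hypothesis VW : {subset V <= W}.

Definition inclusion (x : subspace_of V) : subspace_of W :=
  SubspaceOf (VW (valP x)).

Local Lemma inclusion_linear : linear inclusion.
Proof. by move=> a x y; apply/val_inj. Qed.

HB.instance Definition _ := GRing.isLinear.Build K (subspace_of V)
  (subspace_of W) _ inclusion inclusion_linear.

End inclusion.

Import ComplexField.Normc.
Local Open Scope complex_scope.

Section differentiation.
Context (R : realType) (d : nat).
Implicit Types (phi f g : 'rV[R]_d -> R[i]) (a : R[i]) (s : seq 'I_d).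

Local Notation e i := (delta_mx 0 i : 'rV[R]_d).

(* The derivative of a complex-valued function is taken componentwise. *)
Definition partial (i : 'I_d) phi : 'rV[R]_d -> R[i] :=
  fun x => 'D_(e i) (fun y => complex.Re (phi y)) x +i* 'D_(e i) (fun y => complex.Im (phi y)) x.

Definition partials s phi := foldr partial phi s.

Definition smooth phi := forall s,
  [/\ continuous (fun y => complex.Re (partials s phi y)),
      continuous (fun y => complex.Im (partials s phi y)) &
      forall i x, derivable (fun y => complex.Re (partials s phi y)) x (e i) /\
                  derivable (fun y => complex.Im (partials s phi y)) x (e i)].

(* Multi-indices are the functions 'I_d -> nat. *)
Definition multi_abs (al : 'I_d -> nat) : nat := (\sum_(i < d) al i)%N.

Definition mpartial (al : 'I_d -> nat) phi : 'rV[R]_d -> R[i] :=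
  foldr (fun i => iter (al i) (partial i)) phi (enum 'I_d).

Definition mD (al : 'I_d -> nat) phi : 'rV[R]_d -> R[i] :=
  fun x => (- 'i%C) ^+ multi_abs al * mpartial al phi x.

Lemma mpartialE al : exists s, forall phi, mpartial al phi = partials s phi.
Proof.
rewrite /mpartial; elim: (enum 'I_d) => [|i t [s /= E]]; first by exists [::].
exists (nseq (al i) i ++ s) => phi; rewrite E /partials foldr_cat.
by elim: (al i) => //= n ->.
Qed.

Local Lemma ReD a f g : (fun y => complex.Re (a * f y + g y)) =
  complex.Re a *: (fun y => complex.Re (f y)) + (- complex.Im a) *: (fun y => complex.Im (f y)) +
  (fun y => complex.Re (g y)).
Proof.
apply/funext => y; rewrite !addrfctE !scalrfctE.
by case: a (f y) (g y) => [b c] [k l] [m n]; exact: (congr1 (fun z => _ + z + _) (esym (mulNr c l))).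
Qed.

Local Lemma ImD a f g : (fun y => complex.Im (a * f y + g y)) =
  complex.Re a *: (fun y => complex.Im (f y)) + complex.Im a *: (fun y => complex.Re (f y)) +
  (fun y => complex.Im (g y)).
Proof.
apply/funext => y; rewrite !addrfctE !scalrfctE.
by case: a (f y) (g y) => [b c] [k l] [m n].
Qed.

Local Lemma derive_comb (k l : R) (F G H : 'rV[R]_d -> R) x v :
  derivable F x v -> derivable G x v -> derivable H x v ->
  derivable (k *: F + l *: G + H) x v /\
  'D_v (k *: F + l *: G + H) x = k * 'D_v F x + l * 'D_v G x + 'D_v H x.
Proof.
move=> dF dG dH.
have dkF := @derivableZ _ _ _ F k x v dF.
have dlG := @derivableZ _ _ _ G l x v dG.
have dFG := derivableD dkF dlG.
split; first exact: derivableD dFG dH.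
rewrite (deriveD dFG dH) (deriveD dkF dlG).
by rewrite (deriveZ k dF) (deriveZ l dG).
Qed.

Lemma partials_linear s a f g : smooth f -> smooth g ->
  partials s (fun x => a * f x + g x) =
  (fun x => a * partials s f x + partials s g x).
Proof.
move=> sf sg; elim: s => //= i s ->; apply/funext => x; rewrite /partial.
have [_ _ /(_ i x)[rf imf]] := sf s; have [_ _ /(_ i x)[rg img]] := sg s.
rewrite ReD ImD.
rewrite (derive_comb (complex.Re a) (- complex.Im a) rf imf rg).2.
rewrite (derive_comb (complex.Re a) (complex.Im a) imf rf img).2.
by case: a => [a b] /=; rewrite mulNr.
Qed.

Lemma smooth_linear a f g : smooth f -> smooth g ->
  smooth (fun x => a * f x + g x).
Proof.
move=> sf sg s; rewrite partials_linear//.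
have [cf cf' df] := sf s; have [cg cg' dg] := sg s.
have cZ (k : R) (h : 'rV[R]_d -> R) : continuous h -> continuous (k *: h).
  by move=> ch x; exact: (cvgM (cvg_cst k) (ch x)).
have cD (h k : 'rV[R]_d -> R) : continuous h -> continuous k -> continuous (h + k).
  by move=> ch ck x; exact: (cvgD (ch x) (ck x)).
rewrite ReD ImD; split.
- exact: cD (cD _ _ (cZ _ _ cf) (cZ _ _ cf')) cg.
- exact: cD (cD _ _ (cZ _ _ cf') (cZ _ _ cf)) cg'.
move=> i x; have [df1 df2] := df i x; have [dg1 dg2] := dg i x.
split; first exact: (derive_comb _ _ df1 df2 dg1).1.
exact: (derive_comb _ _ df2 df1 dg2).1.
Qed.

Lemma smooth0 : smooth (fun _ => 0).
Proof.
have p0 s : partials s (fun _ => 0) = (fun _ => 0).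
  elim: s => //= i s ->; apply/funext => x.
  by rewrite /partial/= !derive_cst.
move=> s; rewrite p0 /=; split; [exact: cst_continuous..|].
by move=> i x; split; exact: derivable_cst.
Qed.

Lemma mD_linear al a f g x : smooth f -> smooth g ->
  mD al (fun x => a * f x + g x) x = a * mD al f x + mD al g x.
Proof.
move=> sf sg; rewrite /mD.
have [s E] := mpartialE al.
by rewrite !E partials_linear// mulrDr mulrCA.
Qed.

End differentiation.

Section gelfand_shilov.
Context (R : realType).

(* Euclidean norm; the norm of 'rV[R]_d in the library is the sup norm. *)
Definition eucl d (x : 'rV[R]_d) : R := Num.sqrt (\sum_(i < d) x 0 i ^+ 2).

(* ln 0 = 0 in the library, which is harmless under the positive part. *)
Definition assoc_fun (A : nat -> {posnum R}) (rho : R) : \bar R :=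
  ereal_sup (range (fun p : nat =>
    (Num.max 0 (ln (rho ^+ p / (A p)%:num)))%:E)).

Context (d : nat) (M A : nat -> {posnum R}).
Implicit Types (phi psi : 'rV[R]_d -> R[i]) (h : {posnum R}).

(* The L^oo norm of e^(A(h|.|)) phi, which is lower semicontinuous for phi
   continuous, so that its essential supremum is its supremum. *)
Definition weighted_norm h phi : \bar R :=
  ereal_sup (range (fun x : 'rV[R]_d =>
    (expeR (assoc_fun A (h%:num * eucl x)) * (normc (phi x))%:E)%E)).

Definition gs_norm h phi : \bar R :=
  ereal_sup (range (fun al : 'I_d -> nat =>
    ((h%:num ^+ multi_abs al / (M (multi_abs al))%:num)%:E *
      weighted_norm h (mD al phi))%E)).

Lemma le_assoc_fun (r r' : R) : 0 <= r -> r <= r' ->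
  (assoc_fun A r <= assoc_fun A r')%E.
Proof.
move=> r0 rr'; apply: ge_ereal_sup => _ [p _ <-].
apply: (@le_trans _ _ (Num.max 0 (ln (r' ^+ p / (A p)%:num)))%:E); last first.
  by apply: ereal_sup_ubound; exists p.
rewrite lee_fin ge_max le_max lexx/= le_max.
have [->|rp0] := eqVneq (r ^+ p) 0; first by rewrite mul0r ln0// lexx.
have rp : 0 < r ^+ p by rewrite lt_def rp0 exprn_ge0.
have rp' : r ^+ p <= r' ^+ p.
  by rewrite lerXn2r// nnegrE// (le_trans r0).
have rp'0 := lt_le_trans rp rp'.
have q0 : 0 < r ^+ p / (A p)%:num by rewrite divr_gt0.
have q0' : 0 < r' ^+ p / (A p)%:num by rewrite divr_gt0.
by apply/orP; right; rewrite ler_ln// ler_pM2r// invr_gt0.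
Qed.

Lemma weighted_norm_ge0 h phi : (0 <= weighted_norm h phi)%E.
Proof.
apply: ereal_sup_ge; exists (expeR (assoc_fun A (h%:num * eucl (0 : 'rV[R]_d)))
  * (normc (phi 0))%:E)%E; first by exists 0.
by rewrite mule_ge0 ?expeR_ge0// lee_fin; case: (phi 0) => a b; exact: sqrtr_ge0.
Qed.

Lemma gs_norm_ge0 h phi : (0 <= gs_norm h phi)%E.
Proof.
apply: ereal_sup_ge; eexists; first by exists (fun _ => 0%N).
by rewrite mule_ge0 ?weighted_norm_ge0// lee_fin divr_ge0// exprn_ge0.
Qed.

Lemma le_gs_norm h h' phi : h%:num <= h'%:num ->
  (gs_norm h phi <= gs_norm h' phi)%E.
Proof.
move=> hh'; apply: ge_ereal_sup => _ [al _ <-].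
apply: (@le_trans _ _ ((h'%:num ^+ multi_abs al / (M (multi_abs al))%:num)%:E *
    weighted_norm h' (mD al phi))%E); last by apply: ereal_sup_ubound; exists al.
apply: lee_pmul; rewrite ?weighted_norm_ge0// ?lee_fin ?divr_ge0 ?exprn_ge0//.
  by rewrite ler_pM2r ?invr_gt0// lerXn2r// nnegrE.
apply: ge_ereal_sup => _ [x _ <-].
apply: (@le_trans _ _ (expeR (assoc_fun A (h'%:num * eucl x)) *
    (normc (mD al phi x))%:E)%E); last by apply: ereal_sup_ubound; exists x.
rewrite lee_wpmul2r//.
  by rewrite lee_fin; case: (mD al phi x) => a b; exact: sqrtr_ge0.
rewrite lee_expeR le_assoc_fun ?mulr_ge0 ?sqrtr_ge0//.
by rewrite ler_wpM2r ?sqrtr_ge0.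
Qed.

Lemma gs_norm_linear h (a : R[i]) phi psi : smooth phi -> smooth psi ->
  (gs_norm h (fun x => (a * phi x + psi x)%R) <=
   (normc a)%:E * gs_norm h phi + gs_norm h psi)%E.
Proof.
move=> sphi spsi.
have nc_ge0 (z : R[i]) : 0 <= normc z by case: z => b c; exact: sqrtr_ge0.
apply: ge_ereal_sup => _ [al _ <-].
have c0 : 0 <= h%:num ^+ multi_abs al / (M (multi_abs al))%:num.
  by rewrite divr_ge0// exprn_ge0.
set c := (_ / _) in c0 *.
apply: (@le_trans _ _ (c%:E * ((normc a)%:E * weighted_norm h (mD al phi) +
   weighted_norm h (mD al psi)))%E).
  rewrite lee_wpmul2l ?lee_fin//; apply: ge_ereal_sup => _ [x _ <-].
  rewrite mD_linear//; set w := expeR _.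
  have w0 : (0 <= w)%E by exact: expeR_ge0.
  apply: (@le_trans _ _ (w * ((normc a)%:E * (normc (mD al phi x))%:E +
     (normc (mD al psi x))%:E))%E).
    by rewrite lee_wpmul2l// -EFinM -EFinD lee_fin -normcM le_normcD.
  rewrite ge0_muleDr ?lee_fin ?mulr_ge0//.
  apply: leeD.
    by rewrite muleCA lee_wpmul2l ?lee_fin//; apply: ereal_sup_ubound; exists x.
  by apply: ereal_sup_ubound; exists x.
rewrite ge0_muleDr ?mule_ge0 ?lee_fin ?weighted_norm_ge0//; apply: leeD.
  by rewrite muleCA lee_wpmul2l ?lee_fin//; apply: ereal_sup_ubound; exists al.
by apply: ereal_sup_ubound; exists al.
Qed.

Lemma gs_norm0 h : gs_norm h (fun _ => 0) = 0%E.
Proof.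
have mD0 al : mD al (fun _ : 'rV[R]_d => 0 : R[i]) = fun _ => 0.
  apply/funext => x; have := @mD_linear R d al (-1) _ _ x (@smooth0 R d) (@smooth0 R d).
  rewrite [X in mD _ X](_ : _ = fun _ => 0); last first.
    by apply/funext => y; rewrite mulr0 addr0.
  by rewrite mulN1r addNr.
apply/eqP; rewrite eq_le gs_norm_ge0 andbT.
apply: ge_ereal_sup => _ [al _ <-]; rewrite mD0.
rewrite (_ : weighted_norm _ _ = 0%E) ?mule0//.
apply/eqP; rewrite eq_le weighted_norm_ge0 andbT.
by apply: ge_ereal_sup => _ [x _ <-]; rewrite normc0 mule0.
Qed.

Lemma gs_norm_eq0 h phi : gs_norm h phi = 0%E -> phi = fun _ => 0.
Proof.
move=> phi0; apply/funext => x; apply: eq0_normc; apply/eqP.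
have nc_ge0 : 0 <= normc (phi x) by case: (phi x) => b c; exact: sqrtr_ge0.
rewrite eq_le nc_ge0 andbT -lee_fin.
have abs0 : multi_abs (fun _ : 'I_d => 0%N) = 0%N by rewrite /multi_abs big1.
have mD0 : mD (fun _ => 0%N) phi = phi.
  apply/funext => y; rewrite /mD abs0 expr0 mul1r /mpartial.
  by elim: (enum 'I_d).
have W : (weighted_norm h phi <= 0)%E.
  have : ((h%:num ^+ 0 / (M 0%N)%:num)%:E * weighted_norm h phi <= 0)%E.
    rewrite -phi0; apply: ereal_sup_ubound; exists (fun _ => 0%N) => //=.
    by rewrite abs0 mD0.
  by rewrite expr0 div1r pmule_rle0// lte_fin invr_gt0.
apply: le_trans W; apply: (@le_trans _ _
    (expeR (assoc_fun A (h%:num * eucl x)) * (normc (phi x))%:E)%E); last first.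
  by apply: ereal_sup_ubound; exists x.
rewrite -[leLHS]mul1e lee_wpmul2r ?lee_fin// -expeR0 lee_expeR.
apply: ereal_sup_ge; eexists; first by exists 0%N.
by rewrite lee_fin le_max lexx.
Qed.

Definition in_step h : {pred 'rV[R]_d -> R[i]} :=
  fun phi => `[< smooth phi /\ (gs_norm h phi < +oo)%E >].

Definition in_beurling : {pred 'rV[R]_d -> R[i]} :=
  fun phi => `[< smooth phi /\ forall h, (gs_norm h phi < +oo)%E >].

Definition in_roumieu : {pred 'rV[R]_d -> R[i]} :=
  fun phi => `[< smooth phi /\ exists h, (gs_norm h phi < +oo)%E >].

Local Lemma gs_norm_linear_lty h (a : R[i]) phi psi : smooth phi -> smooth psi ->
  (gs_norm h phi < +oo)%E -> (gs_norm h psi < +oo)%E ->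
  (gs_norm h (a *: phi + psi)%R < +oo)%E.
Proof.
move=> sphi spsi fphi fpsi; apply: le_lt_trans (gs_norm_linear h a sphi spsi) _.
by rewrite lte_add_pinfty// lte_mul_pinfty// lee_fin; case: a => b c; exact: sqrtr_ge0.
Qed.

Lemma in_step_submod h : submod_closed (in_step h).
Proof.
split; first by apply/asboolP; split; [exact: smooth0|rewrite gs_norm0].
move=> a phi psi /asboolP[sphi fphi] /asboolP[spsi fpsi]; apply/asboolP; split.
  exact: smooth_linear.
exact: gs_norm_linear_lty.
Qed.

Lemma in_beurling_submod : submod_closed in_beurling.
Proof.
split; first by apply/asboolP; split=> [|h]; [exact: smooth0|rewrite gs_norm0].
move=> a phi psi /asboolP[sphi fphi] /asboolP[spsi fpsi]; apply/asboolP; split.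
  exact: smooth_linear.
by move=> h; exact: gs_norm_linear_lty.
Qed.

Lemma in_roumieu_submod : submod_closed in_roumieu.
Proof.
split.
  by apply/asboolP; split; [exact: smooth0|exists 1%:pos%R; rewrite gs_norm0].
move=> a phi psi /asboolP[sphi [h fphi]] /asboolP[spsi [k fpsi]].
apply/asboolP; split; first exact: smooth_linear.
have [m [mh mk]] : exists m : {posnum R},
    m%:num <= h%:num /\ m%:num <= k%:num.
  by have [hk|/ltW kh] := leP h%:num k%:num; [exists h|exists k].
have {}fphi := le_lt_trans (le_gs_norm phi mh) fphi.
have {}fpsi := le_lt_trans (le_gs_norm psi mk) fpsi.
by exists m; exact: gs_norm_linear_lty.
Qed.

HB.instance Definition _ h :=
  GRing.isSubmodClosed.Build R[i] _ (in_step h) (in_step_submod h).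
HB.instance Definition _ :=
  GRing.isSubmodClosed.Build R[i] _ in_beurling in_beurling_submod.
HB.instance Definition _ :=
  GRing.isSubmodClosed.Build R[i] _ in_roumieu in_roumieu_submod.

Lemma in_beurling_step h : {subset in_beurling <= in_step h}.
Proof. by move=> phi /asboolP[sphi fphi]; apply/asboolP. Qed.

Lemma in_step_roumieu h : {subset in_step h <= in_roumieu}.
Proof.
by move=> phi /asboolP[sphi fphi]; apply/asboolP; split=> //; exists h.
Qed.

Definition gs_step h : Type := subspace_of (in_step h).

HB.instance Definition _ h := GRing.Lmodule.on (gs_step h).

Section step_norm.
Variable h : {posnum R}.

Definition step_norm (phi : gs_step h) : R[i] :=
  (fine (gs_norm h (subspace_val phi)))%:C.

Local Lemma stepP (phi : gs_step h) : smooth (subspace_val phi) /\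
  gs_norm h (subspace_val phi) \is a fin_num.
Proof.
case: phi => phi /= /asboolP[sphi fphi]; split=> //.
by rewrite ge0_fin_numE// gs_norm_ge0.
Qed.

Local Lemma step_norm_linear a (x y : gs_step h) :
  step_norm (a *: x + y) <= `|a| * step_norm x + step_norm y.
Proof.
have [sx fx] := stepP x; have [sy fy] := stepP y.
have [_ fxy] := stepP (a *: x + y).
rewrite normc_def -rmorphM -rmorphD/= lecR -lee_fin EFinD EFinM !fineK//.
by have := gs_norm_linear h a sx sy; case: a fxy.
Qed.

Lemma step_normD x y : step_norm (x + y) <= step_norm x + step_norm y.
Proof. by have := step_norm_linear 1 x y; rewrite scale1r normr1 mul1r. Qed.

Local Lemma step_norm0 : step_norm 0 = 0.
Proof. by rewrite /step_norm gs_norm0. Qed.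

Lemma step_normZ a x : step_norm (a *: x) = `|a| * step_norm x.
Proof.
have le b y : step_norm (b *: y) <= `|b| * step_norm y.
  by have := step_norm_linear b y 0; rewrite step_norm0 !addr0.
have [->|a0] := eqVneq a 0; first by rewrite scale0r normr0 mul0r step_norm0.
apply/eqP; rewrite eq_le le/=.
have := le a^-1 (a *: x); rewrite scalerA mulVf// scale1r normfV.
by rewrite -ler_pdivrMl ?invr_gt0 ?normr_gt0// invrK.
Qed.

Lemma step_norm_eq0 x : step_norm x = 0 -> x = 0.
Proof.
have [_ fx] := stepP x.
move=> /complexI x0; apply/val_inj; apply: (@gs_norm_eq0 h).
by rewrite -[LHS]fineK// x0.
Qed.

HB.instance Definition _ := Lmodule_isNormed.Build R[i] (gs_step h)
  step_normD step_normZ step_norm_eq0.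

End step_norm.

Definition beurling_space :=
  proj_lim (fun h => inclusion (@in_beurling_step h) :
    {linear subspace_of in_beurling -> gs_step h}).

Definition roumieu_space :=
  ind_lim (fun h => inclusion (@in_step_roumieu h) :
    {linear gs_step h -> subspace_of in_roumieu}).

End gelfand_shilov.

Section weight_conditions.
Context (R : realType).
Implicit Types M : nat -> {posnum R}.

Definition cond_M1 M := forall p, (0 < p)%N ->
  (M p)%:num ^+ 2 <= (M p.-1)%:num * (M p.+1)%:num.

Definition cond_M2 (c0 H : R) M := forall p,
  (M p)%:num <= c0 * H ^+ p *
    \big[Num.min/(M p)%:num * (M 0%N)%:num]_(q < p.+1)
      ((M (p - q)%N)%:num * (M q)%:num).

Definition cond_M5 M := exists q c0 : R, [/\ 0 < q, 1 <= c0 &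
  forall p, (0 < p)%N ->
  (\sum_(p.+1 <= j <oo) ((M j.-1)%:num `^ q / (M j)%:num `^ q)%:E <=
   (c0 * p%:R * ((M p)%:num `^ q / (M p.+1)%:num `^ q))%:E)%E].

Definition cond_M6 M := exists c0 L0 : R, [/\ 1 <= c0, 1 <= L0 &
  forall p, p`!%:R <= c0 * L0 ^+ p * (M p)%:num].

End weight_conditions.

(* Main.v *)
From HB Require Import structures.
Require Import Defs.
From mathcomp Require Import all_boot all_order all_algebra.
From mathcomp Require Import all_classical all_reals all_analysis.
From mathcomp Require Import complex.
From mathcomp Require Import generic_quotient.
From mathcomp Require Import ring lra zify.

(**
Call a seminorm p summing with respect to q when there are countably many
linear functionals f_i and numbers a_i with finite sum such that
|f_i x| <= a_i q(x) and p(x) <= sup_i |f_i x|.  The proof shows that the norm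
of scale h' is summing with respect to the norm of scale h = 2 d H h'
([summing_gs]), and that this property forces the canonical maps between
completions to be nuclear ([summing_nuclear_link]).

The functionals come from Faber-Schauder expansions.  A continuous function on
[0, 1] is controlled by its two end values and its second differences at dyadic
midpoints: with weights (4/3)^j at level j the supremum of the function is at
most 5 times the supremum of the weighted coefficients ([coef_sup]), while for
a C^2 function the second differences are of order 4^-j, so that the 2^j
weighted coefficients of level j are of order 3^-j and form a summable family
([coef_le]).  Iterating over the d coordinates gives the same on unit cubes, at
the price of 2d derivatives ([box_coef_sup], [box_coef_le]).  These functionals
are applied to every derivative of phi on every cube k + [0, 1]^d with k in
Z^d.  Passing from h' to h pays for the rest through [cond_M2]: on the side of
M it absorbs the 2d extra derivatives and leaves 2^-|alpha| ([order_ratio]); on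
the side of A it gains the factor (1 + |x|)^(2d) that makes the sum over the
cubes converge, [cond_M6] ensuring that the suprema over bounded sets
are finite ([pow_bound], [cube_weight]).

Let p be summing with respect to q through (f_i).  Then p(x) is at most the
l^2 norm of (f_i x), which is a hilbertian seminorm dominated by q
([hilbertian_of_summing]); with one more scale, p is therefore summing with
respect to a hilbertian seminorm N.  Orthogonal projection of l^2 onto the
closed range of x |-> (f_i x) then produces vectors u_i in the completion E_p
such that the canonical map is x |-> sum_i f_i(x) u_i, and N may further be
replaced by its quotient along a linear surjection, because minimal lifts in a
pre-Hilbert space depend linearly on the vector lifted.  Minimal lifts exist
only in completions; [lift_limit] replaces them by limits along nearly minimal
ones and is the only form of the projection theorem used.

The Roumieu space is the quotient of the direct sum of its steps at the
scales h_k = 1/(k+1).  On the direct sum, a weighted l^2 sum of hilbertian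
seminorms N_k is again hilbertian, and rescaling the functionals of the k-th
step keeps the whole family summable ([inductive_nuclear_link]).  The Beurling
space is covered by the same statement, with a constant family of steps.
*)

Set Implicit Arguments.
Unset Strict Implicit.
Unset Printing Implicit Defensive.

Import Order.TTheory GRing.Theory Num.Theory.
Import numFieldNormedType.Exports.

Local Open Scope classical_set_scope.
Local Open Scope ring_scope.
Local Open Scope complex_scope.
Local Open Scope quotient_scope.

(** * Real-valued norms over the complex numbers *)

Lemma sq_le (R : realDomainType) (u v : R) : 0 <= u -> u <= v -> u ^+ 2 <= v ^+ 2.
Proof. by move=> u0 uv; rewrite ler_sqr ?nnegrE// (le_trans u0). Qed.

Lemma small_harmonic (R : realType) (e : R) : 0 < e ->
  exists N : nat, forall k, (N <= k)%N -> k.+1%:R^-1 < e.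
Proof.
move=> e0; exists (Num.truncn e^-1) => k Nk.
rewrite invf_plt ?posrE//; apply: lt_le_trans (truncnS_gt _) _.
by rewrite ler_nat.
Qed.

Section real_norm.
Context (R : realType).
Local Notation C := R[i].

(** The norm takes its values in R[i]; this is the same number read in R. *)
Definition rn (V : normedZmodType C) (v : V) : R := complex.Re `|v|.

Section zmod.
Context (V : normedZmodType C).
Implicit Types u v w : V.

Lemma rnE v : `|v| = (rn v)%:C.
Proof. by rewrite RRe_real// normr_real. Qed.

Lemma rn_ge0 v : 0 <= rn v.
Proof. by rewrite -lecR -rnE normr_ge0. Qed.

Lemma rnD u v : rn (u + v) <= rn u + rn v.
Proof. by rewrite -lecR rmorphD/= -!rnE ler_normD. Qed.

Lemma rnN v : rn (- v) = rn v.
Proof. by rewrite /rn normrN. Qed.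

Lemma rnB u v : rn (u - v) = rn (v - u).
Proof. by rewrite -opprB rnN. Qed.

Lemma rn0 : rn (0 : V) = 0.
Proof. by rewrite /rn normr0. Qed.

Lemma rn0_eq0 v : rn v = 0 -> v = 0.
Proof. by move=> v0; apply/eqP; rewrite -normr_eq0 rnE v0. Qed.

Lemma rn_dist w u v : rn (u - v) <= rn (u - w) + rn (w - v).
Proof. by rewrite -[u - v](subrKA w) rnD. Qed.

Lemma rn_sum (I : Type) (s : seq I) (P : pred I) (F : I -> V) :
  rn (\sum_(i <- s | P i) F i) <= \sum_(i <- s | P i) rn (F i).
Proof.
elim/big_ind2 : _ => [|x x' y y' xx' yy'|//]; first by rewrite rn0.
by rewrite (le_trans (rnD _ _))// lerD.
Qed.

End zmod.

Lemma rnM (a b : C) : rn (a * b) = rn a * rn b.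
Proof. by apply: complexI; rewrite rmorphM/= -!rnE normrM. Qed.

Lemma rnZ (V : normedModType C) (a : C) (v : V) : rn (a *: v) = rn a * rn v.
Proof. by apply: complexI; rewrite rmorphM/= -!rnE normrZ. Qed.

Lemma rn_real (x : R) : rn x%:C = `|x|.
Proof. by rewrite /rn normc_def/= expr0n addr0 sqrtr_sqr. Qed.

Lemma rn_normc (a : C) : rn a = ComplexField.Normc.normc a.
Proof. by case: a => a b; rewrite /rn normc_def. Qed.

Lemma rn1 : rn (1 : C) = 1.
Proof. by rewrite (rn_real 1) normr1. Qed.

Lemma rnV (a : C) : rn a^-1 = (rn a)^-1.
Proof. by rewrite !rn_normc ComplexField.Normc.normcV. Qed.

Lemma rn_sqr (a : C) : rn a ^+ 2 = complex.Re a ^+ 2 + complex.Im a ^+ 2.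
Proof.
by apply: complexI; rewrite rmorphXn/= -rnE -add_Re2_Im2.
Qed.

Lemma rn_Re (a : C) : `|complex.Re a| <= rn a.
Proof.
rewrite -(@ler_pXn2r _ 2)// ?nnegrE ?rn_ge0// rn_sqr real_normK ?num_real//.
by rewrite lerDl sqr_ge0.
Qed.

Lemma rn_Im (a : C) : `|complex.Im a| <= rn a.
Proof.
rewrite -(@ler_pXn2r _ 2)// ?nnegrE ?rn_ge0// rn_sqr real_normK ?num_real//.
by rewrite lerDr sqr_ge0.
Qed.

Lemma rn_le_ReIm (a : C) : rn a <= `|complex.Re a| + `|complex.Im a|.
Proof.
rewrite -(@ler_pXn2r _ 2)// ?nnegrE ?rn_ge0 ?addr_ge0// rn_sqr.
rewrite sqrrD !real_normK ?num_real// addrAC lerDl.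
by rewrite mulrn_wge0// mulr_ge0.
Qed.

Lemma parallelogram_C (a b : C) :
  rn (a + b) ^+ 2 + rn (a - b) ^+ 2 = 2 * rn a ^+ 2 + 2 * rn b ^+ 2.
Proof. by case: a b => a a' [b b']; rewrite !rn_sqr/=; ring. Qed.

(** Sequential notions with tolerances in R, whereas the filters of a space
    normed over R[i] use positive elements of R[i]. *)
Definition scvg (V : normedZmodType C) (u : nat -> V) (l : V) :=
  forall e : R, 0 < e -> exists N, forall n, (N <= n)%N -> rn (u n - l) < e.

Definition scauchy (V : normedZmodType C) (u : nat -> V) :=
  forall e : R, 0 < e -> exists N, forall m n, (N <= m)%N -> (N <= n)%N ->
    rn (u m - u n) < e.

Definition scomplete (V : normedZmodType C) :=
  forall u : nat -> V, scauchy u -> exists l, scvg u l.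

Lemma complex_gt0 (e : C) : 0 < e -> exists2 e' : R, 0 < e' & e = e'%:C.
Proof.
move=> e0; exists (complex.Re e); last by rewrite RRe_real// gtr0_real.
by move: e0; rewrite ltcE/= => /andP[].
Qed.

Lemma scvgP (V : normedModType C) (u : nat -> V) (l : V) :
  scvg u l <-> u @ \oo --> l.
Proof.
split=> [ul|/cvgrPdist_lt ul e e0].
  apply/cvgrPdist_lt => _ /complex_gt0[e e0 ->].
  have [N HN] := ul e e0; exists N => // n /= Nn.
  by rewrite distrC rnE ltcR HN.
have [|N _ HN] := ul e%:C; first by rewrite ltcR.
by exists N => n Nn; have := HN _ Nn; rewrite /= distrC rnE ltcR.
Qed.

Lemma complete_scomplete (B : completeNormedModType C) : scomplete B.
Proof.
move=> u cu.
have : cauchy (u @ \oo).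
  apply/cauchyP.
  move=> _ /complex_gt0[e e0 ->]; have [N HN] := cu e e0.
  exists (u N); exists N => // n /= Nn; rewrite -ball_normE/= rnE ltcR.
  by apply: HN.
by move=> /cauchy_cvg/cvg_ex[l /scvgP ul]; exists l.
Qed.

Lemma scomplete_C : scomplete (C^o : normedModType C).
Proof.
move=> u cu.
pose re n := complex.Re (u n); pose im n := complex.Im (u n).
have cauch (v : nat -> R) :
    (forall m n, `|v m - v n| <= rn (u m - u n)) -> exists l : R, v @ \oo --> l.
  move=> vu; apply/cvg_ex; apply: cauchy_cvg; apply/cauchyP.
  move=> e e0; have [N HN] := cu e e0.
  exists (v N); exists N => // n /= Nn; rewrite -ball_normE/=.
  by rewrite (le_lt_trans (vu _ _))// HN.
have ReB (a b : C) : complex.Re a - complex.Re b = complex.Re (a - b) by case: a b => ? ? [].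
have ImB (a b : C) : complex.Im a - complex.Im b = complex.Im (a - b) by case: a b => ? ? [].
have [|lr /cvgrPdist_lt lre] := cauch re; first by move=> m n; rewrite /re ReB rn_Re.
have [|li /cvgrPdist_lt lim] := cauch im; first by move=> m n; rewrite /im ImB rn_Im.
exists (lr +i* li) => e e0; have e2 : 0 < e / 2 by rewrite divr_gt0.
have [N _ HN] := lre _ e2; have [N' _ HN'] := lim _ e2.
exists (maxn N N') => n; rewrite geq_max => /andP[/HN/= h /HN'/= h'].
apply: le_lt_trans (rn_le_ReIm _) _.
move: h h'; rewrite /re /im distrC [X in _ -> X < _ -> _]distrC.
by case: (u n) => a b /=; lra.
Qed.

End real_norm.

(** * Seminorms and completions *)

Section real_seminorm.
Context (R : realType).
Local Notation C := R[i].

Definition rseminorm (E : lmodType C) (n : E -> R) :=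
  (forall x y, n (x + y) <= n x + n y) /\
  (forall a x, n (a *: x) = rn a * n x).

Section theory.
Context (E : lmodType C) (n : E -> R) (nP : rseminorm n).

Lemma rseminorm0 : n 0 = 0.
Proof. by rewrite -(scale0r 0) nP.2 rn0 mul0r. Qed.

Lemma rseminormN x : n (- x) = n x.
Proof. by rewrite -scaleN1r nP.2 rnN rn1 mul1r. Qed.

Lemma rseminorm_ge0 x : 0 <= n x.
Proof.
have := nP.1 x (- x); rewrite subrr rseminorm0 rseminormN.
by rewrite -mulr2n pmulrn_lge0.
Qed.

Lemma rseminormB x y : n (x - y) = n (y - x).
Proof. by rewrite -opprB rseminormN. Qed.

Lemma rseminorm_dist z x y : n (x - y) <= n (x - z) + n (z - y).
Proof. by rewrite -[x - y](subrKA z) nP.1. Qed.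

Lemma rseminorm_abs x y : `|n x - n y| <= n (x - y).
Proof.
rewrite ler_norml; apply/andP; split.
  rewrite lerNl opprB lerBlDr rseminormB.
  by have := nP.1 (y - x) x; rewrite subrK.
by rewrite lerBlDr; have := nP.1 (x - y) y; rewrite subrK.
Qed.

Lemma rseminorm_sum (I : Type) (s : seq I) (P : pred I) (F : I -> E) :
  n (\sum_(i <- s | P i) F i) <= \sum_(i <- s | P i) n (F i).
Proof.
elim/big_ind2 : _ => [|x x' y y' xx' yy'|//]; first by rewrite rseminorm0.
by rewrite (le_trans (nP.1 _ _))// lerD.
Qed.

Local Lemma seminorm_ofD x y : (n (x + y))%:C <= (n x)%:C + (n y)%:C.
Proof. by rewrite -rmorphD lecR nP.1. Qed.

Local Lemma seminorm_ofZ a x : (n (a *: x))%:C = `|a| * (n x)%:C.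
Proof. by rewrite rnE -rmorphM nP.2. Qed.

Definition seminorm_of : seminorm E := Seminorm seminorm_ofD seminorm_ofZ.

End theory.

Definition real_part (E : lmodType C) (p : seminorm E) (x : E) : R :=
  complex.Re (p x).

Lemma real_partE (E : lmodType C) (p : seminorm E) x :
  p x = (real_part p x)%:C.
Proof. by rewrite RRe_real// ger0_real// seminorm_ge0. Qed.

Lemma real_part_seminorm (E : lmodType C) (p : seminorm E) :
  rseminorm (real_part p).
Proof.
split=> [x y|a x]; first by rewrite -lecR rmorphD/= -!real_partE seminormD.
by apply: complexI; rewrite rmorphM/= -!real_partE seminormZ rnE.
Qed.

Lemma rn_seminorm (V : normedModType C) : rseminorm (@rn R V).
Proof. by split=> [x y|a x]; [exact: rnD|exact: rnZ]. Qed.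

End real_seminorm.

Section completion.
Context (R : realType).
Local Notation C := R[i].
Context (E : lmodType C) (n : E -> R) (nP : rseminorm n).

Definition cauchy_pred : {pred nat -> E} := fun u =>
  `[< forall e : R, 0 < e -> exists N, forall k l, (N <= k)%N -> (N <= l)%N ->
      n (u k - u l) < e >].

Lemma cauchy_pred_submod : submod_closed cauchy_pred.
Proof.
split.
  by apply/asboolP => e e0; exists 0%N => k l _ _; rewrite subrr rseminorm0.
move=> a u v /asboolP cu /asboolP cv; apply/asboolP => e e0.
have A0 : 0 < rn a + 1 by rewrite ltr_wpDl ?rn_ge0.
have [|N HN] := cu (e / 2 / (rn a + 1)); first by rewrite !divr_gt0.
have [|N' HN'] := cv (e / 2); first by rewrite divr_gt0.
exists (maxn N N') => k l; rewrite !geq_max => /andP[Nk N'k] /andP[Nl N'l].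
have -> : (a *: u + v) k - (a *: u + v) l = a *: (u k - u l) + (v k - v l).
  by rewrite !addrfctE !scalrfctE scalerBr opprD addrACA.
rewrite (le_lt_trans (nP.1 _ _))// nP.2 (splitr e) ler_ltD//; last exact: HN'.
have /ltW := HN _ _ Nk Nl; rewrite ler_pdivlMr// mulrC; apply: le_trans.
by rewrite ler_wpM2r ?rseminorm_ge0// lerDl.
Qed.

HB.instance Definition _ :=
  GRing.isSubmodClosed.Build C _ cauchy_pred cauchy_pred_submod.

Definition cseq : Type := subspace_of cauchy_pred.
HB.instance Definition _ := GRing.Lmodule.on cseq.

Definition cval (u : cseq) : nat -> E := subspace_val u.

Lemma cvalD u v : cval (u + v) = cval u + cval v. Proof. by []. Qed.
Lemma cvalZ a u : cval (a *: u) = a *: cval u. Proof. by []. Qed.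

Lemma cseqP (u : cseq) (e : R) : 0 < e ->
  exists N, forall k l, (N <= k)%N -> (N <= l)%N -> n (cval u k - cval u l) < e.
Proof. by case: u => u i; have /asboolP ui := i; exact: ui. Qed.

Definition cnorm (u : cseq) : R := limn (fun k => n (cval u k) : R^o).

Lemma cnorm_cvg u : (fun k => n (cval u k)) @ \oo --> cnorm u.
Proof.
have : cvgn (fun k => n (cval u k) : R^o).
  apply: cauchy_cvg; apply/cauchyP => e e0.
  have [N HN] := cseqP u e0.
  exists (n (cval u N)); exists N => // k /= Nk.
  by rewrite -ball_normE/= (le_lt_trans (rseminorm_abs nP _ _))// HN.
by [].
Qed.

Lemma cnormP u (e : R) : 0 < e ->
  exists N, forall k, (N <= k)%N -> `|cnorm u - n (cval u k)| < e.
Proof.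
by move=> e0; have /cvgrPdist_lt/(_ _ e0)[N _ HN] := @cnorm_cvg u; exists N.
Qed.

Lemma cnorm_seminorm : rseminorm cnorm.
Proof.
split=> [u v|a u].
  apply/ler_addgt0Pr => e e0; have e3 : 0 < e / 3 by rewrite divr_gt0.
  have [N1 H1] := cnormP u e3; have [N2 H2] := cnormP v e3.
  have [N3 H3] := cnormP (u + v) e3.
  set k := maxn N1 (maxn N2 N3).
  have k1 : (N1 <= k)%N by rewrite leq_maxl.
  have k2 : (N2 <= k)%N by rewrite /k maxnCA leq_maxl.
  have k3 : (N3 <= k)%N by rewrite /k maxnA leq_maxr.
  have := H1 _ k1; have := H2 _ k2; have := H3 _ k3.
  have := nP.1 (cval u k) (cval v k); rewrite !ltr_norml.
  rewrite cvalD addrfctE.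
  by move=> h /andP[_ h1] /andP[h2 _] /andP[h3 _]; lra.
have : (fun k => n (cval (a *: u) k)) @ \oo --> rn a * cnorm u.
  rewrite (_ : (fun k => _) = (fun k => rn a * n (cval u k))).
    exact: (cvgM (cvg_cst (rn a)) (@cnorm_cvg u)).
  by apply/funext => k; rewrite cvalZ scalrfctE nP.2.
by move=> /cvg_lim <-.
Qed.

Lemma cnorm_le u (e : R) (N : nat) :
  (forall k, (N <= k)%N -> n (cval u k) <= e) -> cnorm u <= e.
Proof.
move=> ue; apply/ler_addgt0Pr => e' /(cnormP u)[N' HN'].
have := HN' _ (leq_maxl N' N); have := ue _ (leq_maxr N' N).
by rewrite ltr_norml => h1 /andP[_ h2]; lra.
Qed.

Definition crel (u v : cseq) := cnorm (u - v) == 0.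

Lemma crel_refl : reflexive crel.
Proof. by move=> u; rewrite /crel subrr (rseminorm0 cnorm_seminorm). Qed.

Lemma crel_sym : symmetric crel.
Proof. by move=> u v; rewrite /crel (rseminormB cnorm_seminorm). Qed.

Lemma crel_trans : transitive crel.
Proof.
move=> v u w /eqP uv /eqP vw; rewrite /crel eq_le.
rewrite (rseminorm_ge0 cnorm_seminorm) andbT.
by rewrite (le_trans (rseminorm_dist cnorm_seminorm v _ _))// uv vw addr0.
Qed.

Canonical crel_equiv := EquivRel crel crel_refl crel_sym crel_trans.

(** Cauchy sequences modulo the sequences whose seminorm tends to 0. *)
Definition completion : Type := {eq_quot crel}.
HB.instance Definition _ := Choice.on completion.

Definition ccls (u : cseq) : completion := \pi_({eq_quot crel}) u.
Definition crep (x : completion) : cseq := repr (x : {eq_quot crel}).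

Lemma crepK x : ccls (crep x) = x.
Proof. exact: reprK. Qed.

Lemma cclsP u v : ccls u = ccls v <-> cnorm (u - v) = 0.
Proof.
split=> [/eqmodP/eqP//|/eqP uv]; exact/eqmodP.
Qed.

Lemma crep_ccls u : cnorm (crep (ccls u) - u) = 0.
Proof. by apply/cclsP; rewrite crepK. Qed.

Definition cadd x y := ccls (crep x + crep y).
Definition copp x := ccls (- crep x).
Definition cscale a x := ccls (a *: crep x).

Let N0 u v : cnorm u = 0 -> cnorm v = 0 -> cnorm (u + v) = 0.
Proof.
move=> u0 v0; apply/eqP; rewrite eq_le (rseminorm_ge0 cnorm_seminorm) andbT.
by rewrite (le_trans (cnorm_seminorm.1 _ _))// u0 v0 addr0.
Qed.

Lemma caddE u v : cadd (ccls u) (ccls v) = ccls (u + v).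
Proof.
by apply/cclsP; rewrite opprD addrACA; apply: N0; exact: crep_ccls.
Qed.

Lemma cscaleE a u : cscale a (ccls u) = ccls (a *: u).
Proof.
by apply/cclsP; rewrite -scalerBr cnorm_seminorm.2 crep_ccls mulr0.
Qed.

Lemma coppE u : copp (ccls u) = ccls (- u).
Proof. by rewrite -scaleN1r -cscaleE /cscale scaleN1r. Qed.

Let caddA : associative cadd.
Proof.
by move=> x y z; rewrite -(crepK x) -(crepK y) -(crepK z) !caddE addrA.
Qed.
Let caddC : commutative cadd.
Proof. by move=> x y; rewrite -(crepK x) -(crepK y) !caddE addrC. Qed.
Let cadd0 : left_id (ccls 0) cadd.
Proof. by move=> x; rewrite -(crepK x) !caddE add0r. Qed.
Let caddN : left_inverse (ccls 0) copp cadd.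
Proof. by move=> x; rewrite -(crepK x) coppE !caddE addNr. Qed.

HB.instance Definition _ :=
  GRing.isZmodule.Build completion caddA caddC cadd0 caddN.

Let addE x y : x + y = cadd x y :> completion. Proof. by []. Qed.

Let cscaleA a b x : cscale a (cscale b x) = cscale (a * b) x.
Proof. by rewrite -(crepK x) !cscaleE scalerA. Qed.
Let cscale1 : left_id 1 cscale.
Proof. by move=> x; rewrite -(crepK x) !cscaleE scale1r. Qed.
Let cscaleDr : right_distributive cscale +%R.
Proof.
move=> a x y; rewrite -(crepK x) -(crepK y).
by rewrite addE !caddE !cscaleE addE !caddE scalerDr.
Qed.
Let cscaleDl x : {morph cscale^~ x : a b / a + b}.
Proof.
by move=> a b; rewrite -(crepK x) addE !cscaleE !caddE scalerDl.
Qed.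

HB.instance Definition _ := GRing.Zmodule_isLmodule.Build C completion
  cscaleA cscale1 cscaleDr cscaleDl.

Lemma ccls_linear : linear ccls.
Proof. by move=> a u v; rewrite -caddE -cscaleE. Qed.

HB.instance Definition _ := GRing.isLinear.Build C cseq completion _ ccls
  ccls_linear.

Definition qnorm (x : completion) : C := (cnorm (crep x))%:C.

Lemma qnormE u : qnorm (ccls u) = (cnorm u)%:C.
Proof.
congr (_%:C); apply/eqP; rewrite -subr_eq0 -normr_le0 -(crep_ccls u).
exact: rseminorm_abs cnorm_seminorm _ _.
Qed.

Let qnormD x y : qnorm (x + y) <= qnorm x + qnorm y.
Proof.
rewrite -(crepK x) -(crepK y) -linearD !qnormE -rmorphD lecR.
exact: cnorm_seminorm.1.
Qed.
Let qnormZ a x : qnorm (a *: x) = `|a| * qnorm x.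
Proof.
by rewrite -(crepK x) -linearZ !qnormE rnE -rmorphM cnorm_seminorm.2.
Qed.
Let qnorm0 x : qnorm x = 0 -> x = 0.
Proof.
rewrite -(crepK x) qnormE => /complexI x0.
by rewrite -(raddf0 ccls); apply/cclsP; rewrite subr0.
Qed.

HB.instance Definition _ := Lmodule_isNormed.Build C completion
  qnormD qnormZ qnorm0.

Lemma rn_ccls u : rn (ccls u) = cnorm u.
Proof. by rewrite /rn; have -> : `|ccls u| = (cnorm u)%:C by exact: qnormE. Qed.

Lemma cst_cauchy (x : E) : (fun=> x) \in cauchy_pred.
Proof.
by apply/asboolP => e e0; exists 0%N => k l _ _; rewrite subrr rseminorm0.
Qed.

Definition cinj (x : E) : completion := ccls (SubspaceOf (cst_cauchy x)).

Lemma cinj_linear : linear cinj.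
Proof.
move=> a x y; rewrite /cinj -linearP; congr ccls.
exact/val_inj.
Qed.

HB.instance Definition _ := GRing.isLinear.Build C E completion _ cinj
  cinj_linear.

Lemma rn_cinj x : rn (cinj x) = n x.
Proof.
rewrite rn_ccls; apply: cvg_lim; first exact: Rhausdorff.
exact: (cvg_cst (n x)).
Qed.

Lemma cinj_approx u (e : R) : 0 < e ->
  exists N, forall k, (N <= k)%N -> rn (ccls u - cinj (cval u k)) <= e.
Proof.
move=> e0; have [N HN] := cseqP u e0; exists N => k Nk.
rewrite /cinj -linearB rn_ccls; apply: (@cnorm_le _ _ N) => l Nl.
by rewrite ltW//; exact: HN.
Qed.

Lemma cinj_dense (x : completion) (e : R) : 0 < e ->
  exists y, rn (x - cinj y) <= e.
Proof.
move=> e0; rewrite -(crepK x); have [N HN] := cinj_approx (crep x) e0.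
by exists (cval (crep x) N); exact: HN.
Qed.

(** A sequence y is extracted from the Cauchy filter F, with y k within
    1/(k+1) of all points of some member of F; its class is the limit. *)
Lemma completion_complete (F : set_system completion) :
  ProperFilter F -> cauchy F -> cvg F.
Proof.
move=> FF /cauchyP cF.
have inv0 (k : nat) : 0 < k.+1%:R^-1 :> R by rewrite invr_gt0.
have H (k : nat) : exists y, F [set z | rn (cinj y - z) < k.+1%:R^-1].
  have e2 : 0 < k.+1%:R^-1 / 2 :> R by rewrite divr_gt0.
  have [|x Fx] := cF (k.+1%:R^-1 / 2)%:C; first by rewrite ltcR.
  have [y xy] := cinj_dense x e2; exists y; apply: filterS Fx => z.
  rewrite -ball_normE/= rnE ltcR => xz.
  move: (k.+1%:R^-1) xy xz => r xy xz.
  by have := rn_dist x (cinj y) z; rewrite rnB in xy; lra.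
have [y Fy] := choice H.
have yc : y \in cauchy_pred.
  apply/asboolP => e e0; have [|N HN] := @small_harmonic R (e / 2); first by rewrite divr_gt0.
  exists N => k l Nk Nl; rewrite -rn_cinj linearB/=.
  have [z [/= zk zl]] := filter_ex (filterI (Fy k) (Fy l)).
  move: (HN _ Nk) (HN _ Nl) zk zl.
  move: k.+1%:R^-1 l.+1%:R^-1 => r r' re re' zk zl.
  by have := rn_dist z (cinj (y k)) (cinj (y l)); rewrite rnB in zl; lra.
apply/cvg_ex; exists (ccls (SubspaceOf yc)).
apply/cvgrPdist_lt => _ /complex_gt0[e e0 ->].
have e2 : 0 < e / 2 by rewrite divr_gt0.
have [N HN] := cinj_approx (SubspaceOf yc) e2; have [N' HN'] := small_harmonic e2.
have := Fy (maxn N N'); apply: filterS => z /=; rewrite rnE ltcR.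
move: (HN' _ (leq_maxr N N')) (HN _ (leq_maxl N N')) => /=.
move: (maxn _ _).+1%:R^-1 => r re h hz.
by have := rn_dist (cinj (y (maxn N N'))) (ccls (SubspaceOf yc)) z; lra.
Qed.

HB.instance Definition _ := Uniform_isComplete.Build completion
  completion_complete.

Lemma completion_is_completion :
  @is_completion _ _ (seminorm_of nP) completion cinj.
Proof.
split=> [x|]; first by rewrite rnE rn_cinj.
move=> O [x Ox] oO.
have : nbhs x O by exact: open_nbhs_nbhs.
move=> /nbhs_ballP[_ /complex_gt0[e e0 ->] eO].
have e2 : 0 < e / 2 by rewrite divr_gt0.
have [y xy] := cinj_dense x e2; exists (cinj y); split; last by exists y.
by apply: eO; rewrite -ball_normE/= rnE ltcR (le_lt_trans xy)//; lra.
Qed.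

End completion.

(** * Quotients of pre-Hilbert spaces and square sums *)

Section lift_limit.
Context (R : realType).
Local Notation C := R[i].

Definition linear_of (E F : lmodType C) (f : E -> F) (lin : linear f) :
  {linear E -> F} := HB.pack f (GRing.isLinear.Build C E F _ f lin).

Lemma sqrtr_le (a b : R) : 0 <= b -> a <= b ^+ 2 -> Num.sqrt a <= b.
Proof. by move=> b0 ab; rewrite -(ger0_norm b0) -sqrtr_sqr ler_wsqrtr. Qed.

Lemma sqrtr_subadd (a b : R) : 0 <= a -> 0 <= b ->
  Num.sqrt (a + b) <= Num.sqrt a + Num.sqrt b.
Proof.
move=> a0 b0; apply: sqrtr_le; first by rewrite addr_ge0 ?sqrtr_ge0.
by rewrite sqrrD !sqr_sqrtr// addrAC lerDl mulrn_wge0// mulr_ge0 ?sqrtr_ge0.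
Qed.

Context (X E : lmodType C) (B : normedModType C) (s : {linear X -> E})
  (L : {linear X -> B}) (D : X -> R).

(** The linear map l should be L evaluated at the best lift of a vector, where
    D x measures how far x is from being one (as a squared distance).  Best
    lifts need not exist, so L is evaluated along lifts with D tending to 0:
    two lifts of the same vector differ by an element of the kernel of s, where
    D bounds L, and hence their images under L form a Cauchy sequence.  The
    parallelogram-type bound on D makes the limit linear. *)
Lemma lift_limit : scomplete B ->
  (forall x, 0 <= D x) -> (forall x y, D (x + y) <= 2 * D x + 2 * D y) ->
  (forall a x, D (a *: x) = rn a ^+ 2 * D x) ->
  (forall x, s x = 0 -> rn (L x) ^+ 2 <= D x) ->
  (forall y e, 0 < e -> exists2 x, s x = y & D x < e) ->
  exists l : {linear E -> B}, forall x,
    rn (l (s x) - L x) <= Num.sqrt (2 * D x).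
Proof.
move=> cB D0 DD DZ LD lifts.
have close x y : s x = s y -> rn (L x - L y) <= Num.sqrt (2 * D x + 2 * D y).
  move=> sxy; rewrite -(ger0_norm (rn_ge0 _)) -sqrtr_sqr ler_wsqrtr// -linearB.
  apply: (le_trans (LD _ _)); first by rewrite linearB/= sxy subrr.
  by rewrite (le_trans (DD _ _))// -scaleN1r DZ rnN rn1 expr1n mul1r.
have lim y : exists l, forall x, s x = y -> rn (l - L x) <= Num.sqrt (2 * D x).
  have inv0 (k : nat) : 0 < k.+1%:R^-1 ^+ 2 :> R by rewrite exprn_gt0// invr_gt0.
  have [x xP] := choice (fun k => let: ex_intro2 x sx Dx := lifts y _ (inv0 k) in
    ex_intro (fun x => s x = y /\ D x < k.+1%:R^-1 ^+ 2) x (conj sx Dx)).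
  have [k|l ul] := cB (fun k => L (x k)).
    move=> k0; have [N HN] := @small_harmonic R (k / 2) (divr_gt0 k0 (ltr0n _ 2)).
    exists N => m n Nm Nn; apply: (le_lt_trans (close _ _ _)).
      by rewrite (xP m).1 (xP n).1.
    have {}HN i : (N <= i)%N -> D (x i) < k ^+ 2 / 4.
      move=> /HN h; apply: lt_trans (xP i).2 _.
      have i0 : 0 < i.+1%:R^-1 :> R by rewrite invr_gt0.
      by move: (i.+1%:R^-1) h i0 => r h r0; nra.
    rewrite -(ger0_norm (ltW k0)) -sqrtr_sqr ltr_sqrt ?exprn_gt0//.
    by have := HN _ Nm; have := HN _ Nn; lra.
  exists l => z sz; apply/ler_addgt0Pr => e e0.
  have [N HN] := ul _ (divr_gt0 e0 (ltr0n _ 2)).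
  have [N' HN'] := @small_harmonic R (e / 4) (divr_gt0 e0 (ltr0n _ 4)).
  move: (HN _ (leq_maxl N N')) (HN' _ (leq_maxr N N')).
  set k := maxn N N' => h h'; rewrite rnB in h.
  have xz : s (x k) = s z by rewrite (xP k).1 sz.
  have := close _ _ xz; have := rn_dist (L (x k)) l (L z).
  have D2 u : 0 <= 2 * D u by rewrite mulr_ge0.
  have := sqrtr_subadd (D2 (x k)) (D2 z).
  have k0 : 0 < k.+1%:R^-1 :> R by rewrite invr_gt0.
  have : Num.sqrt (2 * D (x k)) <= 2 * k.+1%:R^-1.
    apply: sqrtr_le; first by rewrite mulr_ge0// ltW.
    have := (xP k).2; move: (k.+1%:R^-1) k0 => r r0; nra.
  by move: (k.+1%:R^-1) h' => r h'; lra.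
have [l lP] := choice lim.
suff lin : linear l by exists (linear_of lin) => x; exact: lP.
move=> a y z; apply/subr0_eq/rn0_eq0/eqP; rewrite eq_le rn_ge0 andbT.
apply/ler_addgt0Pr => e e0; rewrite add0r.
set A := rn a; have A0 : 0 <= A := rn_ge0 a.
pose t := e / (8 * (A + 1)).
have t0 : 0 < t by rewrite divr_gt0// mulr_gt0// ltr_wpDl.
have et : e = 8 * (A + 1) * t.
  by rewrite /t mulrC divfK// mulf_neq0// gt_eqF// ltr_wpDl.
have [x sx Dx] := lifts y _ (exprn_gt0 2 t0).
have [x' sx' Dx'] := lifts z _ (exprn_gt0 2 t0).
have h1 : rn (l y - L x) <= 2 * t.
  apply: le_trans (lP y x sx) _; apply: sqrtr_le; first by rewrite mulr_ge0// ltW.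
  by nra.
have h2 : rn (l z - L x') <= 2 * t.
  apply: le_trans (lP z x' sx') _; apply: sqrtr_le; first by rewrite mulr_ge0// ltW.
  by nra.
have h3 : rn (l (a *: y + z) - L (a *: x + x')) <= 2 * (A + 1) * t.
  have sE : s (a *: x + x') = a *: y + z by rewrite linearP/= sx sx'.
  apply: le_trans (lP _ _ sE) _.
  apply: sqrtr_le; first by rewrite mulr_ge0 ?(ltW t0)// mulr_ge0// addr_ge0.
  have := DD (a *: x) x'; rewrite DZ -/A => h.
  apply: (@le_trans _ _ (4 * (A ^+ 2 * t ^+ 2 + t ^+ 2))).
    have : A ^+ 2 * D x <= A ^+ 2 * t ^+ 2.
      by rewrite ler_wpM2l ?exprn_ge0// ltW.
    by lra.
  have : 0 <= A * t ^+ 2 by rewrite mulr_ge0// exprn_ge0// ltW.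
  have -> : (2 * (A + 1) * t) ^+ 2 =
    4 * (A ^+ 2 * t ^+ 2 + t ^+ 2) + 8 * (A * t ^+ 2) by ring.
  by lra.
have -> : l (a *: y + z) - (a *: l y + l z) =
  (l (a *: y + z) - L (a *: x + x')) - (a *: (l y - L x) + (l z - L x')).
  rewrite linearP/= scalerBr addrACA -opprD opprB.
  by rewrite subrKA.
apply: (le_trans (rnD _ _)); rewrite rnN.
have := rnD (a *: (l y - L x)) (l z - L x'); rewrite rnZ -/A.
have : A * rn (l y - L x) <= A * (2 * t) by rewrite ler_wpM2l.
by rewrite et; nra.
Qed.

End lift_limit.

Section hilbertian.
Context (R : realType).
Local Notation C := R[i].

Definition hilbertian (X : lmodType C) (N : X -> R) :=
  rseminorm N /\ forall x y,
    N (x + y) ^+ 2 + N (x - y) ^+ 2 = 2 * N x ^+ 2 + 2 * N y ^+ 2.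

Section quotient.
Context (X E : lmodType C) (s : {linear X -> E}) (N : X -> R).
Hypotheses (surj : forall y, exists x, s x = y) (Nh : hilbertian N).

Definition quot (y : E) : R := inf [set N x | x in [set x | s x = y]].

Let quot_has_inf y : has_inf [set N x | x in [set x | s x = y]].
Proof.
split; first by have [x sx] := surj y; exists (N x); exists x.
by exists 0 => _ [x _ <-]; exact: rseminorm_ge0 Nh.1 _.
Qed.

Lemma quot_le x : quot (s x) <= N x.
Proof. by apply: ge_inf; [case: (quot_has_inf (s x))|exists x]. Qed.

Lemma quot_approx y e : 0 < e -> exists2 x, s x = y & N x < quot y + e.
Proof.
move=> e0; have [_ [x sx <-] xe] := inf_adherent e0 (quot_has_inf y).
by exists x.
Qed.

Lemma quot_ge y c : (forall x, s x = y -> c <= N x) -> c <= quot y.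
Proof.
move=> cN; apply: lb_le_inf; first by have [] := quot_has_inf y.
by move=> _ [x sx <-]; exact: cN.
Qed.

Let quot_ge0 y : 0 <= quot y.
Proof. by apply: quot_ge => x _; exact: rseminorm_ge0 Nh.1 _. Qed.

Lemma quot_seminorm : rseminorm quot.
Proof.
have qZ a y : quot (a *: y) <= rn a * quot y.
  apply/ler_addgt0Pr => e e0.
  have A0 : 0 < rn a + 1 by rewrite ltr_wpDl ?rn_ge0.
  have [x sx xe] := quot_approx y (divr_gt0 e0 A0).
  have := quot_le (a *: x); rewrite linearZ/= sx Nh.1.2 => /le_trans; apply.
  apply: (@le_trans _ _ (rn a * (quot y + e / (rn a + 1)))).
    by rewrite ler_wpM2l ?rn_ge0// ltW.
  rewrite mulrDr lerD2l mulrA ler_pdivrMr// mulrC ler_pM2l//.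
  by rewrite lerDl.
split=> [y z|a y].
  apply/ler_addgt0Pr => e e0; have e2 : 0 < e / 2 by rewrite divr_gt0.
  have [x sx xe] := quot_approx y e2; have [x' sx' x'e] := quot_approx z e2.
  have := quot_le (x + x'); rewrite linearD/= sx sx'.
  by have := Nh.1.1 x x'; lra.
have [->|a0] := eqVneq a 0.
  rewrite scale0r rn0 mul0r; apply/eqP; rewrite eq_le quot_ge0 andbT.
  by have := qZ 0 0; rewrite scale0r rn0 mul0r.
apply/eqP; rewrite eq_le qZ/=.
have := qZ a^-1 (a *: y); rewrite scalerA mulVf// scale1r rnV => h.
have A0 : 0 < rn a.
  by rewrite lt_def rn_ge0 andbT; apply: contra_neq a0 => /rn0_eq0.
by rewrite -ler_pdivlMl.
Qed.

Let qpar y z : quot (y + z) ^+ 2 + quot (y - z) ^+ 2 <=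
  2 * quot y ^+ 2 + 2 * quot z ^+ 2.
Proof.
apply/ler_addgt0Pr => e e0.
(* t is the tolerance on the lifts for which the squares lose at most e *)
have [t t0 et] : exists2 t, 0 < t &
    2 * (quot y + t) ^+ 2 + 2 * (quot z + t) ^+ 2 <=
    2 * quot y ^+ 2 + 2 * quot z ^+ 2 + e.
  have y0 := quot_ge0 y; have z0 := quot_ge0 z.
  pose K := 4 * (quot y + quot z + 1 + e).
  have K0 : 0 < K by rewrite /K; lra.
  exists (e / K); first by rewrite divr_gt0.
  have e1 : e / K * K = e by rewrite divfK// gt_eqF.
  have e2 : e / K <= 1 by rewrite ler_pdivrMr// /K; lra.
  have e3 : 0 < e / K by rewrite divr_gt0.
  move: (e / K) e1 e2 e3; rewrite /K => t e1 e2 e3; nra.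
have [x sx xe] := quot_approx y t0; have [x' sx' x'e] := quot_approx z t0.
have := quot_le (x + x'); have := quot_le (x - x').
rewrite linearB/= linearD/= sx sx' => h1 h2.
have p : 0 <= quot (y + z) /\ 0 <= quot (y - z) by rewrite !quot_ge0.
have p' : 0 <= N x /\ 0 <= N x' by rewrite !(rseminorm_ge0 Nh.1).
apply: le_trans et; apply: (@le_trans _ _ (2 * N x ^+ 2 + 2 * N x' ^+ 2)).
  by rewrite -Nh.2; apply: lerD; rewrite lerXn2r// nnegrE ?(rseminorm_ge0 Nh.1)//; case: p.
have sq u v : 0 <= u -> u < v + t -> u ^+ 2 <= (v + t) ^+ 2.
  by move=> u0 uv; rewrite lerXn2r// ?nnegrE ?(le_trans u0) ?ltW.
by case: p' => /sq /(_ xe) h /sq /(_ x'e) h'; lra.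
Qed.

(** Nearly minimal lifts satisfy the parallelogram law of N, which gives one
    inequality for quot; the same inequality for y + z and y - z is the
    reverse one. *)
Lemma quot_hilbertian : hilbertian quot.
Proof.
split; first exact: quot_seminorm.
move=> y z; apply/eqP; rewrite eq_le qpar/=.
have := qpar (y + z) (y - z).
have -> : y + z + (y - z) = y + y by rewrite addrACA subrr addr0.
have -> : y + z - (y - z) = z + z by rewrite opprB addrC addrA subrK.
have q2 u : quot (u + u) = 2 * quot u.
  have -> : u + u = (2 : R)%:C *: u.
    by rewrite [(2 : R)%:C]rmorph_nat scaler_nat mulr2n.
  by rewrite quot_seminorm.2 rn_real normr_nat.
by rewrite !q2; lra.
Qed.

(** The squared distance from x to a minimal lift of s x, if there is one: a
    quadratic form, as the difference of two squared hilbertian seminorms. *)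
Definition defect (x : X) : R := N x ^+ 2 - quot (s x) ^+ 2.

Lemma defect_ge0 x : 0 <= defect x.
Proof.
by rewrite subr_ge0 lerXn2r ?nnegrE ?quot_ge0 ?quot_le ?(rseminorm_ge0 Nh.1).
Qed.

Lemma defectD x y : defect (x + y) <= 2 * defect x + 2 * defect y.
Proof.
have := defect_ge0 (x - y); rewrite /defect linearB linearD/=.
have := quot_hilbertian.2 (s x) (s y); have := Nh.2 x y.
by lra.
Qed.

Lemma defectZ a x : defect (a *: x) = rn a ^+ 2 * defect x.
Proof.
by rewrite /defect (linearZZ s) Nh.1.2 quot_seminorm.2 !exprMn -mulrBr.
Qed.

Lemma defect_ker x : s x = 0 -> defect x = N x ^+ 2.
Proof.
by rewrite /defect => ->; rewrite (rseminorm0 quot_seminorm) expr0n subr0.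
Qed.

Lemma defect_le x : defect x <= N x ^+ 2.
Proof. by rewrite gerBl sqr_ge0. Qed.

Lemma defect_approx y e : 0 < e -> exists2 x, s x = y & defect x < e.
Proof.
move=> e0; have y0 := quot_ge0 y.
pose K := 2 * quot y + 1 + e.
have K0 : 0 < K by rewrite /K; lra.
have e1 : e / K * K = e by rewrite divfK// gt_eqF.
have e2 : e / K <= 1 by rewrite ler_pdivrMr// /K; lra.
have e3 : 0 < e / K by rewrite divr_gt0.
have [x sx xe] := quot_approx y e3; exists x => //; rewrite /defect sx.
have := rseminorm_ge0 Nh.1 x.
by move: (e / K) e1 e2 e3 xe; rewrite /K => t e1 e2 e3 xe x0; nra.
Qed.

End quotient.

Lemma functional_hilbertian (X : lmodType C) (f : {linear X -> C^o}) :
  hilbertian (fun x => rn (f x : C)).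
Proof.
split; [split=> [x y|a x]|move=> x y].
- by rewrite linearD rnD.
- by rewrite linearZ/= rnM.
- by rewrite linearD linearB/= parallelogram_C.
Qed.

Section square_sum.
Context (X : lmodType C) (h : nat -> X -> R).
Hypothesis hH : forall i, hilbertian (h i).

(** Summability, for the nonnegative families to which it is applied. *)
Definition bsum (a : nat -> R) := exists c, forall m, \sum_(i < m) a i <= c.

Definition sqsum x (m : nat) : R := \sum_(i < m) h i x ^+ 2.

Hypothesis hfin : forall x, bsum (fun i => h i x ^+ 2).

Let h0 i x : 0 <= h i x. Proof. exact: rseminorm_ge0 (hH i).1 x. Qed.

Definition l2sq x : R := limn (sqsum x : nat -> R^o).

Definition l2norm x : R := Num.sqrt (l2sq x).

Let sqsum_ge0 x m : 0 <= sqsum x m.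
Proof. by apply: sumr_ge0 => i _; rewrite exprn_ge0// h0. Qed.

Lemma l2sq_cvg x : sqsum x @ \oo --> l2sq x.
Proof.
suff : cvgn (sqsum x : nat -> R^o) by [].
apply: nondecreasing_is_cvgn.
  apply/nondecreasing_seqP => m; rewrite /sqsum big_ord_recr/= lerDl.
  by rewrite exprn_ge0// h0.
by have [c hc] := hfin x; exists c => _ [m _ <-]; exact: hc.
Qed.

Lemma sqsum_le x m : sqsum x m <= l2sq x.
Proof.
apply: nondecreasing_cvgn_le; last by apply/cvg_ex; exists (l2sq x); exact: l2sq_cvg.
apply/nondecreasing_seqP => k; rewrite /sqsum big_ord_recr/= lerDl.
by rewrite exprn_ge0// h0.
Qed.

Lemma l2sq_le x c : (forall m, sqsum x m <= c) -> l2sq x <= c.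
Proof.
move=> hc; apply: limr_le; first by apply/cvg_ex; exists (l2sq x); exact: l2sq_cvg.
by apply: nearW => m; exact: hc.
Qed.

Lemma l2sq_ge0 x : 0 <= l2sq x.
Proof. exact: le_trans (sqsum_ge0 x 0%N) (sqsum_le x 0%N). Qed.

Lemma l2normK x : l2norm x ^+ 2 = l2sq x.
Proof. by rewrite sqr_sqrtr// l2sq_ge0. Qed.

Lemma le_l2norm x i : h i x <= l2norm x.
Proof.
rewrite -(ger0_norm (h0 i x)) -sqrtr_sqr ler_wsqrtr//.
apply: le_trans (sqsum_le x i.+1); rewrite /sqsum big_ord_recr/= lerDr.
by rewrite sumr_ge0// => j _; rewrite exprn_ge0// h0.
Qed.

Lemma l2norm_le x c : 0 <= c -> (forall m, sqsum x m <= c ^+ 2) ->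
  l2norm x <= c.
Proof. by move=> c0 /l2sq_le; exact: sqrtr_le. Qed.

(** The parallelogram law passes to the limit.  For the triangle inequality,
    the weights 1 + B/A and 1 + A/B in
    (u + v)^2 <= (1 + B/A) u^2 + (1 + A/B) v^2 are chosen so that summing over
    the coordinates yields (A + B)^2. *)
Lemma l2norm_hilbertian : hilbertian l2norm.
Proof.
have l2Z a x : l2sq (a *: x) = rn a ^+ 2 * l2sq x.
  apply: cvg_lim; first exact: Rhausdorff.
  rewrite (_ : sqsum (a *: x) = (fun m => rn a ^+ 2 * sqsum x m)).
    exact: (cvgM (cvg_cst _) (@l2sq_cvg x)).
  apply/funext => m; rewrite /sqsum mulr_sumr; apply: eq_bigr => i _.
  by rewrite (hH i).1.2 exprMn.
have n0 x : 0 <= l2norm x by exact: sqrtr_ge0.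
split; last first.
  move=> x y; rewrite !l2normK.
  apply: (@cvg_unique _ (@Rhausdorff R)
    ((fun m => sqsum (x + y) m + sqsum (x - y) m) @ \oo)).
    exact: (cvgD (@l2sq_cvg (x + y)) (@l2sq_cvg (x - y))).
  rewrite (_ : (fun m => _) = (fun m => 2 * sqsum x m + 2 * sqsum y m)).
    exact: (cvgD (cvgM (cvg_cst _) (@l2sq_cvg x))
                 (cvgM (cvg_cst _) (@l2sq_cvg y))).
  apply/funext => m; rewrite /sqsum -big_split/= !mulr_sumr -big_split/=.
  by apply: eq_bigr => i _; exact: (hH i).2.
split=> [x y|a x]; last first.
  by rewrite /l2norm l2Z sqrtrM ?exprn_ge0 ?rn_ge0// sqrtr_sqr ger0_norm// rn_ge0.
apply/ler_addgt0Pr => e e0.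
pose A := l2norm x + e / 2; pose B := l2norm y + e / 2.
have A0 : 0 < A by rewrite /A; have := n0 x; lra.
have B0 : 0 < B by rewrite /B; have := n0 y; lra.
apply: (@le_trans _ _ (A + B)); last by rewrite /A /B; lra.
apply: l2norm_le => [|m]; first by rewrite addr_ge0// ltW.
have sx : sqsum x m <= A ^+ 2.
  apply: le_trans (sqsum_le x m) _; rewrite -l2normK lerXn2r// ?nnegrE// ?ltW//.
  by rewrite /A; lra.
have sy : sqsum y m <= B ^+ 2.
  apply: le_trans (sqsum_le y m) _; rewrite -l2normK lerXn2r// ?nnegrE// ?ltW//.
  by rewrite /B; lra.
have BA : 0 <= B / A by rewrite divr_ge0// ltW.
have AB : 0 <= A / B by rewrite divr_ge0// ltW.
have BA1 : B / A * (A / B) = 1 by rewrite mulrA divfK ?divff ?gt_eqF.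
apply: (@le_trans _ _ ((1 + B / A) * sqsum x m + (1 + A / B) * sqsum y m)).
  rewrite /sqsum !mulr_sumr -big_split/=; apply: ler_sum => i _.
  apply: (@le_trans _ _ ((h i x + h i y) ^+ 2)).
    by rewrite lerXn2r// ?nnegrE ?addr_ge0 ?h0// (hH i).1.1.
  move: (h i x) (h i y) (h0 i x) (h0 i y).
  move=> u v u0 v0.
  have : 0 <= B / A * (u - A / B * v) ^+ 2 by rewrite mulr_ge0// sqr_ge0.
  have -> : B / A * (u - A / B * v) ^+ 2 =
     B / A * u ^+ 2 - (B / A * (A / B)) * (u * v) *+ 2 +
     (B / A * (A / B)) * (A / B * v ^+ 2) by ring.
  by rewrite BA1; lra.
have E : (A + B) ^+ 2 = (1 + B / A) * A ^+ 2 + (1 + A / B) * B ^+ 2.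
  by field; rewrite ?gt_eqF.
by rewrite E lerD// ler_wpM2l// addr_ge0.
Qed.

End square_sum.

End hilbertian.

(** * Nuclear maps from summable functionals *)

Section bounded_sums.
Context (R : realType).
Implicit Types a b : nat -> R.

Lemma bsum_le a b : (forall i, a i <= b i) -> bsum b -> bsum a.
Proof.
move=> ab [c hc]; exists c => m; apply: le_trans (hc m).
by apply: ler_sum => i _; exact: ab.
Qed.

Lemma bsumD a b : bsum a -> bsum b -> bsum (fun i => a i + b i).
Proof.
move=> [c hc] [k hk]; exists (c + k) => m; rewrite big_split/=.
by rewrite lerD ?hc ?hk.
Qed.

Lemma bsumZ k a : 0 <= k -> bsum a -> bsum (fun i => k * a i).
Proof.
by move=> k0 [c hc]; exists (k * c) => m; rewrite -mulr_sumr ler_wpM2l.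
Qed.

Lemma bsum_finite n a : (forall i, (n <= i)%N -> a i = 0) -> bsum a.
Proof.
move=> an; exists (\sum_(i < n) `|a i|) => m.
apply: (@le_trans _ _ (\sum_(i < m) `|a i|)).
  by apply: ler_sum => i _; exact: ler_norm.
have [mn|nm] := leqP m n.
  rewrite (big_ord_widen _ (fun i => `|a i|) mn) [leRHS](bigID (fun i : 'I_n => (i < m)%N))/=.
  by rewrite lerDl sumr_ge0.
rewrite -(subnKC (ltnW nm)) big_split_ord/= gerDl big1 ?lexx// => i _.
by rewrite an ?normr0// leq_addr.
Qed.

Section nonneg.
Context (a : nat -> R).
Hypotheses (a0 : forall i, 0 <= a i) (aS : bsum a).

Lemma partial_sum_mono : {homo (fun m => \sum_(i < m) a i) : m n / (m <= n)%N >-> m <= n}.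
Proof.
move=> m n mn; rewrite (big_ord_widen _ a mn).
rewrite [leRHS](bigID (fun i : 'I_n => (i < m)%N))/= lerDl.
by rewrite sumr_ge0.
Qed.

Lemma bsum_elt : exists2 c, 0 <= c & forall i, a i <= c.
Proof.
have [c hc] := aS; exists c; first by have := hc 0%N; rewrite big_ord0.
move=> i; apply: le_trans (hc i.+1).
by rewrite big_ord_recr/= lerDr sumr_ge0.
Qed.

Lemma bsum_tail e : 0 < e -> exists M0, forall M k, (M0 <= M)%N ->
  \sum_(i < k) (if (i < M)%N then 0 else a i) <= e.
Proof.
move=> e0; pose S := [set \sum_(i < m) a i | m in [set: nat]].
have supS : has_sup S.
  split; first by exists (\sum_(i < 0) a i); exists 0%N.
  by have [c hc] := aS; exists c => _ [m _ <-].
have [_ [M0 _ <-] hM0] := sup_adherent e0 supS.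
exists M0 => M k M0M.
have [kM|Mk] := leqP k M.
  by rewrite big1 ?ltW// => i _; rewrite (leq_trans (ltn_ord i)).
have : \sum_(i < k) a i <= sup S by apply: ub_le_sup; [case: supS|exists k].
have := partial_sum_mono M0M.
rewrite -(subnKC (ltnW Mk)) !big_split_ord/= => h1 h2.
rewrite big1 ?add0r => [|i _]; last by rewrite ltn_ord.
apply: (@le_trans _ _ (\sum_(i < k - M) a (M + i)%N)); last by lra.
by apply: ler_sum => i _; rewrite ltnNge leq_addr.
Qed.

Lemma bsum_cvg : cvgn (fun m => \sum_(i < m) a i : R^o).
Proof.
apply: nondecreasing_is_cvgn; first exact: partial_sum_mono.
by have [c hc] := aS; exists c => _ [m _ <-]; exact: hc.
Qed.

Lemma bsum_series_cvg : cvgn (series (fun n => `|(a n)%:C| : R[i]^o)).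
Proof.
have /cvg_ex[l /cvgrPdist_lt al] := bsum_cvg.
apply/cvg_ex; exists (l%:C : R[i]^o); apply/scvgP => e e0.
have [N _ HN] := al e e0; exists N => n Nn.
rewrite (_ : series _ n = (\sum_(i < n) a i)%:C).
  by rewrite -rmorphB/= (@rn_real R) distrC; exact: HN.
rewrite /series/= big_mkord rmorph_sum; apply: eq_bigr => i _.
by rewrite ger0_norm// ler0c.
Qed.

Lemma bsum_sqr k : bsum (fun i => (a i * k) ^+ 2).
Proof.
have [c c0 hc] := bsum_elt.
apply: (@bsum_le _ (fun i => (c * k ^+ 2) * a i)) => [i|].
  rewrite exprMn [leRHS]mulrAC; apply: ler_wpM2r; first exact: sqr_ge0.
  by rewrite expr2 ler_wpM2r.
by apply: bsumZ => //; rewrite mulr_ge0// sqr_ge0.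
Qed.

End nonneg.
End bounded_sums.

Section nuclear_link.
Context (R : realType).
Local Notation C := R[i].

(** What [nuclear_space] requires of the canonical map from E_q to E_p. *)
Definition nuclear_link (E : lmodType C) (q p : seminorm E) :=
  exists (Eq Ep : completeNormedModType C)
    (jq : {linear E -> Eq}) (jp : {linear E -> Ep}) (T : {linear Eq -> Ep}),
    [/\ is_completion q jq, is_completion p jp, continuous T,
        forall x, T (jq x) = jp x & nuclear_map T].

(** The map x |-> (f_i x) is summable as seen from q, and bounded below by p
    for the supremum norm.  Upper bounds B stand for that supremum. *)
Definition summing (E : lmodType C) (p q : E -> R) :=
  exists (f : nat -> {linear E -> C^o}) (a : nat -> R),
  [/\ forall i, 0 <= a i, bsum a, forall i x, rn (f i x : C) <= a i * q x &
      forall x B, (forall i, rn (f i x : C) <= B) -> p x <= B].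

Lemma bounded_linear_continuous (V W : normedModType C) (T : {linear V -> W})
    (c : R) : (forall z, rn (T z) <= c * rn z) -> continuous T.
Proof.
move=> Tc z; apply/cvgrPdist_lt => _ /complex_gt0[e e0 ->].
have c0 : 0 < `|c| + 1 by rewrite ltr_wpDl.
have e1 : 0 < (e / (`|c| + 1))%:C :> C by rewrite ltcR divr_gt0.
have := nbhsx_ballx z _ e1; apply: filterS => w.
rewrite -ball_normE/= rnE ltcR ltr_pdivlMr// => zw; rewrite -linearB rnE ltcR.
apply: le_lt_trans (Tc _) (le_lt_trans _ zw).
rewrite mulrC ler_wpM2l ?rn_ge0// (le_trans (ler_norm c))//.
by rewrite lerDl.
Qed.

(** Extension by density as a lift limit: the pair (y, z) is a lift of z whose
    quality is the distance from jq y to z. *)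
Lemma extend_completion (E : lmodType C) (q : seminorm E)
    (Eq : completeNormedModType C) (jq : {linear E -> Eq})
    (B : normedModType C) (L : {linear E -> B}) (c : R) :
  is_completion q jq -> scomplete B -> 0 <= c ->
  (forall y, rn (L y) <= c * rn (jq y)) ->
  exists Lh : {linear Eq -> B}, (forall y, Lh (jq y) = L y) /\
    (forall z, rn (Lh z) <= 2 * c * rn z).
Proof.
move=> [_ djq] cB c0 Lc.
have lin2 : linear (@snd E Eq) by [].
have linL : linear (fun x : E * Eq => L x.1) by move=> a x y /=; rewrite linearP.
pose D (x : E * Eq) := c ^+ 2 * rn (x.2 - jq x.1) ^+ 2.
have dense_jq z e : 0 < e -> exists y, rn (z - jq y) < e.
  move=> e0; have [||w [zw [y _ yw]]] := djq (ball z e%:C).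
  - by exists z; apply: ballxx; rewrite ltcR.
  - by apply: ball_open; rewrite ltcR.
  by exists y; rewrite yw; move: zw; rewrite -ball_normE/= rnE ltcR.
have [|||||Lh hLh] := @lift_limit R (E * Eq)%type Eq B
  (linear_of lin2) (linear_of linL) D cB.
- by move=> x; rewrite mulr_ge0// sqr_ge0.
- have dist k u v : 2 * (k * u) + 2 * (k * v) = k * (2 * u + 2 * v) :> R by ring.
  move=> x y; rewrite /D dist.
  apply: ler_wpM2l; first exact: sqr_ge0.
  have -> : (x + y).2 - jq (x + y).1 = (x.2 - jq x.1) + (y.2 - jq y.1).
    by rewrite /= linearD opprD addrACA.
  have := rnD (x.2 - jq x.1) (y.2 - jq y.1).
  move: (rn_ge0 ((x.2 - jq x.1) + (y.2 - jq y.1))).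
  move: (rn _) (rn _) (rn _) => w v u u0 uvw.
  apply: (@le_trans _ _ ((v + w) ^+ 2)).
    by rewrite sq_le.
  by have := sqr_ge0 (v - w); lra.
- move=> a x; rewrite /D/= linearZ/= -scalerBr rnZ exprMn.
  by rewrite mulrCA.
- move=> x /= x20; rewrite /D x20 sub0r rnN -exprMn.
  by rewrite sq_le ?rn_ge0.
- move=> z e e0.
  have c1 : 0 < c ^+ 2 + 1 by rewrite ltr_wpDl// sqr_ge0.
  pose t := Num.min 1 (e / (c ^+ 2 + 1)).
  have t0 : 0 < t by rewrite lt_min ltr01 divr_gt0.
  have [y zy] := dense_jq z t t0; exists (y, z) => //; rewrite /D/=.
  have t1 : t <= 1 by rewrite ge_min lexx.
  have te : (c ^+ 2 + 1) * t <= e.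
    by rewrite mulrC -ler_pdivlMr// ge_min lexx orbT.
  have r0 := rn_ge0 (z - jq y); have cc := sqr_ge0 c.
  apply: lt_le_trans te.
  move: (rn (z - jq y)) zy r0 (c ^+ 2) cc => r zy r0 k k0.
  have rt : r ^+ 2 <= t by nra.
  have : k * r ^+ 2 <= k * t by rewrite ler_wpM2l.
  by lra.
have {}hLh y z : rn (Lh z - L y) <= 2 * c * rn (z - jq y).
  apply: le_trans (hLh (y, z)) _; apply: sqrtr_le.
    by rewrite !mulr_ge0// rn_ge0.
  rewrite /D/= !exprMn.
  have : 0 <= c ^+ 2 * rn (z - jq y) ^+ 2 by rewrite mulr_ge0 ?sqr_ge0.
  by lra.
exists Lh; split=> [y|z].
  apply/subr0_eq/rn0_eq0/eqP; rewrite eq_le rn_ge0 andbT.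
  by have := hLh y (jq y); rewrite subrr rn0 mulr0.
by have := hLh 0 z; rewrite (linear0 L) (linear0 jq) !subr0.
Qed.

(** Let Phi x = (g_i x), so that p (s x) <= |Phi x| in l^2.  Composing the
    orthogonal projection of l^2 onto the closed range of Phi with the map
    Phi x |-> jp (s x) gives an operator U on l^2 with values in the completion
    of p, and jp (s x) is the sum of the g_i x times the vectors U e_i.  Finite
    sequences, in the form of polynomials with e_i = 'X^i, suffice for this. *)
Section summing_nuclear.
Context (X E : lmodType C) (s : {linear X -> E}) (p : seminorm E) (N : X -> R).
Hypotheses (surj : forall y, exists x, s x = y) (Nh : hilbertian N).
Context (g : nat -> {linear X -> C^o}) (a : nat -> R).
Hypotheses (a0 : forall i, 0 <= a i) (aS : bsum a)
  (ga : forall i x, rn (g i x : C) <= a i * N x)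
  (pg : forall x B, (forall i, rn (g i x : C) <= B) -> real_part p (s x) <= B).

Let q0 := quot s N.
Let q0P := quot_seminorm surj Nh.

Let shift_fun i (x : X * {poly C}) : C^o := x.2`_i - g i x.1.
Let shift_linear i : linear (shift_fun i).
Proof.
move=> k x y; rewrite /shift_fun /= coefD coefZ linearP/=.
by rewrite opprD addrACA -mulrN -mulrDr.
Qed.
Let shift i : {linear (X * {poly C})%type -> C^o} := linear_of (shift_linear i).

Let N0 x : 0 <= N x. Proof. exact: rseminorm_ge0 Nh.1 x. Qed.

Let shift_fin x : bsum (fun i => rn (shift i x : C) ^+ 2).
Proof.
apply: (@bsum_le _ _ (fun i => 2 * rn (x.2`_i) ^+ 2 + 2 * (a i * N x.1) ^+ 2)).
  move=> i /=; rewrite /shift_fun; have := rnD x.2`_i (- g i x.1 : C).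
  rewrite rnN => h; have := ga i x.1; have := rn_ge0 (g i x.1 : C).
  have := rn_ge0 (x.2`_i - g i x.1 : C); have := rn_ge0 (x.2`_i : C).
  set u := rn (x.2`_i - g i x.1 : C) in h *; set v := rn (g i x.1 : C) in h *.
  set t := rn (x.2`_i : C) in h *; set w := a i * N x.1 => t0 u0 v0 vw.
  apply: (@le_trans _ _ ((t + w) ^+ 2)); first by rewrite sq_le//; lra.
  by have := sqr_ge0 (t - w); lra.
apply: bsumD; last by apply: bsumZ => //; exact: bsum_sqr.
apply: bsumZ => //; apply: (@bsum_finite _ (size x.2)) => i hi.
by rewrite nth_default// rn0 expr0n.
Qed.

(** W (x, xi) is the l^2 distance from xi to Phi x. *)
Let W := l2norm (fun i x => rn (shift i x : C)).
Let shiftH i := functional_hilbertian (shift i).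
Let WP := l2norm_hilbertian shiftH shift_fin.

(** The truncations of Phi x, which converge to it in l^2. *)
Let tr x M : {poly C} := \poly_(i < M) (g i x : C).

Let W_tr x e : 0 < e -> exists M0, forall M, (M0 <= M)%N -> W (x, tr x M) <= e.
Proof.
move=> e0.
have b0 i : 0 <= (a i * N x) ^+ 2 by exact: sqr_ge0.
have [M0 HM0] := bsum_tail b0 (bsum_sqr a0 aS (N x)) (exprn_gt0 2 e0).
exists M0 => M M0M; apply: (l2norm_le shiftH shift_fin); first exact: ltW.
move=> k; apply: le_trans (HM0 M k M0M); apply: ler_sum => i _.
rewrite /= /shift_fun/= coef_poly; case: ifP => iM.
  by rewrite subrr rn0 expr0n.
by rewrite sub0r rnN sq_le// rn_ge0.
Qed.

Let W_X m : W (0, 'X^m) <= 1.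
Proof.
apply: (l2norm_le shiftH shift_fin) => // k; rewrite expr1n.
apply: (@le_trans _ _ (\sum_(i < k) if (i == m :> nat) then 1 else 0)).
  apply: ler_sum => i _; rewrite /= /shift_fun/= coefXn linear0 subr0.
  by case: eqP => _; rewrite ?rn1 ?rn0 ?expr1n// expr0n.
rewrite -big_mkcond/=; have [mk|km] := ltnP m k.
  by rewrite (big_pred1 (Ordinal mk))// => i; rewrite -val_eqE.
by rewrite big_pred0// => i; rewrite ltn_eqF// (leq_trans (ltn_ord i)).
Qed.

Let W_ker x : real_part p (s x) <= W (x, 0).
Proof.
apply: pg => i; apply: le_trans (le_l2norm shiftH shift_fin (x, 0) i).
by rewrite /= /shift_fun/= coef0 sub0r rnN.
Qed.

Section expansion.
Context (Ep : completeNormedModType C) (jp : {linear E -> Ep}).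
Hypothesis jpP : is_completion p jp.

Let rn_jp y : rn (jp y) = real_part p y.
Proof. by rewrite /rn jpP.1. Qed.

(** The operator U.  A lift (x, xi) of xi is nearly minimal for W when Phi x is
    nearly the orthogonal projection of xi onto the range of Phi. *)
Let synthesis : exists U : {linear {poly C} -> Ep},
  forall x xi, rn (U xi - jp (s x)) <= 2 * W (x, xi).
Proof.
have lin2 : linear (@snd X {poly C}) by [].
have linL : linear (fun x : X * {poly C} => jp (s x.1)).
  by move=> k x y /=; rewrite !linearP.
have surj2 (y : {poly C}) : exists x, linear_of lin2 x = y by exists (0, y).
have W0 x : 0 <= W x by exact: sqrtr_ge0.
have [|||||U hU] := @lift_limit R (X * {poly C})%type {poly C} Ep
  (linear_of lin2) (linear_of linL) (defect (linear_of lin2) W)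
  (@complete_scomplete R Ep).
- exact: defect_ge0 surj2 WP.
- exact: defectD surj2 WP.
- exact: defectZ surj2 WP.
- move=> x x0; rewrite (defect_ker surj2 WP x0) sq_le ?rn_ge0//= rn_jp.
  by case: x x0 => x xi /= ->; exact: W_ker.
- exact: defect_approx surj2 WP.
exists U => x xi; apply: le_trans (hU (x, xi)) _; apply: sqrtr_le.
  by rewrite mulr_ge0.
have := defect_le (linear_of lin2) W (x, xi); have := sqr_ge0 (W (x, xi)).
by rewrite exprMn; lra.
Qed.

(** A functional g_i on X does not factor through s; evaluating it at
    N-minimal lifts makes a functional on E out of it. *)
Let coefficient i : exists f : {linear E -> C^o},
  forall x, rn (f (s x) - g i x : C) <= 2 * a i * Num.sqrt (defect s N x).
Proof.
have [|||||f hf] := @lift_limit R X E C^o s (g i)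
  (fun x => a i ^+ 2 * defect s N x) (@scomplete_C R).
- by move=> x; rewrite mulr_ge0 ?sqr_ge0// (defect_ge0 surj Nh).
- have dist k u v : 2 * (k * u) + 2 * (k * v) = k * (2 * u + 2 * v) :> R by ring.
  move=> x y; rewrite dist.
  by rewrite ler_wpM2l ?sqr_ge0// (defectD surj Nh).
- by move=> k x; rewrite (defectZ surj Nh) mulrCA.
- move=> x /(defect_ker surj Nh) ->; rewrite -exprMn sq_le ?rn_ge0//.
- move=> y e e0.
  have A1 : 0 < a i ^+ 2 + 1 by rewrite ltr_wpDl// sqr_ge0.
  have [x sx xe] := defect_approx surj Nh y (divr_gt0 e0 A1).
  exists x => //; move: xe; rewrite ltr_pdivlMr//.
  by have := defect_ge0 surj Nh x; lra.
exists f => x; apply: le_trans (hf x) _; apply: sqrtr_le.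
  by rewrite !mulr_ge0 ?sqrtr_ge0.
rewrite !exprMn sqr_sqrtr ?(defect_ge0 surj Nh)//.
have : 0 <= a i ^+ 2 * defect s N x.
  by rewrite mulr_ge0 ?sqr_ge0// (defect_ge0 surj Nh).
by lra.
Qed.

(** If x were a minimal lift of y, then f_i y = g_i x and the partial sums would
    be the values of U at the truncations of Phi x.  For a nearly minimal x the
    difference f_i y - g_i x is small relative to a_i, uniformly in i. *)
Lemma nuclear_expansion : exists (f : nat -> {linear E -> C^o}) (u : nat -> Ep),
  [/\ forall i y, rn (f i y : C) <= 3 * a i * q0 y,
      forall i, rn (u i) <= 2 &
      forall y, scvg (fun M => \sum_(i < M) f i y *: u i) (jp y)].
Proof.
have [U hU] := synthesis; have [f hf] := choice coefficient.
exists f, (fun i => U 'X^i); split=> [i y|i|y e e0].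
- have A1 : 0 < 3 * a i + 1 by rewrite ltr_wpDl// mulr_ge0.
  apply/ler_addgt0Pr => e e0.
  have [x <- xe] := quot_approx surj Nh y (divr_gt0 e0 A1).
  have h1 : Num.sqrt (defect s N x) <= N x.
    by apply: sqrtr_le => //; exact: defect_le.
  have := rnD (f i (s x) - g i x : C) (g i x : C); rewrite subrK => h2.
  have := hf i x; have := ga i x; have ai := a0 i.
  have : a i * Num.sqrt (defect s N x) <= a i * N x by rewrite ler_wpM2l.
  have : 3 * a i * N x <= 3 * a i * (q0 (s x) + e / (3 * a i + 1)).
    by rewrite ler_wpM2l ?mulr_ge0// ltW.
  have : 3 * a i * (e / (3 * a i + 1)) <= e.
    by rewrite mulrA ler_pdivrMr// mulrC ler_pM2l// lerDl.
  by rewrite mulrDr; lra.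
- have := hU 0 'X^i; rewrite (linear0 s) (linear0 jp) subr0 => /le_trans; apply.
  by have := W_X i; lra.
have [A A0 hA] : exists2 A, 0 <= A & forall m, \sum_(i < m) a i <= A.
  by have [A hA] := aS; exists A => //; have := hA 0%N; rewrite big_ord0.
have e4 : 0 < e / 4 by rewrite divr_gt0.
have K0 : 0 < 16 * (A + 1) by rewrite mulr_gt0// ltr_wpDl.
have t0 : 0 < e / (16 * (A + 1)) by rewrite divr_gt0.
have [x sx xe] := defect_approx surj Nh y (exprn_gt0 2 t0).
have sd : Num.sqrt (defect s N x) <= e / (16 * (A + 1)).
  by apply: sqrtr_le; exact: ltW.
have [M0 HM0] := W_tr x e4; exists M0 => M M0M.
have -> : \sum_(i < M) f i y *: U 'X^i - jp y =
  \sum_(i < M) (f i y - g i x) *: U 'X^i + (U (tr x M) - jp (s x)).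
  rewrite sx /tr poly_def linear_sum addrA -big_split/=; congr (_ - _).
  by apply: eq_bigr => i _; rewrite linearZ/= -scalerDl subrK.
apply: (le_lt_trans (rnD _ _)).
have h1 : rn (U (tr x M) - jp (s x)) <= e / 2.
  by apply: le_trans (hU _ _) _; have := HM0 M M0M; lra.
have h2 : rn (\sum_(i < M) (f i y - g i x) *: U 'X^i) <= e / 4.
  apply: (le_trans (rn_sum _ _ _)).
  apply: (@le_trans _ _ (\sum_(i < M) a i * (4 * (e / (16 * (A + 1)))))).
    apply: ler_sum => i _; rewrite rnZ.
    have u2 : rn (U 'X^i) <= 2.
      have := hU 0 'X^i; rewrite (linear0 s) (linear0 jp) subr0 => /le_trans; apply.
      by have := W_X i; lra.
    apply: (@le_trans _ _ ((2 * a i * (e / (16 * (A + 1)))) * 2)).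
      apply: ler_pM; rewrite ?rn_ge0// -sx.
      apply: le_trans (hf i x) _; rewrite ler_wpM2l// mulr_ge0//.
    by lra.
  rewrite -mulr_suml; apply: (@le_trans _ _ (A * (4 * (e / (16 * (A + 1)))))).
    by rewrite ler_wpM2r// mulr_ge0// ltW.
  rewrite mulrCA (_ : e / (16 * (A + 1)) = e / 16 / (A + 1)); last first.
    by rewrite invfM mulrA.
  have : A * (e / 16 / (A + 1)) <= e / 16.
    rewrite mulrA ler_pdivrMr ?ltr_wpDl// mulrC ler_pM2l ?divr_gt0//.
    by rewrite lerDl.
  by lra.
by lra.
Qed.

End expansion.

(** The functionals f_i and the vectors u_i are transported to the completions,
    with a_i as the summable factor: f_i / a_i is bounded independently of i. *)
Theorem summing_nuclear_link : exists (q : E -> R) (qP : rseminorm q),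
  [/\ forall y, p y <= seminorm_of qP y,
      exists2 c, 0 <= c & forall x, q (s x) <= c * N x &
      nuclear_link (seminorm_of qP) p].
Proof.
have [A A0 hA] : exists2 A, 0 <= A & forall m, \sum_(i < m) a i <= A.
  by have [A hA] := aS; exists A => //; have := hA 0%N; rewrite big_ord0.
have aA i : a i <= A.
  apply: le_trans (hA i.+1).
  by rewrite big_ord_recr/= lerDr sumr_ge0.
have A1 : 0 <= A + 1 by rewrite addr_ge0.
have qP : rseminorm (fun y => (A + 1) * q0 y).
  split=> [y z|k y]; first by rewrite -mulrDr ler_wpM2l// q0P.1.
  by rewrite /q0 q0P.2 mulrCA.
have q00 y : 0 <= q0 y by exact: rseminorm_ge0 q0P y.
have pq y : real_part p y <= (A + 1) * q0 y.
  apply: (@le_trans _ _ (A * q0 y)); last by rewrite ler_wpM2r// lerDl.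
  apply/ler_addgt0Pr => e e0.
  have A2 : 0 < A + 1 by rewrite ltr_wpDl.
  have [x <- xe] := quot_approx surj Nh y (divr_gt0 e0 A2).
  apply: (@le_trans _ _ (A * N x)).
    by apply: pg => i; apply: le_trans (ga i x) _; rewrite ler_wpM2r.
  apply: (@le_trans _ _ (A * (q0 (s x) + e / (A + 1)))).
    by rewrite ler_wpM2l// ltW.
  rewrite mulrDr lerD2l mulrA ler_pdivrMr// mulrC ler_pM2l//.
  by rewrite lerDl.
exists (fun y => (A + 1) * q0 y), qP; split.
- by move=> y; rewrite real_partE/= lecR.
- by exists (A + 1) => // x; rewrite ler_wpM2l// quot_le.
pose Eq := completion qP; pose Ep := completion (real_part_seminorm p).
pose jq : {linear E -> Eq} := @cinj R E _ qP.
pose jp : {linear E -> Ep} := @cinj R E _ (real_part_seminorm p).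
have jqP : is_completion (seminorm_of qP) jq by exact: completion_is_completion.
have jpP : is_completion p jp.
  have [h1 h2] := completion_is_completion (real_part_seminorm p).
  by split=> // x; rewrite h1 [RHS]real_partE.
have rn_jq y : rn (jq y) = (A + 1) * q0 y by exact: rn_cinj.
have rn_jp y : rn (jp y) = real_part p y by exact: rn_cinj.
have [f [u [fa u2 fu]]] := nuclear_expansion jpP.
have [|T [TE T2]] := @extend_completion _ _ _ jq Ep jp 1 jqP
  (@complete_scomplete R Ep) ler01.
  by move=> y; rewrite mul1r rn_jp rn_jq.
have fh i : exists h : {linear Eq -> C^o}, (forall y, h (jq y) = f i y) /\
    forall z, rn (h z : C) <= 2 * (3 * a i) * rn z.
  apply: (extend_completion jqP (@scomplete_C R)); first by rewrite mulr_ge0.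
  move=> y; rewrite rn_jq; apply: le_trans (fa i y) _.
  rewrite ler_wpM2l ?mulr_ge0// -[leLHS]mul1r ler_wpM2r//.
  by rewrite lerDr.
have [h hP] := choice fh.
have normlin i : linear (fun z : Eq => (a i)^-1%:C * h i z : C^o).
  by move=> k x y; rewrite linearP/= mulrDr mulrCA.
exists Eq, Ep, jq, jp, T; split => //.
  exact: bounded_linear_continuous T2.
exists (fun i => (a i)%:C), (fun i => linear_of (normlin i)), u; split.
- exact: bsum_series_cvg.
- exists 6%:C => i z; rewrite (rnE z) (rnE (linear_of _ z : C)) -rmorphM lecR/=.
  rewrite rnM (@rn_real R) ger0_norm ?invr_ge0//.
  have [ai0|ai0] := eqVneq (a i) 0.
    by rewrite ai0 invr0 mul0r mulr_ge0// rn_ge0.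
  have ai : 0 < a i by rewrite lt_def ai0 a0.
  rewrite ler_pdivrMl//; apply: le_trans ((hP i).2 z) _.
  by lra.
- by exists 2%:C => i; rewrite rnE lecR.
move=> z; apply/scvgP => e e0.
have K0 : 0 < 24 * (A + 1) by rewrite mulr_gt0// ltr_wpDl.
have t0 : 0 < e / (24 * (A + 1)) by rewrite divr_gt0.
have [y zy] : exists y, rn (z - jq y) < e / (24 * (A + 1)).
  have [y zy] := cinj_dense z (divr_gt0 t0 (ltr0n _ 2)); exists y.
  by apply: le_lt_trans zy _; rewrite ltr_pdivrMr// ltr_pMr// ltr1n.
have [M0 HM0] := fu y (e / 4) (divr_gt0 e0 (ltr0n _ 4)).
exists M0 => M /HM0 hM.
have -> : series (fun n => ((a n)%:C * linear_of (normlin n) z) *: u n) M - T z =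
    \sum_(i < M) h i (z - jq y) *: u i +
    ((\sum_(i < M) f i y *: u i - jp y) - T (z - jq y)).
  rewrite (linearB T)/= TE opprB subrKA addrA -big_split/=.
  rewrite /series/= big_mkord; congr (_ - _); apply: eq_bigr => i _.
  rewrite -scalerDl linearB/= (hP i).1 subrK; congr (_ *: _).
  have [ai0|ai0] := eqVneq (a i) 0; last first.
    by rewrite mulrA -rmorphM divff// mul1r.
  (* when a_i = 0 the functional vanishes, so dividing by it is harmless *)
  rewrite ai0 mul0r; apply/esym/rn0_eq0/eqP; rewrite eq_le rn_ge0 andbT.
  by have := (hP i).2 z; rewrite ai0 !mulr0 mul0r.
apply: (le_lt_trans (rnD _ _)).
have := rnD (\sum_(i < M) f i y *: u i - jp y) (- T (z - jq y)); rewrite rnN.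
have := T2 (z - jq y); rewrite mulr1.
have : rn (\sum_(i < M) h i (z - jq y) *: u i) <= 12 * A * rn (z - jq y).
  apply: (le_trans (rn_sum _ _ _)).
  apply: (@le_trans _ _ (\sum_(i < M) a i * (12 * rn (z - jq y)))).
    apply: ler_sum => i _; rewrite rnZ.
    apply: (@le_trans _ _ ((2 * (3 * a i) * rn (z - jq y)) * 2)).
      by apply: ler_pM; rewrite ?rn_ge0//; exact: (hP i).2.
    by lra.
  rewrite -mulr_suml; apply: (@le_trans _ _ (A * (12 * rn (z - jq y)))).
    by rewrite ler_wpM2r ?mulr_ge0 ?rn_ge0.
  by lra.
have : 12 * A * rn (z - jq y) + 2 * rn (z - jq y) <= e / 2.
  apply: (@le_trans _ _ (12 * (A + 1) * rn (z - jq y))).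
    by have := rn_ge0 (z - jq y); lra.
  rewrite -ler_pdivlMl ?mulr_gt0 ?ltr_wpDl//; apply: le_trans (ltW zy) _.
  rewrite le_eqVlt; apply/orP; left; apply/eqP; field.
  by rewrite gt_eqF// ltr_wpDl.
by move: hM; lra.
Qed.

End summing_nuclear.

End nuclear_link.

(** * Countable direct sums *)

Section finite_sums.
Context (R : realType).

Lemma sum_subset (I : eqType) (s t : seq I) (a : I -> R) :
  (forall i, 0 <= a i) -> uniq s -> {subset s <= t} ->
  \sum_(i <- s) a i <= \sum_(i <- t) a i.
Proof.
move=> a0; elim: s t => [|x s IH] t; first by rewrite big_nil sumr_ge0.
move=> /= /andP[xs us] st; have xt : x \in t by rewrite st ?mem_head.
rewrite (perm_big _ (perm_to_rem xt)) !big_cons lerD2l IH// => y ys.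
have : y \in x :: rem x t by rewrite -(perm_mem (perm_to_rem xt)) st// in_cons ys orbT.
by rewrite in_cons; case: eqP => // yx; move: ys; rewrite yx (negbTE xs).
Qed.

(** Bounded sums over finite sets of indices make sense on any index type, and
    survive products and reindexing. *)
Definition fsum (I : eqType) (a : I -> R) :=
  exists c, forall s, uniq s -> \sum_(i <- s) a i <= c.

Lemma fsum_nat (a : nat -> R) : (forall i, 0 <= a i) -> bsum a -> fsum a.
Proof.
move=> a0 [c hc]; exists c => s us; apply: le_trans (hc (\max_(i <- s) i).+1).
rewrite -(big_mkord xpredT a); apply: sum_subset => // i si.
by rewrite mem_index_iota/= ltnS leq_bigmax_seq.
Qed.

Lemma fsum_pair (I J : eqType) (a : I * J -> R) (b : I -> R) :
  (forall i, 0 <= a i) -> fsum b ->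
  (forall i s, uniq s -> \sum_(j <- s) a (i, j) <= b i) -> fsum a.
Proof.
move=> a0 [c hc] ab; exists c => s us.
pose s1 := undup (map fst s); pose s2 := undup (map snd s).
apply: (@le_trans _ _ (\sum_(x <- [seq (i, j) | i <- s1, j <- s2]) a x)).
  apply: sum_subset => // -[i j] xs; apply/allpairsP; exists (i, j).
  by rewrite !mem_undup; split=> //; apply/mapP; exists (i, j).
rewrite big_allpairs; apply: le_trans (hc s1 (undup_uniq _)).
by apply: ler_sum => i _; exact: ab (undup_uniq _).
Qed.

Lemma geometric_bsum (r : R) : 0 <= r -> r < 1 -> bsum (fun i => r ^+ i).
Proof.
move=> r0 r1; exists (1 - r)^-1 => m.
rewrite -[leRHS]mul1r ler_pdivlMr ?subr_gt0// mulrC.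
rewrite -opprB mulNr -subrX1 opprB gerBl exprn_ge0//.
Qed.

End finite_sums.

Section countable_index.
Context (R : realType).
Local Notation C := R[i].

(** The indices are enumerated by their codes; numbers that are not codes get the
    zero functional. *)
Lemma summing_countable (I : countType) (E : lmodType C) (p q : E -> R)
    (f : I -> {linear E -> C^o}) (a : I -> R) :
  (forall i, 0 <= a i) -> fsum a -> (forall i x, rn (f i x : C) <= a i * q x) ->
  (forall x B, 0 <= B -> (forall i, rn (f i x : C) <= B) -> p x <= B) -> summing p q.
Proof.
move=> a0 [c hc] fa pf.
have lin n : linear (fun x : E => oapp (fun i => f i x) 0 (pickle_inv n) : C^o).
  move=> k x y; case: pickle_inv => [i|] /=; first by rewrite linearP.
  by rewrite scaler0 addr0.
exists (fun n => linear_of (lin n)), (fun n => oapp a 0 (pickle_inv n)); split.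
- by move=> n; case: pickle_inv.
- exists c => m; have u : uniq (pmap (@pickle_inv I) (iota 0 m)).
    by apply: (pmap_uniq (@pickle_invK I)); exact: iota_uniq.
  apply: le_trans (hc _ u); rewrite -(big_mkord xpredT (fun n => oapp a 0 (pickle_inv n))).
  rewrite /index_iota subn0; elim: (iota 0 m) => [|n s IH]; first by rewrite !big_nil.
  rewrite big_cons/=; case: pickle_inv => [i|] /=; first by rewrite big_cons lerD2l.
  by rewrite add0r.
- move=> n x /=; case: pickle_inv => [i|] /=; first exact: fa.
  by rewrite rn0 mul0r.
- move=> x B fB; apply: pf => [|i]; last first.
    by have := fB (pickle i); rewrite /= pickleK_inv.
  exact: le_trans (rn_ge0 _) (fB 0%N).
Qed.

End countable_index.

Section dependent_product.
Context (K : nzRingType) (F : nat -> lmodType K).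

(** The full product, of which the direct sum is the subspace of finitely
    supported families. *)
Definition dprod : Type := forall k, F k.

HB.instance Definition _ := gen_eqMixin dprod.
HB.instance Definition _ := gen_choiceMixin dprod.

Implicit Types x y z : dprod.
Definition dprod_add x y : dprod := fun k => x k + y k.
Definition dprod_opp x : dprod := fun k => - x k.
Definition dprod_scale (a : K) x : dprod := fun k => a *: x k.

Let ext x y : (forall k, x k = y k) -> x = y.
Proof. exact: functional_extensionality_dep. Qed.

Let dprod_addA : associative dprod_add.
Proof. by move=> x y z; apply: ext => k; rewrite /dprod_add addrA. Qed.
Let dprod_addC : commutative dprod_add.
Proof. by move=> x y; apply: ext => k; rewrite /dprod_add addrC. Qed.
Let dprod_add0 : left_id (fun k => 0) dprod_add.
Proof. by move=> x; apply: ext => k; rewrite /dprod_add add0r. Qed.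
Let dprod_addN : left_inverse (fun k => 0) dprod_opp dprod_add.
Proof. by move=> x; apply: ext => k; rewrite /dprod_add addNr. Qed.

HB.instance Definition _ := GRing.isZmodule.Build dprod
  dprod_addA dprod_addC dprod_add0 dprod_addN.

Let dprod_scaleA a b x :
  dprod_scale a (dprod_scale b x) = dprod_scale (a * b) x.
Proof. by apply: ext => k; rewrite /dprod_scale scalerA. Qed.
Let dprod_scale1 : left_id 1 dprod_scale.
Proof. by move=> x; apply: ext => k; rewrite /dprod_scale scale1r. Qed.
Let dprod_scaleDr : right_distributive dprod_scale +%R.
Proof. by move=> a x y; apply: ext => k; rewrite /dprod_scale scalerDr. Qed.
Let dprod_scaleDl x : {morph dprod_scale^~ x : a b / a + b}.
Proof. by move=> a b; apply: ext => k; rewrite /dprod_scale scalerDl. Qed.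

HB.instance Definition _ := GRing.Zmodule_isLmodule.Build K dprod
  dprod_scaleA dprod_scale1 dprod_scaleDr dprod_scaleDl.

Lemma dprodP a x y k : (a *: x + y) k = a *: x k + y k.
Proof. by []. Qed.

End dependent_product.

Section direct_sum.
Context (R : realType).
Local Notation C := R[i].
Context (F : nat -> lmodType C).

Definition finsupp : {pred dprod F} := fun x =>
  `[< exists n, forall k, (n <= k)%N -> x k = 0 >].

Lemma finsupp_submod : submod_closed finsupp.
Proof.
split; first by apply/asboolP; exists 0%N.
move=> a x y /asboolP[n xn] /asboolP[m ym]; apply/asboolP.
exists (maxn n m) => k; rewrite geq_max => /andP[nk mk].
by rewrite dprodP xn// ym// scaler0 addr0.
Qed.

HB.instance Definition _ :=
  GRing.isSubmodClosed.Build C _ finsupp finsupp_submod.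

Definition dsum : Type := subspace_of finsupp.
HB.instance Definition _ := GRing.Lmodule.on dsum.

Definition component (x : dsum) k : F k := subspace_val x k.

Lemma component_linear k (a : C) (x y : dsum) :
  component (a *: x + y) k = a *: component x k + component y k.
Proof. by []. Qed.

Lemma dsumP (x : dsum) : exists n, forall k, (n <= k)%N -> component x k = 0.
Proof. by case: x => x xP; have /asboolP := xP. Qed.

(** Some bound on the support. *)
Definition dlen x := projT1 (cid (dsumP x)).

Lemma dlenP x k : (dlen x <= k)%N -> component x k = 0.
Proof. exact: (projT2 (cid (dsumP x))). Qed.

Definition inj_fun k (v : F k) : dprod F := fun l =>
  if pselect (k = l) is left e then ecast j (F j) e v else 0.

Lemma inj_funE k (v : F k) : inj_fun v k = v.
Proof.
rewrite /inj_fun; case: pselect => // e.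
by rewrite (Prop_irrelevance e erefl).
Qed.

Lemma inj_fun0 k l (v : F k) : k <> l -> inj_fun v l = 0.
Proof. by rewrite /inj_fun; case: pselect. Qed.

Lemma inj_in k (v : F k) : inj_fun v \in finsupp.
Proof.
apply/asboolP; exists k.+1 => l kl; rewrite inj_fun0// => kE.
by rewrite kE ltnn in kl.
Qed.

Definition dinj k (v : F k) : dsum := SubspaceOf (inj_in v).

Context (E : lmodType C) (u : forall k, {linear F k -> E}).

Definition dtotal (x : dsum) : E := \sum_(k < dlen x) u k (component x k).

Lemma dtotalE x n : (forall k, (n <= k)%N -> component x k = 0) ->
  dtotal x = \sum_(k < n) u k (component x k).
Proof.
move=> xn; pose S m := \sum_(k < m) u k (component x k).
have aux m : (forall k, (m <= k)%N -> component x k = 0) ->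
    forall j, S (m + j)%N = S m.
  move=> xm j; rewrite /S big_split_ord/= [X in _ + X]big1 ?addr0// => i _.
  by rewrite xm ?linear0// leq_addr.
rewrite /dtotal -!/(S _) -(aux _ (@dlenP x) n) addnC.
exact: aux.
Qed.

Lemma dtotal_linear : linear dtotal.
Proof.
move=> a x y; pose n := maxn (dlen x) (dlen y).
have cE k : component (a *: x + y) k = a *: component x k + component y k by [].
have xn k : (n <= k)%N -> component x k = 0.
  by rewrite geq_max => /andP[/dlenP].
have yn k : (n <= k)%N -> component y k = 0.
  by rewrite geq_max => /andP[_ /dlenP].
rewrite (dtotalE xn) (dtotalE yn) (@dtotalE (a *: x + y) n) => [|k nk]; last first.
  by rewrite cE xn// yn// scaler0 addr0.
rewrite scaler_sumr -big_split/=; apply: eq_bigr => k _.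
exact: (linearP (u k) a (component x k) (component y k)).
Qed.

Lemma dtotal_dinj k v : dtotal (dinj v) = u k v.
Proof.
rewrite (@dtotalE _ k.+1) => [|l kl]; last first.
  by rewrite /component/= inj_fun0// => kE; rewrite kE ltnn in kl.
rewrite big_ord_recr/= big1 ?add0r => [|i _]; first by rewrite /component/= inj_funE.
rewrite /component/= inj_fun0 ?linear0// => ki.
by have := ltn_ord i; rewrite -ki ltnn.
Qed.

Section nuclear.
Context (N : forall k, F k -> R) (p : seminorm E).
Hypotheses (NH : forall k, hilbertian (@N k))
  (surj : forall y, exists k v, u k v = y)
  (pN : forall k, summing (fun v => real_part p (u k v)) (@N k)).

Let H k : {fa : (nat -> {linear F k -> C^o}) * (nat -> R) &
    [/\ forall i, 0 <= fa.2 i, bsum fa.2,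
      forall i x, rn (fa.1 i x : C) <= fa.2 i * N x &
      forall x B, (forall i, rn (fa.1 i x : C) <= B) -> real_part p (u k x) <= B]}.
Proof. by apply: cid; have [f [a h]] := pN k; exists (f, a). Qed.

Let f k := (projT1 (H k)).1.
Let a k := (projT1 (H k)).2.

Let fP k : [/\ forall i, 0 <= a k i, bsum (a k),
      forall i x, rn (f k i x : C) <= a k i * N x &
      forall x B, (forall i, rn (f k i x : C) <= B) -> real_part p (u k x) <= B].
Proof. exact: projT2 (H k). Qed.

Let HA k : {A : R | 0 <= A & forall s, uniq s -> \sum_(i <- s) a k i <= A}.
Proof.
apply: cid2; have [a0 aS _ _] := fP k; have [A hA] := fsum_nat a0 aS.
by exists A => //; have := hA [::] erefl; rewrite big_nil.
Qed.

Let A k := s2val (HA k).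
Let A0 k : 0 <= A k. Proof. exact: s2valP (HA k). Qed.
Let AP k s : uniq s -> \sum_(i <- s) a k i <= A k.
Proof. by have := s2valP' (HA k); apply. Qed.

(** Of the factor 4^(k+1), one half 2^(k+1) compensates for the functionals of
    the k-th step being multiplied by 2^(k+1), and the other makes the family
    summable in k. *)
Let c k : R := 4 ^+ k.+1 * (A k + 1).
Let c0 k : 0 < c k.
Proof. by rewrite mulr_gt0 ?exprn_gt0// ltr_wpDl. Qed.

Let h k (x : dsum) : R := c k * N (component x k).

Let hH k : hilbertian (h k).
Proof.
have ck := c0 k; have N1 := (NH k).1; split; [split=> [x y|b x]|move=> x y].
- rewrite /h -mulrDr ler_pM2l//.
  by have := component_linear k 1 x y; rewrite !scale1r => ->; exact: N1.1.
- have := component_linear k b x 0; rewrite /h addr0 => ->.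
  by rewrite addr0 N1.2 mulrCA.
- rewrite /h !exprMn.
  have -> : component (x + y) k = component x k + component y k by [].
  have -> : component (x - y) k = component x k - component y k by [].
  by rewrite -mulrDr (NH k).2; ring.
Qed.

Let hfin x : bsum (fun k => h k x ^+ 2).
Proof.
apply: (@bsum_finite _ (dlen x)) => k /dlenP; rewrite /h => ->.
by rewrite (rseminorm0 (NH k).1) mulr0 expr0n.
Qed.

Let Q := l2norm h.

Let two k : R := 2 ^+ k.+1.
Let two0 k : 0 < two k. Proof. by rewrite exprn_gt0. Qed.

(** If all these are at most B in modulus, then p (u_k x_k) <= 2^-(k+1) B, and
    these bounds add up to at most B. *)
Let gfun (i : nat * nat) (x : dsum) : C^o :=
  (two i.1)%:C * f i.1 i.2 (component x i.1).

Let glin i : linear (gfun i).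
Proof.
by move=> b x y; rewrite /gfun component_linear linearP/= mulrDr mulrCA.
Qed.

Let half_sum n : \sum_(k < n) (two k)^-1 <= 1.
Proof.
suff -> : \sum_(k < n) (two k)^-1 = 1 - (2 ^+ n)^-1.
  by rewrite gerBl invr_ge0 exprn_ge0.
elim: n => [|n IH]; first by rewrite big_ord0 expr0 invr1 subrr.
rewrite big_ord_recr/= IH /two exprS invfM.
by field; rewrite expf_neq0.
Qed.

Let dsum_summing : summing (fun x => real_part p (dtotal x)) Q.
Proof.
have pP := real_part_seminorm p.
pose b (i : nat * nat) := (two i.1)^-1 * (a i.1 i.2 / (A i.1 + 1)).
have A1 k : 0 < A k + 1 by rewrite ltr_wpDl.
apply: (@summing_countable _ (nat * nat)%type _ _ _
  (fun i => linear_of (glin i)) b).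
- move=> [k i]; have [ak0 _ _ _] := fP k.
  by rewrite /b/= mulr_ge0 ?invr_ge0 ?(ltW (two0 k))// divr_ge0// ltW.
- apply: (@fsum_pair _ _ _ b (fun k => (two k)^-1)).
  + move=> [k i]; have [ak0 _ _ _] := fP k.
    by rewrite /b/= mulr_ge0 ?invr_ge0 ?(ltW (two0 k))// divr_ge0// ltW.
  + apply: fsum_nat; last by exists 1.
    by move=> k; rewrite invr_ge0 ltW.
  + move=> k s us; rewrite /b/= -mulr_sumr -mulr_suml.
    rewrite -[leRHS]mulr1 ler_pM2l ?invr_gt0// ler_pdivrMr// mul1r.
    by apply: le_trans (AP k us) _; rewrite lerDl.
- move=> [k i] x; rewrite /= /gfun/= rnM rn_real ger0_norm ?(ltW (two0 k))//.
  have [ak0 _ fa _] := fP k.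
  apply: (@le_trans _ _ (two k * (a k i * N (component x k)))).
    by rewrite ler_pM2l.
  apply: (@le_trans _ _ (b (k, i) * h k x)); last first.
    apply: ler_wpM2l (le_l2norm hH hfin x k).
    by rewrite /b/= mulr_ge0 ?invr_ge0 ?(ltW (two0 k))// divr_ge0// ltW.
  rewrite /b /h /c /two/= (_ : 4 = 2 * 2 :> R); last by ring.
  rewrite exprMn le_eqVlt; apply/orP; left; apply/eqP.
  by field; rewrite expf_neq0//= gt_eqF.
- move=> x B B0 gB; apply: (@le_trans _ _ (\sum_(k < dlen x) (two k)^-1 * B)).
    apply: (le_trans (rseminorm_sum pP _ _ _)); apply: ler_sum => k _.
    have [_ _ _] := fP k; apply => i; have := gB (k : nat, i).
    rewrite /= /gfun/= rnM rn_real ger0_norm ?(ltW (two0 k))//.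
    by rewrite ler_pdivlMl.
  by rewrite -mulr_suml -[leRHS]mul1r ler_wpM2r.
Qed.

(** E is the quotient by the kernel of dtotal of the direct sum of the F k, on
    which the l^2 sum Q of the weighted seminorms is hilbertian.  The quotient
    seminorm of Q is bounded on each F k because Q restricts there to a
    multiple of N k. *)
Theorem inductive_nuclear_link : exists (q : E -> R) (qP : rseminorm q),
  [/\ forall y, p y <= seminorm_of qP y,
      forall k, exists2 c, 0 <= c & forall v, q (u k v) <= c * N v &
      nuclear_link (seminorm_of qP) p].
Proof.
have [g [b [b0 bS gb pg]]] := dsum_summing.
have surjX y : exists x, linear_of dtotal_linear x = y.
  by have [k [v <-]] := surj y; exists (dinj v); exact: dtotal_dinj.
have [q [qP [pq [d d0 qd] link]]] := summing_nuclear_link (s := linear_of dtotal_linear)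
  surjX (l2norm_hilbertian hH hfin) b0 bS gb pg.
exists q, qP; split=> // k; exists (d * c k); first by rewrite mulr_ge0// ltW.
move=> v; have := qd (dinj v); rewrite /= dtotal_dinj => /le_trans; apply.
rewrite -mulrA ler_wpM2l//; apply: (l2norm_le hH hfin) => [|m].
  by rewrite mulr_ge0 ?(ltW (c0 k)) ?(rseminorm_ge0 (NH k).1).
have hk : h k (dinj v) = c k * N v by rewrite /h /component/= inj_funE.
have hl l : l <> k -> h l (dinj v) = 0.
  move=> lk; rewrite /h /component/= inj_fun0; last by move=> e; apply: lk.
  by rewrite (rseminorm0 (NH l).1) mulr0.
have [mk|km] := leqP m k.
  rewrite /sqsum big1 ?sqr_ge0// => i _; rewrite hl ?expr0n// => ik.
  by have := ltn_ord i; rewrite ik ltnNge mk.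
rewrite /sqsum (bigD1 (Ordinal km))//= big1 ?addr0 ?hk// => i ik.
by rewrite hl ?expr0n// => iE; move/eqP: ik; apply; exact/val_inj.
Qed.

End nuclear.
End direct_sum.

(** * Commutation of partial derivatives *)

Lemma dist_halves (R : realFieldType) (P Q S e : R) :
  `|S - P| < e / 2 -> `|Q - P| < e / 2 -> `|Q - S| <= e.
Proof.
move=> h1 h2; apply: le_trans (ler_distD P Q S) _.
by rewrite [`|P - S|]distrC; lra.
Qed.

Section directional.
Context (R : realType) (d : nat).
Implicit Types (u : 'rV[R]_d -> R) (x v w : 'rV[R]_d).

Lemma is_derive_line u x v (t : R) : derivable u (x + t *: v) v ->
  is_derive t (1 : R) (fun r : R => u (x + r *: v)) ('D_v u (x + t *: v)).
Proof.
have E : (fun h : R => h^-1 *: (((fun r : R => u (x + r *: v)) \o shift t) (h *: (1 : R)) -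
     u (x + t *: v))) =
   (fun h : R => h^-1 *: ((u \o shift (x + t *: v)) (h *: v) - u (x + t *: v))).
  apply/funext => h /=; congr (_ *: (u _ - _)).
  by rewrite [h *: 1]mulr1 scalerDl addrCA.
by move=> du; apply: DeriveDef; rewrite /derivable /derive E.
Qed.

Lemma mvt_line (f df : R -> R) (a b : R) : a < b ->
  (forall t : R, is_derive t (1 : R) f (df t)) ->
  exists2 c, a < c < b & f b - f a = df c * (b - a).
Proof.
move=> ab fdf; have [|c] := @MVT R f df a b ab (fun y _ => fdf y).
  by apply: derivable_within_continuous => y _; have [] := fdf y.
by rewrite in_itv/=; exists c.
Qed.

Lemma second_difference u v w x t : 0 < t ->
  (forall y, derivable u y v) -> (forall y, derivable ('D_v u) y w) ->
  exists c c', [/\ 0 < c < t, 0 < c' < t &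
    u (x + t *: v + t *: w) - u (x + t *: v) - u (x + t *: w) + u x =
    'D_w ('D_v u) (x + c *: v + c' *: w) * t ^+ 2].
Proof.
move=> t0 dv dw.
pose G r := u (x + t *: w + r *: v) - u (x + r *: v).
have dG (r : R) : is_derive r (1 : R) G ('D_v u (x + t *: w + r *: v) - 'D_v u (x + r *: v)).
  by apply: is_deriveB; exact: is_derive_line.
have [c cP Gc] := mvt_line t0 dG.
have dH (r : R) : is_derive r (1 : R) (fun r : R => 'D_v u (x + c *: v + r *: w))
    ('D_w ('D_v u) (x + c *: v + r *: w)) by exact: is_derive_line.
have [c' cP' Hc] := mvt_line t0 dH.
exists c, c'; split => //.
move: Gc Hc; rewrite /G !scale0r !addr0 !subr0 => Gc Hc.
have -> : x + t *: v + t *: w = x + t *: w + t *: v by rewrite addrAC.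
have E : x + c *: v + t *: w = x + t *: w + c *: v by rewrite addrAC.
by rewrite expr2 mulrA -Hc E -Gc; ring.
Qed.

Lemma line_near x v w (P : set 'rV[R]_d) : nbhs x P ->
  exists2 t, 0 < t & forall c c', 0 < c < t -> 0 < c' < t -> P (x + c *: v + c' *: w).
Proof.
move=> /nbhs_ballP[e /= e0 eP].
have K0 : 0 < `|v| + `|w| + 1 by rewrite ltr_wpDl// addr_ge0.
exists (e / (`|v| + `|w| + 1)); first by rewrite divr_gt0.
move=> c c' /andP[c0 ct] /andP[c'0 c't]; apply: eP.
rewrite -ball_normE/= -addrA opprD addrA subrr sub0r normrN.
apply: (le_lt_trans (ler_normD _ _)); rewrite !normrZ !gtr0_norm//.
set t := e / _ in ct c't; have t0 : 0 < t by rewrite divr_gt0.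
apply: (@le_lt_trans _ _ (t * (`|v| + `|w|))).
  by rewrite mulrDr lerD// ler_wpM2r// ltW.
apply: (@lt_le_trans _ _ (t * (`|v| + `|w| + 1))).
  by rewrite ltr_pM2l// ltrDl.
by rewrite /t divfK// gt_eqF.
Qed.

(** The second difference along v and w does not depend on the order of v and w,
    and it is t^2 times the value of either mixed derivative at a nearby point. *)
Lemma derive_swap u v w x :
  (forall y, derivable u y v) -> (forall y, derivable u y w) ->
  (forall y, derivable ('D_v u) y w) -> (forall y, derivable ('D_w u) y v) ->
  continuous ('D_w ('D_v u)) -> continuous ('D_v ('D_w u)) ->
  'D_w ('D_v u) x = 'D_v ('D_w u) x.
Proof.
move=> dv dw dvw dwv cvw cwv; apply/eqP; rewrite -subr_eq0 -normr_le0.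
apply/ler_addgt0Pr => e e0; rewrite add0r.
have e2 : 0 < e / 2 by rewrite divr_gt0.
have /cvgrPdist_lt/(_ _ e2) := cvw x; have /cvgrPdist_lt/(_ _ e2) := cwv x.
move=> /(line_near w v)[t1 t10 h1] /(line_near v w)[t2 t20 h2].
pose t := Num.min t1 t2; have t0 : 0 < t by rewrite lt_min t10.
have [c [c' [cP cP' E]]] := second_difference x t0 dv dvw.
have [k [k' [kP kP' E']]] := second_difference x t0 dw dwv.
have tt1 c1 : 0 < c1 < t -> 0 < c1 < t1.
  by rewrite /t lt_min => /and3P[-> ->].
have tt2 c1 : 0 < c1 < t -> 0 < c1 < t2.
  by rewrite /t lt_min => /and3P[-> _ ->].
have {}h1 := h1 k k' (tt1 _ kP) (tt1 _ kP').
have {}h2 := h2 c c' (tt2 _ cP) (tt2 _ cP').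
have E2 : 'D_w ('D_v u) (x + c *: v + c' *: w) =
    'D_v ('D_w u) (x + k *: w + k' *: v).
  have tn : t ^+ 2 != 0 by rewrite expf_neq0// gt_eqF.
  apply: (mulIf tn); apply: etrans (esym E) (etrans _ E').
  by rewrite (addrAC x (t *: v)); ring.
rewrite -E2 in h1; move: h1 h2; move: ('D_w _ _) ('D_w _ x) ('D_v _ x) => P Q S.
exact: dist_halves.
Qed.

End directional.

Section commuting_partials.
Context (R : realType) (d : nat).
Implicit Types (phi : 'rV[R]_d -> R[i]) (s t : seq 'I_d).

Lemma partials_cat s t phi : partials (s ++ t) phi = partials s (partials t phi).
Proof. by rewrite /partials foldr_cat. Qed.

Lemma smooth_partials s phi : smooth phi -> smooth (partials s phi).
Proof. by move=> sphi t; have := sphi (t ++ s); rewrite partials_cat. Qed.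

Lemma partial_swap i j phi : smooth phi ->
  partial i (partial j phi) = partial j (partial i phi).
Proof.
move=> sphi; apply/funext => x; rewrite /partial/=.
have [_ _ d0] := sphi [::].
have [_ _ di] := sphi [:: i]; have [_ _ dj] := sphi [:: j].
have [cij1 cij2 _] := sphi [:: i; j]; have [cji1 cji2 _] := sphi [:: j; i].
apply: (f_equal2 (@Complex R)).
- exact: (@derive_swap R d (fun y => complex.Re (phi y)) _ _ x
    (fun y => (d0 j y).1) (fun y => (d0 i y).1)
    (fun y => (dj i y).1) (fun y => (di j y).1) cij1 cji1).
- exact: (@derive_swap R d (fun y => complex.Im (phi y)) _ _ x
    (fun y => (d0 j y).2) (fun y => (d0 i y).2)
    (fun y => (dj i y).2) (fun y => (di j y).2) cij2 cji2).
Qed.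

Lemma partials_swap_front s i t phi : smooth phi ->
  partials (s ++ i :: t) phi = partials (i :: s ++ t) phi.
Proof.
move=> sphi; elim: s => [//|j s IH].
rewrite -[LHS]/(partial j (partials (s ++ i :: t) phi)) IH.
exact: (partial_swap j i (smooth_partials (s ++ t) sphi)).
Qed.

Lemma partials_perm s t phi : smooth phi -> perm_eq s t ->
  partials s phi = partials t phi.
Proof.
move=> sphi; elim: s t => [|i s IH] t; first by rewrite perm_sym => /perm_nilP ->.
move=> st; have : i \in t by rewrite -(perm_mem st) mem_head.
move=> /path.splitPr tE; case: tE st => t1 t2 st.
rewrite partials_swap_front//=; congr partial; apply: IH.
rewrite -(perm_cons i); apply: perm_trans st _.
by rewrite -[i :: t2]cat1s perm_catCA.
Qed.

Definition mindex_seq (al : 'I_d -> nat) : seq 'I_d :=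
  flatten [seq nseq (al i) i | i <- enum 'I_d].

Lemma mpartial_seq al phi : mpartial al phi = partials (mindex_seq al) phi.
Proof.
rewrite /mpartial /mindex_seq; elim: (enum 'I_d) => //= i s ->.
by rewrite partials_cat; elim: (al i) => //= n ->.
Qed.

Lemma count_mindex_seq al i : count_mem i (mindex_seq al) = al i.
Proof.
rewrite /mindex_seq count_flatten sumnE 2!big_map big_enum/=.
rewrite (bigD1 i)//= count_nseq /= eqxx mul1n big1 ?addn0// => j ji.
by rewrite count_nseq/= (negbTE ji) mul0n.
Qed.

Lemma size_mindex_seq al : size (mindex_seq al) = multi_abs al.
Proof.
rewrite /mindex_seq size_flatten sumnE 2!big_map big_enum/=.
by apply: eq_bigr => i _; rewrite size_nseq.
Qed.

(** Iterated partial derivatives of a smooth function depend only on how often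
    each variable occurs. *)
Lemma partials_mpartial r al phi : smooth phi -> exists be : 'I_d -> nat,
  multi_abs be = (size r + multi_abs al)%N /\
  partials r (mpartial al phi) = mpartial be phi.
Proof.
move=> sphi; pose be i := (count_mem i r + al i)%N; exists be.
have pE : perm_eq (r ++ mindex_seq al) (mindex_seq be).
  apply/allP => i _; apply/eqP; rewrite count_cat !count_mindex_seq//.
split; first by rewrite -size_mindex_seq -(perm_size pE) size_cat size_mindex_seq.
by rewrite !mpartial_seq -partials_cat; exact: partials_perm.
Qed.

Lemma rn_mD al phi x : rn (mD al phi x : R[i]) = rn (mpartial al phi x).
Proof.
rewrite /mD rnM (_ : rn _ = 1) ?mul1r//.
elim: (multi_abs al) => [|n IH]; first by rewrite expr0 rn1.
by rewrite exprS rnM IH mulr1 rnN rn_normc /= expr0n expr1n add0r sqrtr1.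
Qed.

End commuting_partials.

(** * Midpoint coefficients on an interval *)

Section midpoint_coefficients.
Context (R : realType).
Local Notation C := R[i].

(** Level 0 consists of the two end points, level j + 1 of the midpoints of the
    2^j dyadic intervals of length 2^-j. *)
Definition node_count (j : nat) : nat := if j is j'.+1 then 2 ^ j' else 2.

(** Any base strictly between 1 and 2 would do: the inverse weights are summable,
    and the 2^j coefficients of level j remain summable when second differences
    are of order 4^-j. *)
Definition weight (j : nat) : C := ((4 / 3) ^+ j)%:C.

(** The coefficient of index c as a list of pairs of a factor and a node, so that
    it is visibly a finite combination of point values. *)
Definition terms (c : nat * nat) : seq (C * R) :=
  if (c.2 < node_count c.1)%N then
    if c.1 is j.+1 then
      [:: (weight j, (c.2.*2.+1)%:R / 2 ^+ j.+1);
          (- weight j / 2, c.2%:R / 2 ^+ j);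
          (- weight j / 2, (c.2.+1)%:R / 2 ^+ j)]
    else [:: (1, c.2%:R)]
  else [::].

Definition coef (c : nat * nat) (g : R -> C) : C :=
  \sum_(p <- terms c) p.1 * g p.2.

(** The size of the coefficients of a function bounded by 1 with its second
    derivative; there are none beyond the last node of a level. *)
Definition decay (c : nat * nat) : R :=
  if (c.2 < node_count c.1)%N then 3 * 3^-1 ^+ c.1 else 0.

Lemma decay_ge0 c : 0 <= decay c.
Proof. by rewrite /decay; case: ifP => // _; rewrite mulr_ge0// exprn_ge0. Qed.

Lemma sum_const_ltn (s : seq nat) (n : nat) (a : R) : 0 <= a -> uniq s ->
  \sum_(l <- s) (if (l < n)%N then a else 0) <= n%:R * a.
Proof.
move=> a0 us; rewrite -big_mkcond/= big_const_seq iter_addr_0 -[a *+ _]mulr_natl.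
rewrite ler_wpM2r// ler_nat -size_filter -[leqRHS](size_iota 0).
apply: uniq_leq_size; first exact: filter_uniq.
by move=> l; rewrite mem_filter mem_iota => /andP[].
Qed.

(** At most 2 * 2^j nodes of level j, each contributing 3 * 3^-j. *)
Lemma decay_fsum : fsum decay.
Proof.
apply: (@fsum_pair _ _ _ decay (fun j => 6 * (2 / 3) ^+ j)).
- exact: decay_ge0.
- apply: fsum_nat; first by move=> i; rewrite mulr_ge0// exprn_ge0// divr_ge0.
  apply: bsumZ => //; apply: geometric_bsum; first by rewrite divr_ge0.
  by rewrite ltr_pdivrMr// mul1r ltr_nat.
move=> j s us; rewrite /decay/=.
have a0 : 0 <= 3 * 3^-1 ^+ j :> R by rewrite mulr_ge0// exprn_ge0.
apply: le_trans (sum_const_ltn (node_count j) a0 us) _.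
have -> : 6 * (2 / 3) ^+ j = (2 * 2 ^+ j) * (3 * 3^-1 ^+ j) :> R.
  by rewrite exprMn; ring.
rewrite ler_wpM2r//; case: j {a0} => [|j]; first by rewrite /= expr0 mulr1.
rewrite /= natrX exprS; have : 0 <= 2 ^+ j :> R by rewrite exprn_ge0.
by lra.
Qed.

Lemma second_difference_le (f f1 f2 : R -> R) (m e B : R) : 0 < e ->
  (forall t : R, is_derive t (1 : R) f (f1 t)) ->
  (forall t : R, is_derive t (1 : R) f1 (f2 t)) ->
  (forall t, m - e <= t <= m + e -> `|f2 t| <= B) ->
  `|f m - (f (m - e) + f (m + e)) / 2| <= e ^+ 2 * B.
Proof.
move=> e0 df df1 f2B.
have [|a aP fa] := mvt_line _ df (a := m - e) (b := m); first by lra.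
have [|b bP fb] := mvt_line _ df (a := m) (b := m + e); first by lra.
have ab : a < b by lra.
have [c cP fc] := mvt_line ab df1.
have {}f2B : `|f2 c| <= B by apply: f2B; lra.
have -> : f m - (f (m - e) + f (m + e)) / 2 = - (e / 2 * ((b - a) * f2 c)).
  have -> : (b - a) * f2 c = f1 b - f1 a by rewrite fc mulrC.
  have : f m = f (m - e) + f1 a * e by rewrite -[f m](subrK (f (m - e))) fa; ring.
  have : f (m + e) = f m + f1 b * e by rewrite -[f (m + e)](subrK (f m)) fb; ring.
  by move=> h h'; rewrite h; lra.
have e20 : 0 < e / 2 by rewrite divr_gt0.
have ba0 : 0 < b - a by rewrite subr_gt0.
rewrite normrN (normrM (e / 2)) (normrM (b - a)) (gtr0_norm e20) (gtr0_norm ba0).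
apply: (@le_trans _ _ (e / 2 * ((e + e) * B))).
  apply: ler_wpM2l; first exact: ltW.
  by apply: ler_pM => //; [exact: ltW|lra].
by lra.
Qed.

Lemma coefE0 c g : (node_count c.1 <= c.2)%N -> coef c g = 0.
Proof. by move=> h; rewrite /coef /terms ltnNge h/= big_nil. Qed.

Lemma coefE1 l g : (l < 2)%N -> coef (0%N, l) g = g l%:R.
Proof. by move=> h; rewrite /coef /terms h/= big_seq1 mul1r. Qed.

Lemma coefES j l g : (l < 2 ^ j)%N ->
  coef (j.+1, l) g = weight j * (g (l.*2.+1%:R / 2 ^+ j.+1) -
    (g (l%:R / 2 ^+ j) + g (l.+1%:R / 2 ^+ j)) / 2).
Proof.
move=> h; rewrite /coef /terms/= h !big_cons big_nil/= addr0.
by rewrite mulrBr !mulNr; ring.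
Qed.

Lemma rn_weight j : rn (weight j) = (4 / 3) ^+ j.
Proof. by rewrite rn_real ger0_norm// exprn_ge0// divr_ge0. Qed.

(** A second difference of step e = 2^-(j+1) is at most e^2 times the second
    derivative, and (4/3)^j e^2 = 3^-j / 4.  The derivatives of the real and
    imaginary parts are bounded separately, whence a factor 2. *)
Lemma coef_le (g : R -> C) (f1 f2 h1 h2 : R -> R) (B : R) c :
  (forall t : R, is_derive t (1 : R) (fun t => complex.Re (g t)) (f1 t)) ->
  (forall t : R, is_derive t (1 : R) f1 (f2 t)) ->
  (forall t : R, is_derive t (1 : R) (fun t => complex.Im (g t)) (h1 t)) ->
  (forall t : R, is_derive t (1 : R) h1 (h2 t)) ->
  (forall t, 0 <= t <= 1 -> [/\ rn (g t) <= B, `|f2 t| <= B & `|h2 t| <= B]) ->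
  rn (coef c g) <= decay c * B.
Proof.
move=> df df1 dh dh1 gB; case: c => j l; rewrite /decay /=.
case: ifP => [lj|/negbT]; last first.
  by rewrite -leqNgt => h; rewrite coefE0// rn0 mul0r.
case: j lj => [|j] lj.
  rewrite coefE1// expr0 mulr1.
  have [|gl _ _] := gB l%:R.
    by case: l lj => [|[|]]//= _; rewrite ?lexx ?ler01.
  by have := rn_ge0 (g l%:R); lra.
rewrite coefES// rnM rn_weight.
set m := l.*2.+1%:R / 2 ^+ j.+1; pose e : R := (2 ^+ j.+1)^-1.
have p0 : 0 < 2 ^+ j :> R by rewrite exprn_gt0.
have e0 : 0 < e by rewrite invr_gt0 exprn_gt0.
have lm : l.*2.+1%:R = 2 * l%:R + 1 :> R.
  by rewrite -natr1 -muln2 natrM mulrC.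
have el : l%:R / 2 ^+ j = m - e.
  by rewrite /m /e lm exprS; field; rewrite gt_eqF.
have er : l.+1%:R / 2 ^+ j = m + e.
  by rewrite /m /e lm exprS -natr1; field; rewrite gt_eqF.
have l0 : 0 <= m - e by rewrite -el divr_ge0// exprn_ge0.
have r1 : m + e <= 1 by rewrite -er ler_pdivrMr// mul1r -natrX ler_nat.
have tI t : m - e <= t <= m + e -> 0 <= t <= 1.
  by move=> /andP[h h']; rewrite (le_trans l0)// (le_trans h').
have hf : `|complex.Re (g m) - (complex.Re (g (m - e)) + complex.Re (g (m + e))) / 2|
    <= e ^+ 2 * B.
  by apply: (second_difference_le e0 df df1) => t /tI /gB[].
have hh : `|complex.Im (g m) - (complex.Im (g (m - e)) + complex.Im (g (m + e))) / 2|
    <= e ^+ 2 * B.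
  by apply: (second_difference_le e0 dh dh1) => t /tI /gB[].
have h : rn (g m - (g (m - e) + g (m + e)) / 2) <= e ^+ 2 * B + e ^+ 2 * B.
  apply: (le_trans (rn_le_ReIm _)); apply: lerD.
    apply: le_trans hf; rewrite le_eqVlt; apply/orP; left; apply/eqP.
    congr (`|_|); case: (g m) (g (m - e)) (g (m + e)) => [a b] [a' b'] [a'' b''] /=.
    by field.
  apply: le_trans hh; rewrite le_eqVlt; apply/orP; left; apply/eqP.
  congr (`|_|); case: (g m) (g (m - e)) (g (m + e)) => [a b] [a' b'] [a'' b''] /=.
  by field.
have B0 : 0 <= B.
  have [|gl _ _] := gB 0; first by rewrite lexx ler01.
  exact: le_trans (rn_ge0 _) gl.
rewrite el er; apply: (@le_trans _ _ ((4 / 3) ^+ j * (e ^+ 2 * B + e ^+ 2 * B))).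
  by rewrite ler_wpM2l// exprn_ge0// divr_ge0.
have E : (4 / 3) ^+ j * e ^+ 2 = 3^-1 ^+ j / 4.
  have -> : (4 / 3) ^+ j = 2 ^+ j * 2 ^+ j * 3^-1 ^+ j :> R.
    by rewrite -!exprMn; congr (_ ^+ _); field.
  rewrite /e (exprS 2 j); move: (2 ^+ j) p0 (3^-1 ^+ j) => P P0 T.
  by field; rewrite gt_eqF.
have -> : (4 / 3) ^+ j * (e ^+ 2 * B + e ^+ 2 * B) =
    2 * ((4 / 3) ^+ j * e ^+ 2) * B by ring.
rewrite E exprS; have : 0 <= 3^-1 ^+ j * B by rewrite mulr_ge0// exprn_ge0.
by lra.
Qed.

(** A value at a new dyadic point differs from the mean of its two neighbours by
    at most (3/4)^j B.  By induction the values at level j are at most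
    B (1 + sum_(i < j) (3/4)^i) = B (5 - 4 (3/4)^j), and the other points are
    limits of dyadic ones. *)
Lemma coef_sup (g : R -> C) (B : R) :
  (forall t, 0 <= t -> scvg (fun j => g ((Num.truncn (t * 2 ^+ j))%:R / 2 ^+ j)) (g t)) ->
  0 <= B -> (forall c, rn (coef c g) <= B) ->
  forall t, 0 <= t <= 1 -> rn (g t) <= 5 * B.
Proof.
move=> gc B0 gB.
have dyadic j l : (l <= 2 ^ j)%N ->
    rn (g (l%:R / 2 ^+ j)) <= B * (5 - 4 * (3 / 4) ^+ j).
  elim: j l => [|j IH] l lj.
    rewrite !expr0 divr1 mulr1 -(@coefE1 l g); last by rewrite ltnS.
    by rewrite (le_trans (gB _))// -[leLHS]mulr1 ler_wpM2l//; lra.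
  have q0 : 0 <= (3 / 4) ^+ j :> R by rewrite exprn_ge0// divr_ge0.
  have mono : B * (5 - 4 * (3 / 4) ^+ j) + B * (3 / 4) ^+ j =
      B * (5 - 4 * (3 / 4) ^+ j.+1) by rewrite exprS; field.
  have p0 : 2 ^+ j != 0 :> R by rewrite expf_neq0.
  have := odd_double_half l; case: (odd l) => /= lE.
    have l2 : (l./2 < 2 ^ j)%N.
      by move: lj; rewrite expnS; lia.
    have := gB (j.+1, l./2); rewrite coefES// rnM rn_weight.
    rewrite add1n in lE; rewrite lE => h.
    have hl := IH _ (ltnW l2); have hr := IH _ l2.
    rewrite -mono.
    set G := g (l%:R / _) in h *.
    set Gl := g (l./2%:R / _) in h hl; set Gr := g (l./2.+1%:R / _) in h hr.
    have {}h : rn (G - (Gl + Gr) / 2) <= B * (3 / 4) ^+ j.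
      have -> : (3 / 4) ^+ j = ((4 / 3) ^+ j)^-1 :> R by rewrite -exprVn invfM invrK mulrC.
      by rewrite ler_pdivlMr ?exprn_gt0 ?divr_gt0// mulrC.
    have h2 : rn ((Gl + Gr) / 2) <= (rn Gl + rn Gr) / 2.
      rewrite rnM rnV (_ : rn 2 = 2); last first.
        by rewrite -[2 : C](rmorph_nat (real_complex R)) rn_real ger0_norm.
      by rewrite ler_wpM2r ?invr_ge0// rnD.
    have := rnD (G - (Gl + Gr) / 2) ((Gl + Gr) / 2); rewrite subrK.
    by lra.
  rewrite add0n in lE; rewrite -mono -lE.
  have -> : (l./2.*2)%:R / 2 ^+ j.+1 = l./2%:R / 2 ^+ j :> R.
    by rewrite -muln2 natrM exprS; field.
  apply: (@le_trans _ _ (B * (5 - 4 * (3 / 4) ^+ j))); last first.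
    by rewrite lerDl mulr_ge0.
  by apply: IH; rewrite -leq_double lE -mul2n -expnS.
move=> t /andP[t0 t1]; apply/ler_addgt0Pr => e e0.
have [j hj] := gc t t0 e e0; have {}hj := hj j (leqnn j).
have p0 : 0 < 2 ^+ j :> R by rewrite exprn_gt0.
have nj : (Num.truncn (t * 2 ^+ j) <= 2 ^ j)%N.
  rewrite -(ler_nat R) natrX; apply: (@le_trans _ _ (t * 2 ^+ j)).
    by rewrite truncn_le// mulr_ge0// ltW.
  by rewrite -[leRHS]mul1r ler_pM2r.
have := dyadic j _ nj; move: hj; set G := g (_ / _); rewrite rnB => hj hG.
have := rnD (g t - G) G; rewrite subrK.
have : B * (5 - 4 * (3 / 4) ^+ j) <= 5 * B.
  by rewrite mulrC ler_wpM2r// gerBl mulr_ge0// exprn_ge0// divr_ge0.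
by lra.
Qed.

End midpoint_coefficients.

(** * Midpoint coefficients on a cube *)

Section substitution.
Context (R : realType) (d : nat).
Local Notation C := R[i].
Local Notation e i := (delta_mx 0 i : 'rV[R]_d).
Implicit Types (x y : 'rV[R]_d) (psi : 'rV[R]_d -> C).

Definition subst (i : 'I_d) (t : R) x : 'rV[R]_d :=
  \row_j (if j == i then t else x 0 j).

Lemma subst_id i x : subst i (x 0 i) x = x.
Proof. by apply/rowP => j; rewrite mxE; case: eqP => [->|]. Qed.

Lemma substE i a t x : subst i (a + t) x = subst i a x + t *: e i.
Proof.
apply/rowP => j; rewrite !mxE eqxx/= eq_sym.
by case: eqP => _; rewrite ?mulr1// mulr0 addr0.
Qed.

Lemma subst_shift i j t (h : R) x : i != j ->
  subst i t (h *: e j + x) = h *: e j + subst i t x.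
Proof.
move=> ij; apply/rowP => k; rewrite !mxE eqxx/=.
by case: (k =P i) => // ->; rewrite (negbTE ij) mulr0 add0r.
Qed.

Lemma subst_shift_same i t (h : R) x : subst i t (h *: e i + x) = subst i t x.
Proof.
apply/rowP => k; rewrite !mxE eqxx/=; case: (k =P i) => // _.
by rewrite mulr0 add0r.
Qed.

Lemma subst_continuous i t : continuous (subst i t).
Proof.
move=> x A /nbhs_ballP[eps /= eps0 epsA].
apply/nbhs_ballP; exists eps => //= y [_ xy]; apply: epsA; split=> // k l.
by rewrite !mxE; case: (l == i); [exact: ballxx|exact: xy].
Qed.

(** Keeping the frozen variable as a dummy makes psub i t an endomorphism of
    the space of smooth functions, so that it can be iterated. *)
Definition psub i t psi : 'rV[R]_d -> C := fun x => psi (subst i t x).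

Lemma derive_subst (u : 'rV[R]_d -> R) i j t x : i != j ->
  'D_(e j) (fun y => u (subst i t y)) x = 'D_(e j) u (subst i t x) /\
  (derivable u (subst i t x) (e j) -> derivable (fun y => u (subst i t y)) x (e j)).
Proof.
move=> ij; rewrite /derive /derivable.
rewrite (_ : (fun h : R => h^-1 *: (((fun y => u (subst i t y)) \o shift x) (h *: e j) -
    u (subst i t x))) = (fun h : R => h^-1 *: ((u \o shift (subst i t x)) (h *: e j) -
    u (subst i t x))))//.
by apply/funext => h /=; rewrite subst_shift.
Qed.

Lemma derive_subst_same (u : 'rV[R]_d -> R) i t x :
  'D_(e i) (fun y => u (subst i t y)) x = 0 /\
  derivable (fun y => u (subst i t y)) x (e i).
Proof.
rewrite /derive /derivable.
rewrite (_ : (fun h : R => h^-1 *: (((fun y => u (subst i t y)) \o shift x) (h *: e i) -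
    u (subst i t x))) = (fun h : R => 0)); last first.
  by apply/funext => h /=; rewrite subst_shift_same subrr scaler0.
split; first exact: lim_cst.
by apply/cvg_ex; exists 0; exact: cvg_cst.
Qed.

Lemma partial_psub i j t psi : i != j ->
  partial j (psub i t psi) = psub i t (partial j psi).
Proof.
move=> ij; apply/funext => x; apply: (f_equal2 (@Complex R)).
- exact: (derive_subst (fun y => complex.Re (psi y)) t x ij).1.
- exact: (derive_subst (fun y => complex.Im (psi y)) t x ij).1.
Qed.

Lemma partial_psub_same i t psi : partial i (psub i t psi) = fun _ => 0.
Proof.
apply/funext => x; apply: (f_equal2 (@Complex R)).
- exact: (derive_subst_same (fun y => complex.Re (psi y)) i t x).1.
- exact: (derive_subst_same (fun y => complex.Im (psi y)) i t x).1.
Qed.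

Lemma partials_zero s : partials s (fun _ : 'rV[R]_d => 0 : C) = fun _ => 0.
Proof.
elim: s => //= i s ->; apply/funext => x.
by apply: (f_equal2 (@Complex R)); exact: derive_cst.
Qed.

Lemma partials_psub s i t psi : partials s (psub i t psi) =
  if i \in s then fun _ => 0 else psub i t (partials s psi).
Proof.
elim: s => [//|j s IH].
rewrite -[LHS]/(partial j (partials s (psub i t psi))) IH in_cons.
have [<- /=|ij] := eqVneq i j; case: ifP => _ /=.
- exact: (partials_zero [:: j]).
- exact: partial_psub_same.
- exact: (partials_zero [:: j]).
- exact: partial_psub.
Qed.

Lemma smooth_psub i t psi : smooth psi -> smooth (psub i t psi).
Proof.
move=> spsi s; rewrite partials_psub; case: ifP => _.
  by have := @smooth0 R d [::].
have [cr ci dr] := spsi s; split.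
- move=> x.
  exact: (@continuous_comp _ _ _ (subst i t)
    (fun y => complex.Re (partials s psi y)) x (@subst_continuous i t x) (cr _)).
- move=> x.
  exact: (@continuous_comp _ _ _ (subst i t)
    (fun y => complex.Im (partials s psi y)) x (@subst_continuous i t x) (ci _)).
move=> j x; have [<-|ij] := eqVneq i j.
  split; [exact: (derive_subst_same (fun y => complex.Re (partials s psi y)) i t x).2
         |exact: (derive_subst_same (fun y => complex.Im (partials s psi y)) i t x).2].
have [d1 d2] := dr j (subst i t x).
split; [exact: (derive_subst (fun y => complex.Re (partials s psi y)) t x ij).2
       |exact: (derive_subst (fun y => complex.Im (partials s psi y)) t x ij).2].
Qed.

Section linear_combination.
Context (T : Type) (f : T -> 'rV[R]_d -> C).
Hypothesis fs : forall t, smooth (f t).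

Lemma lincomb_partials (l : seq (C * T)) :
  smooth (fun x => \sum_(p <- l) p.1 * f p.2 x) /\
  forall s, partials s (fun x => \sum_(p <- l) p.1 * f p.2 x) =
    (fun x => \sum_(p <- l) p.1 * partials s (f p.2) x).
Proof.
elim: l => [|p l [sl pl]].
  have -> : (fun x => \sum_(p <- [::]) p.1 * f p.2 x) = (fun _ => 0).
    by apply/funext => x; rewrite big_nil.
  split; first exact: smooth0.
  by move=> s; rewrite partials_zero; apply/funext => x; rewrite big_nil.
have E : (fun x => \sum_(p <- p :: l) p.1 * f p.2 x) =
    (fun x => p.1 * f p.2 x + \sum_(p <- l) p.1 * f p.2 x).
  by apply/funext => x; rewrite big_cons.
rewrite E; split; first exact: (smooth_linear p.1 (fs p.2) sl).
move=> s; rewrite (partials_linear s p.1 (fs p.2) sl) pl.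
by apply/funext => x; rewrite big_cons.
Qed.

End linear_combination.

(** The result still depends on the other variables, so that such operators for
    distinct coordinates can be composed. *)
Definition coord_coef (k : R) (i : 'I_d) (c : nat * nat) psi : 'rV[R]_d -> C :=
  fun x => coef c (fun t => psi (subst i (k + t) x)).

Lemma coord_coef_smooth k i c psi : smooth psi -> smooth (coord_coef k i c psi).
Proof.
move=> spsi.
exact: (lincomb_partials (fun t => smooth_psub i (k + t) spsi) (terms R c)).1.
Qed.

Lemma coord_coef_partials k i c psi s : smooth psi -> i \notin s ->
  partials s (coord_coef k i c psi) = coord_coef k i c (partials s psi).
Proof.
move=> spsi /negbTE si.
rewrite (lincomb_partials (fun t => smooth_psub i (k + t) spsi) (terms R c)).2.
by apply/funext => x; apply: eq_bigr => p _; rewrite partials_psub si.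
Qed.

Context (k : 'I_d -> R).

Definition in_box x := forall i, k i <= x 0 i <= k i + 1.

Lemma subst_in_box i t x : in_box x -> 0 <= t <= 1 ->
  in_box (subst i (k i + t) x).
Proof.
move=> xb tI j; rewrite mxE; case: eqP => [->|//].
by rewrite lerDl lerD2l.
Qed.

Definition box_coef (c : 'I_d -> nat * nat) (s : seq 'I_d) psi :=
  foldr (fun i => coord_coef (k i) i (c i)) psi s.

Lemma box_coef_smooth c s psi : smooth psi -> smooth (box_coef c s psi).
Proof.
move=> spsi; elim: s => [|i s IH]; first exact: spsi.
exact: (coord_coef_smooth (k i) i (c i) IH).
Qed.

Lemma box_coef_partials c s r psi : smooth psi ->
  (forall i, i \in s -> i \notin r) ->
  partials r (box_coef c s psi) = box_coef c s (partials r psi).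
Proof.
move=> spsi; elim: s => //= i s IH sr.
rewrite coord_coef_partials; [|exact: box_coef_smooth|by rewrite sr// mem_head].
by rewrite IH// => j js; rewrite sr// in_cons js orbT.
Qed.

Lemma eq_box_coef c c' s psi : {in s, c =1 c'} ->
  box_coef c s psi = box_coef c' s psi.
Proof.
elim: s => //= i s IH cc'; rewrite cc' ?mem_head// IH// => j js.
by rewrite cc'// in_cons js orbT.
Qed.

(** Once all coordinates are treated, the point of evaluation is immaterial and
    box_coef is a linear functional. *)
Lemma box_coef_indep c s psi x y : (forall j, j \notin s -> x 0 j = y 0 j) ->
  box_coef c s psi x = box_coef c s psi y.
Proof.
elim: s x y => [|i s IH] x y xy /=.
  by congr psi; apply/rowP => j; exact: xy.
apply: eq_bigr => p _; congr (_ * _); apply: IH => j js; rewrite !mxE.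
by case: eqP => // /eqP ji; rewrite xy// in_cons (negbTE ji).
Qed.

Lemma line_derive psi i x (t : R) : smooth psi ->
  is_derive t (1 : R) (fun t => complex.Re (psi (subst i (k i + t) x)))
    (complex.Re (partial i psi (subst i (k i + t) x))) /\
  is_derive t (1 : R) (fun t => complex.Im (psi (subst i (k i + t) x)))
    (complex.Im (partial i psi (subst i (k i + t) x))).
Proof.
move=> spsi; have [_ _ d0] := spsi [::].
have [d1 d2] := d0 i (subst i (k i) x + t *: e i).
split.
  have -> : (fun t => complex.Re (psi (subst i (k i + t) x))) =
      (fun t => complex.Re (psi (subst i (k i) x + t *: e i))).
    by apply/funext => r; rewrite substE.
  rewrite substE.
  exact: (@is_derive_line R d (fun y => complex.Re (psi y)) _ (e i) t d1).
have -> : (fun t => complex.Im (psi (subst i (k i + t) x))) =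
    (fun t => complex.Im (psi (subst i (k i) x + t *: e i))).
  by apply/funext => r; rewrite substE.
rewrite substE.
exact: (@is_derive_line R d (fun y => complex.Im (psi y)) _ (e i) t d2).
Qed.

(** Each coordinate costs two derivatives in its own variable, and these commute
    with the coefficients taken in the other variables. *)
Lemma box_coef_le c s psi B : uniq s -> smooth psi ->
  (forall r x, (size r <= 2 * size s)%N -> in_box x -> rn (partials r psi x) <= B) ->
  forall x, in_box x -> rn (box_coef c s psi x) <= (\prod_(i <- s) decay R (c i)) * B.
Proof.
elim: s psi => [|i s IH] psi /=.
  by move=> _ _ psiB x xb; rewrite big_nil mul1r; exact: (psiB [::]).
move=> /andP[si us] spsi psiB x xb; rewrite big_cons -mulrA.
have sL := box_coef_smooth c s spsi.
have sL1 : smooth (partial i (box_coef c s psi)) by exact: (smooth_partials [:: i]).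
have d2 : partial i (partial i (box_coef c s psi)) =
    box_coef c s (partials [:: i; i] psi).
  apply: (box_coef_partials c (r := [:: i; i]) spsi) => j js.
  by rewrite !inE orbb; apply: contra si => /eqP <-.
pose L := box_coef c s psi; pose g t := subst i (k i + t) x.
apply: (@coef_le R (fun t => L (g t))
  (fun t => complex.Re (partial i L (g t)))
  (fun t => complex.Re (partial i (partial i L) (g t)))
  (fun t => complex.Im (partial i L (g t)))
  (fun t => complex.Im (partial i (partial i L) (g t))) _ (c i)
  (fun t => (line_derive i x t sL).1) (fun t => (line_derive i x t sL1).1)
  (fun t => (line_derive i x t sL).2) (fun t => (line_derive i x t sL1).2)).
move=> t tI; rewrite /L /g.
have yb := subst_in_box i xb tI.
have h2 : rn (partial i (partial i (box_coef c s psi)) (subst i (k i + t) x)) <=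
    \prod_(j <- s) decay R (c j) * B.
  rewrite d2; apply: (IH _ us (smooth_partials _ spsi)) => // r y rs yb'.
  rewrite -partials_cat; apply: psiB => //.
  by rewrite size_cat/= addn2 mulnS add2n !ltnS.
split.
- apply: IH => // r y rs; apply: psiB.
  by rewrite (leq_trans rs)// mulnS leq_addl.
- exact: le_trans (rn_Re _) h2.
- exact: le_trans (rn_Im _) h2.
Qed.

Lemma subst_scvg psi i x (t : R) : smooth psi -> 0 <= t ->
  scvg (fun j => psi (subst i (k i + (Num.truncn (t * 2 ^+ j))%:R / 2 ^+ j) x))
    (psi (subst i (k i + t) x)).
Proof.
move=> spsi t0.
have tc : (fun j => (Num.truncn (t * 2 ^+ j))%:R / 2 ^+ j) @ \oo --> t.
  apply/cvgrPdist_lt => eps eps0.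
  have [N HN] := small_harmonic eps0; exists N => // j /= Nj.
  have p0 : 0 < 2 ^+ j :> R by rewrite exprn_gt0.
  have tp : 0 <= t * 2 ^+ j by rewrite mulr_ge0// ltW.
  rewrite -[X in X - _](mulfK (lt0r_neq0 p0)) -mulrBl normrM.
  rewrite [X in _ * X]gtr0_norm ?invr_gt0// ltr_pdivrMr//.
  rewrite ger0_norm ?subr_ge0 ?truncn_le//.
  have h : t * 2 ^+ j < (Num.truncn (t * 2 ^+ j))%:R + 1.
    by rewrite natr1 truncnS_gt.
  apply: (@lt_trans _ _ 1); first by rewrite ltrBlDl.
  apply: (@lt_le_trans _ _ (eps * j.+1%:R)).
    by rewrite -ltr_pdivrMr// mul1r HN.
  by rewrite ler_wpM2l ?(ltW eps0)// -natrX ler_nat ltn_expl.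
have cont (u : 'rV[R]_d -> R) : continuous u ->
    (fun j => u (subst i (k i + (Num.truncn (t * 2 ^+ j))%:R / 2 ^+ j) x)) @ \oo
      --> u (subst i (k i + t) x).
  move=> cu; apply: continuous_cvg; first exact: cu.
  rewrite substE (_ : (fun j => _) = fun j => subst i (k i) x +
      ((Num.truncn (t * 2 ^+ j))%:R / 2 ^+ j) *: e i); last first.
    by apply/funext => j; rewrite substE.
  by apply: cvgD; [exact: cvg_cst|exact: cvgZr_tmp].
have [cr ci _] := spsi [::].
move=> eps eps0; have e2 : 0 < eps / 2 by rewrite divr_gt0.
have /cvgrPdist_lt/(_ _ e2)[N _ HN] := cont _ cr.
have /cvgrPdist_lt/(_ _ e2)[N' _ HN'] := cont _ ci.
exists (maxn N N') => j; rewrite geq_max => /andP[/HN/= h /HN'/= h'].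
apply: le_lt_trans (rn_le_ReIm _) _; move: h h'.
case: (psi (subst _ _ _)) => a b; case: (psi (subst _ _ _)) => a' b' /=.
rewrite distrC => h; rewrite distrC => h'.
by rewrite (splitr eps) ltrD.
Qed.

(** One application of [coef_sup] for each coordinate. *)
Lemma box_coef_sup s psi B : uniq s -> smooth psi -> 0 <= B ->
  (forall c x, in_box x -> rn (box_coef c s psi x) <= B) ->
  forall x, in_box x -> rn (psi x) <= 5 ^+ size s * B.
Proof.
elim: s B => [|i s IH] B /=.
  by move=> _ _ _ /(_ (fun=> (0, 0)%N)) h x xb; rewrite mul1r h.
move=> /andP[si us] spsi B0 psiB x xb; rewrite exprSr -mulrA.
apply: IH => // [|c y yb]; first by rewrite mulr_ge0.
have sL := box_coef_smooth c s spsi.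
have -> : box_coef c s psi y =
    box_coef c s psi (subst i (k i + (y 0 i - k i)) y).
  by rewrite [k i + _]addrC subrK subst_id.
apply: (@coef_sup R (fun t => box_coef c s psi (subst i (k i + t) y)) B) => //.
- by move=> t; exact: subst_scvg.
- move=> b; pose c' j := if j == i then b else c j.
  have := psiB c' y yb; rewrite /= /coord_coef {1}/c' eqxx.
  rewrite (@eq_box_coef c' c)// => j js; rewrite /c'.
  by case: eqP => // ji; move: si; rewrite -ji js.
- by have := yb i; rewrite subr_ge0 lerBlDl.
Qed.

End substitution.

(** * Weights on cubes *)

Section weights.
Context (R : realType).
Local Notation C := R[i].

Lemma cond_M2_add (c0 H : R) (M : nat -> {posnum R}) p q : 0 <= c0 -> 0 <= H ->
  cond_M2 c0 H M ->
  (M (p + q)%N)%:num <= c0 * H ^+ (p + q) * ((M p)%:num * (M q)%:num).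
Proof.
move=> c00 H0 M2; apply: le_trans (M2 (p + q)%N) _.
apply: ler_wpM2l; first by rewrite mulr_ge0// exprn_ge0.
have qp : (q < (p + q).+1)%N by rewrite ltnS leq_addl.
apply: le_trans (bigmin_le _ (Ordinal qp) _) _.
by rewrite /= addnK.
Qed.

Section norm_characterization.
Context (d : nat) (M A : nat -> {posnum R}).
Hypothesis A0 : (A 0%N)%:num = 1.
Implicit Types (phi : 'rV[R]_d -> C).

(** The exponential of the associated function at rho is the supremum over p of
    rho^p / A_p, the positive part of the logarithm being covered by p = 0; so
    the norm is a supremum of elementary quantities. *)
Lemma gs_norm_leP (h : {posnum R}) phi (B : R) : 0 <= B ->
  (gs_norm M A h phi <= B%:E)%E <->
  forall al x p, h%:num ^+ multi_abs al / (M (multi_abs al))%:num *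
    ((h%:num * eucl x) ^+ p / (A p)%:num) * rn (mD al phi x) <= B.
Proof.
move=> B0; split=> [phiB al x p|phiB].
  set c := _ / _; set v := rn _; pose rho := h%:num * eucl x.
  have c0 : 0 < c by rewrite divr_gt0// exprn_gt0.
  have v0 : 0 <= v by exact: rn_ge0.
  have : (c%:E * weighted_norm A h (mD al phi) <= B%:E)%E.
    by apply: le_trans phiB; apply: ereal_sup_ubound; exists al.
  rewrite -lee_fin; apply: le_trans; rewrite -mulrA EFinM lee_pmul2l//.
  apply: (@le_trans _ _ (expeR (assoc_fun A rho) * v%:E)%E); last first.
    by apply: ereal_sup_ubound; exists x => //; rewrite /v rn_normc.
  rewrite EFinM lee_wpmul2r// -/rho.
  have [->|rp0] := eqVneq (rho ^+ p) 0; first by rewrite mul0r expeR_ge0.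
  have q0 : 0 < rho ^+ p / (A p)%:num.
    by rewrite divr_gt0// lt_def rp0 exprn_ge0// mulr_ge0// sqrtr_ge0.
  rewrite -[X in (X%:E <= _)%E](lnK q0) -[(expR _)%:E]/(expeR (ln _)%:E) lee_expeR.
  apply: ereal_sup_ge; eexists; first by exists p.
  by rewrite lee_fin le_max lexx orbT.
apply: ge_ereal_sup => _ [al _ <-].
have c0 : 0 < h%:num ^+ multi_abs al / (M (multi_abs al))%:num.
  by rewrite divr_gt0// exprn_gt0.
move: (phiB al) => {phiB}; set c := _ / _ in c0 * => phiB.
suff : (weighted_norm A h (mD al phi) <= (B / c)%:E)%E.
  by move=> W; rewrite muleC -lee_pdivlMr// -EFinM.
apply: ge_ereal_sup => _ [x _ <-]; rewrite -rn_normc.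
have {}phiB := phiB x; move: phiB; set v := rn _ => phiB.
have [->|v0] := eqVneq v 0; first by rewrite mule0 lee_fin divr_ge0// ltW.
have {}v0 : 0 < v by rewrite lt_def v0 rn_ge0.
pose Q := B / c / v.
have Qp p : (h%:num * eucl x) ^+ p / (A p)%:num <= Q.
  by rewrite /Q !ler_pdivlMr// mulrC mulrA; exact: phiB.
have Q1 : 1 <= Q by have := Qp 0%N; rewrite expr0 A0 divr1.
have Q0 : 0 < Q by exact: lt_le_trans Q1.
have -> : (B / c)%:E = (Q%:E * v%:E)%E.
  by rewrite -EFinM /Q divfK// gt_eqF.
apply: lee_wpmul2r; first by rewrite lee_fin ltW.
rewrite -[X in (_ <= X%:E)%E](lnK Q0) -[(expR _)%:E]/(expeR (ln _)%:E) lee_expeR.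
apply: ge_ereal_sup => _ [p _ <-]; rewrite lee_fin ge_max ln_ge0//=.
have [->|rp0] := eqVneq ((h%:num * eucl x) ^+ p) 0.
  by rewrite mul0r ln0// ln_ge0.
rewrite ler_ln// posrE divr_gt0// lt_def rp0 exprn_ge0// mulr_ge0//.
exact: sqrtr_ge0.
Qed.

End norm_characterization.

Lemma sum_sqr_le (I : Type) (s : seq I) (a : I -> R) : (forall i, 0 <= a i) ->
  \sum_(i <- s) a i ^+ 2 <= (\sum_(i <- s) a i) ^+ 2.
Proof.
move=> a0; elim: s => [|i s IH]; first by rewrite !big_nil expr0n.
rewrite !big_cons sqrrD -addrA lerD2l (le_trans IH)// lerDr mulrn_wge0//.
by rewrite mulr_ge0// sumr_ge0.
Qed.

Lemma eucl_le (d : nat) (x : 'rV[R]_d) : eucl x <= \sum_i `|x 0 i|.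
Proof.
apply: sqrtr_le; first by rewrite sumr_ge0.
apply: le_trans (sum_sqr_le _ (fun i : 'I_d => normr_ge0 (x 0 i))).
by apply: ler_sum => i _; rewrite real_normK// num_real.
Qed.

Lemma le_eucl (d : nat) (x : 'rV[R]_d) i : `|x 0 i| <= eucl x.
Proof.
rewrite -sqrtr_sqr ler_wsqrtr// (bigD1 i)//= lerDl.
by rewrite sumr_ge0// => j _; exact: sqr_ge0.
Qed.

Section cube_weights.
Context (d : nat) (hd : (0 < d)%N) (A : nat -> {posnum R}).
Hypothesis A0 : (A 0%N)%:num = 1.
Context (c0 H : R) (hc0 : 1 <= c0) (hH : 1 <= H).
Hypotheses (A2 : cond_M2 c0 H A) (A6 : cond_M6 A).

(** An upper bound for the Euclidean norm on the cube of corner k.  Away from the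
    origin the norm is conversely at least cube_radius k / (2 d). *)
Definition cube_radius (k : 'I_d -> int) : R := \sum_i (`|(k i)%:~R| + 1).

Lemma cube_radius_ge (k : 'I_d -> int) x :
  in_box (fun i => (k i)%:~R) x -> eucl x <= cube_radius k.
Proof.
move=> xk; apply: le_trans (eucl_le x) _; apply: ler_sum => i _.
have /andP[h1 h2] := xk i.
rewrite ler_norml; apply/andP; split.
  by have := ler_norm (- (k i)%:~R : R); rewrite normrN; lra.
by have := ler_norm ((k i)%:~R : R); lra.
Qed.

Lemma cube_radius_le (k : 'I_d -> int) x :
  in_box (fun i => (k i)%:~R) x -> cube_radius k - 2 * d%:R <= d%:R * eucl x.
Proof.
move=> xk.
have -> : cube_radius k - 2 * d%:R = \sum_(i < d) (`|(k i)%:~R| - 1) :> R.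
  have -> : 2 * d%:R = \sum_(i < d) 2 :> R by rewrite sumr_const card_ord mulr_natr.
  by rewrite -sumrB; apply: eq_bigr => i _; lra.
have -> : d%:R * eucl x = \sum_(i < d) eucl x.
  by rewrite sumr_const card_ord mulr_natl.
apply: ler_sum => i _; apply: le_trans (le_eucl x i).
have /andP[h1 h2] := xk i.
have := ler_normD (x 0 i) ((k i)%:~R - x 0 i); rewrite addrC subrK => h.
have : `|(k i)%:~R - x 0 i| <= 1 by rewrite ler_norml; apply/andP; split; lra.
by lra.
Qed.

Lemma cube_radius_ge1 (k : 'I_d -> int) i : `|(k i)%:~R| + 1 <= cube_radius k.
Proof.
rewrite /cube_radius (bigD1 i)//= lerDl sumr_ge0// => j _.
Qed.

Lemma cube_radius_gt0 (k : 'I_d -> int) : 0 < cube_radius k.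
Proof.
apply: lt_le_trans (cube_radius_ge1 k (Ordinal hd)).
by rewrite ltr_wpDl.
Qed.

(** The lower bound on A_p turns the powers into terms of an exponential series. *)
Lemma pow_bound (r : R) : exists2 c, 0 <= c &
  forall s p, 0 <= s <= r -> s ^+ p / (A p)%:num <= c.
Proof.
have [c [L [c1 L1 hA]]] := A6.
have c00 : 0 < c by exact: lt_le_trans c1.
have L0 : 0 < L by exact: lt_le_trans L1.
exists (c * expR (L * r)); first by rewrite mulr_ge0 ?expR_ge0// ltW.
move=> s p /andP[s0 sr]; rewrite ler_pdivrMr//.
have e1 : (L * s) ^+ p / p`!%:R <= expR (L * r).
  apply: (@le_trans _ _ (expR (L * s))); last by rewrite ler_expR ler_pM2l.
  have Ls : 0 <= L * s by rewrite mulr_ge0// ltW.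
  case: p => [|p]; last first.
    by apply: le_trans (expR_ge1Dxn p Ls); rewrite lerDr.
  by rewrite expr0 fact0 divr1 -expR0 ler_expR.
have f0 : 0 < p`!%:R :> R by rewrite ltr0n fact_gt0.
move: e1; rewrite ler_pdivrMr// exprMn => e1.
have Lp : 0 < L ^+ p by rewrite exprn_gt0.
rewrite -(ler_pM2l Lp); apply: (le_trans e1).
apply: (@le_trans _ _ (expR (L * r) * (c * L ^+ p * (A p)%:num))).
  by rewrite ler_wpM2l// expR_ge0.
by rewrite le_eqVlt; apply/orP; left; apply/eqP; ring.
Qed.

(** W k is the supremum over p of (h' rho)^p / A_p with rho the radius of the
    cube.  The product is at most rho^n with n = 2d, and
    (h' rho)^p rho^n / A_p is, up to a constant, at most
    (H h' rho)^(p+n) / A_(p+n) by [cond_M2].  If rho >= 4 d then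
    rho <= 2 d |x| on the cube, so that H h' rho <= h |x|; the finitely many
    cubes with rho < 4 d only contribute to the constant. *)
Lemma cube_weight (h' h : R) : 0 < h' -> h = 2 * d%:R * H * h' ->
  exists (W : ('I_d -> int) -> R) (c : R), [/\ 0 <= c,
    forall k, 1 <= W k,
    forall k p x, in_box (fun i => (k i)%:~R) x ->
      (h' * eucl x) ^+ p / (A p)%:num <= W k &
    forall k x U, in_box (fun i => (k i)%:~R) x ->
      (forall p, (h * eucl x) ^+ p / (A p)%:num <= U) ->
      W k * (\prod_(i < d) (`|(k i)%:~R| + 1) ^+ 2) <= c * U].
Proof.
move=> h'0 hh.
have c00 : 0 < c0 by exact: lt_le_trans hc0.
have H0 : 0 < H by exact: lt_le_trans hH.
have d0 : 0 < d%:R :> R by rewrite ltr0n.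
pose S k : set R := [set (h' * cube_radius k) ^+ p / (A p)%:num | p in [set: nat]].
have hr k : 0 <= h' * cube_radius k by rewrite mulr_ge0 ?ltW// cube_radius_gt0.
have supS k : has_sup (S k).
  split; first by eexists; exists 0%N.
  have [c _ hc] := pow_bound (h' * cube_radius k).
  by exists c => _ [p _ <-]; apply: hc; rewrite lexx hr.
have SW k p : (h' * cube_radius k) ^+ p / (A p)%:num <= sup (S k).
  by apply: ub_le_sup; [case: (supS k)|exists p].
have [E E0 hE] := pow_bound (h' * (4 * d%:R)).
pose n := (2 * d)%N.
pose c := c0 * (A n)%:num / h' ^+ n + E * (4 * d%:R) ^+ n.
have c1 : 0 <= c0 * (A n)%:num / h' ^+ n.
  by rewrite divr_ge0 ?mulr_ge0 ?(ltW c00)// exprn_ge0// ltW.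
have c2 : 0 <= E * (4 * d%:R) ^+ n.
  by rewrite mulr_ge0// exprn_ge0// mulr_ge0// ltW.
exists (fun k => sup (S k)), c; split.
- exact: addr_ge0.
- by move=> k; have := SW k 0%N; rewrite expr0 A0 divr1.
- move=> k p x xk; apply: le_trans (SW k p).
  rewrite ler_pM2r ?invr_gt0// lerXn2r ?nnegrE//.
    by rewrite mulr_ge0 ?(ltW h'0)// sqrtr_ge0.
  by rewrite ler_pM2l// cube_radius_ge.
move=> k x U xk hU.
have U1 : 1 <= U by have := hU 0%N; rewrite expr0 A0 divr1.
have U0 : 0 <= U by exact: le_trans U1.
pose rho := cube_radius k.
have rho0 : 0 < rho by exact: cube_radius_gt0.
have P1 : \prod_(i < d) (`|(k i)%:~R| + 1) ^+ 2 <= rho ^+ n.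
  apply: (@le_trans _ _ (\prod_(i < d) rho ^+ 2)).
    apply: ler_prod => i _; rewrite exprn_ge0 ?addr_ge0//=.
    by apply: sq_le; [rewrite addr_ge0|exact: cube_radius_ge1].
  by rewrite prodr_const card_ord -exprM.
have P0 : 0 < \prod_(i < d) (`|(k i)%:~R| + 1) ^+ 2 :> R.
  by rewrite prodr_gt0// => i _; rewrite exprn_gt0// ltr_wpDl.
suff key p : (h' * rho) ^+ p / (A p)%:num * rho ^+ n <= c * U.
  rewrite -ler_pdivlMr//; apply: ge_sup; first by case: (supS k).
  move=> _ [p _ <-]; rewrite ler_pdivlMr//; apply: le_trans (key p).
  by rewrite ler_wpM2l// divr_ge0// exprn_ge0.
rewrite /c mulrDl; have [rl|rs] := leP (4 * d%:R) rho; last first.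
  apply: (@le_trans _ _ (E * (4 * d%:R) ^+ n * U)); last first.
    by rewrite lerDr mulr_ge0.
  apply: (@le_trans _ _ (E * (4 * d%:R) ^+ n)); last by rewrite ler_peMr.
  apply: ler_pM.
  - by rewrite divr_ge0// exprn_ge0// hr.
  - by rewrite exprn_ge0// ltW.
  - by apply: hE; rewrite hr/= ler_pM2l// ltW.
  - by rewrite lerXn2r ?nnegrE ?mulr_ge0 ?(ltW rho0)// ltW.
apply: (@le_trans _ _ (c0 * (A n)%:num / h' ^+ n * U)); last first.
  by rewrite lerDl mulr_ge0.
have rx : H * (h' * rho) <= h * eucl x.
  have := cube_radius_le xk; rewrite -/rho => h1.
  have h2 : rho <= 2 * (d%:R * eucl x) by lra.
  rewrite hh; apply: (@le_trans _ _ (H * h' * (2 * (d%:R * eucl x)))).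
    by rewrite mulrA ler_wpM2l// mulr_ge0 ?ltW.
  by rewrite le_eqVlt; apply/orP; left; apply/eqP; ring.
have Ap := cond_M2_add p n (ltW c00) (ltW H0) A2.
have Hq : 0 < H ^+ (p + n) by rewrite exprn_gt0.
have hn : 0 < h' ^+ n by rewrite exprn_gt0.
have step : (H * (h' * rho)) ^+ (p + n) <= U * (A (p + n)%N)%:num.
  rewrite -ler_pdivrMr//; apply: le_trans (hU (p + n)%N).
  have a0 : 0 <= H * (h' * rho) by rewrite mulr_ge0 ?(ltW H0)// hr.
  have b0 : 0 <= h * eucl x by exact: le_trans rx.
  by rewrite ler_pM2r ?invr_gt0// lerXn2r ?nnegrE.
have step2 : (h' * rho) ^+ (p + n) <= U * (c0 * ((A p)%:num * (A n)%:num)).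
  rewrite -(ler_pM2l Hq) -exprMn; apply: (le_trans step).
  apply: (@le_trans _ _ (U * (c0 * H ^+ (p + n) * ((A p)%:num * (A n)%:num)))).
    by rewrite ler_wpM2l.
  by rewrite le_eqVlt; apply/orP; left; apply/eqP; ring.
rewrite mulrAC ler_pdivrMr// -(ler_pM2r hn).
have -> : c0 * (A n)%:num / h' ^+ n * U * (A p)%:num * h' ^+ n =
    c0 * (A n)%:num * U * (A p)%:num by field; rewrite gt_eqF.
have E2 : (h' * rho) ^+ (p + n) = (h' * rho) ^+ p * rho ^+ n * h' ^+ n.
  by rewrite exprD exprMn [(h' * rho) ^+ n]exprMn; ring.
rewrite -E2; apply: (le_trans step2).
by rewrite le_eqVlt; apply/orP; left; apply/eqP; ring.
Qed.

End cube_weights.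
End weights.

(** * Comparison of Gelfand-Shilov norms at two scales *)

Section product_sums.
Context (R : realType).

Lemma fsumZ (I : eqType) (k : R) (a : I -> R) : 0 <= k -> fsum a ->
  fsum (fun i => k * a i).
Proof.
move=> k0 [c hc]; exists (k * c) => s us.
by rewrite -mulr_sumr ler_wpM2l// hc.
Qed.

Lemma fsum_prod (I J : eqType) (a : I -> R) (b : J -> R) :
  (forall i, 0 <= a i) -> (forall j, 0 <= b j) -> fsum a -> fsum b ->
  fsum (fun x : I * J => a x.1 * b x.2).
Proof.
move=> a0 b0 fa [c hc]; have c0 : 0 <= c by have := hc [::] erefl; rewrite big_nil.
apply: (@fsum_pair _ _ _ _ (fun i => c * a i)).
- by move=> x; rewrite mulr_ge0.
- exact: fsumZ.
- by move=> i s us /=; rewrite -mulr_sumr mulrC ler_wpM2r// hc.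
Qed.

Lemma fsum_absz (u : nat -> R) : (forall i, 0 <= u i) -> fsum u ->
  fsum (fun k : int => u `|k|%N).
Proof.
move=> u0 [c hc]; exists (c + c) => s us.
rewrite (bigID (fun k : int => 0 <= k))/=; apply: lerD.
  rewrite -big_filter -(big_map absz xpredT u); apply: hc.
  rewrite map_inj_in_uniq ?filter_uniq// => x y.
  by rewrite !mem_filter => /andP[x0 _] /andP[y0 _]; lia.
rewrite -big_filter -(big_map absz xpredT u); apply: hc.
rewrite map_inj_in_uniq ?filter_uniq// => x y.
by rewrite !mem_filter => /andP[x0 _] /andP[y0 _]; lia.
Qed.

(** Comparison with the telescoping sum of 1 / (n (n + 1)). *)
Lemma inverse_squares_bsum : bsum (fun n => ((n%:R + 1) ^+ 2)^-1 : R).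
Proof.
exists 2; case=> [|m]; first by rewrite big_ord0.
apply: (@le_trans _ _ (2 - m.+1%:R^-1)); last by rewrite gerBl invr_ge0.
elim: m => [|m IH].
  by rewrite big_ord_recr big_ord0/= !add0r expr1n invr1; lra.
rewrite big_ord_recr/=; apply: le_trans (lerD IH (lexx _)) _.
set x := m.+1%:R : R; have -> : m.+2%:R = x + 1 :> R by rewrite natr1.
have x0 : 0 < x by rewrite ltr0n.
have E : x^-1 - (x + 1)^-1 = (x * (x + 1))^-1.
  by field; rewrite ?gt_eqF// ltr_wpDl// ltW.
have : ((x + 1) ^+ 2)^-1 <= (x * (x + 1))^-1.
  rewrite lef_pV2 ?posrE ?mulr_gt0 ?exprn_gt0 ?ltr_wpDl ?(ltW x0)//.
  by rewrite expr2 ler_wpM2r ?lerDl// addr_ge0// ltW.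
by rewrite -E; move: ((x + 1) ^- 2) (x^-1) ((x + 1)^-1) => u v w; lra.
Qed.

(** The sum over all families with values in a finite set t is the d-th power of
    the sum over t. *)
Lemma fsum_ffun (d : nat) (T : countType) (b : T -> R) :
  (forall t, 0 <= b t) -> fsum b ->
  fsum (fun f : {ffun 'I_d -> T} => \prod_i b (f i)).
Proof.
move=> b0 [c hc]; exists (c ^+ d) => s us.
pose t := undup (flatten [seq codom f | f : {ffun 'I_d -> T} <- s]).
pose J : finType := seq_sub t.
pose G := [seq [ffun i => val (g i)] | g : {ffun 'I_d -> J}] : seq {ffun 'I_d -> T}.
apply: (@le_trans _ _ (\sum_(f <- G) \prod_i b (f i))).
  apply: sum_subset => // [f|f fs]; first exact: prodr_ge0.
  have ft i : f i \in t.
    rewrite mem_undup; apply/flatten_mapP; exists f => //; exact: codom_f.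
  apply/mapP; exists [ffun i => SeqSub (ft i)]; first by rewrite mem_enum.
  by apply/ffunP => i; rewrite !ffunE.
rewrite /G big_map big_enum/=.
apply: (@le_trans _ _ (\sum_(g : {ffun 'I_d -> J}) \prod_i b (val (g i)))).
  by apply: ler_sum => g _; under eq_bigr do rewrite ffunE.
rewrite -(bigA_distr_bigA (fun _ (j : J) => b (val j))) prodr_const card_ord.
have [->|d0] := eqVneq d 0%N; first by rewrite !expr0.
rewrite lerXn2r ?nnegrE ?sumr_ge0//.
  by have := hc [::] erefl; rewrite big_nil.
rewrite -[index_enum J]/(index_enum J) -big_enum/=.
rewrite -(big_map val xpredT b); apply: hc.
by rewrite map_inj_uniq ?enum_uniq//; exact: val_inj.
Qed.

End product_sums.

Section step_lemma.
Context (R : realType).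
Local Notation C := R[i].
Context (d : nat) (hd : (0 < d)%N) (M A : nat -> {posnum R}).
Hypothesis A0 : (A 0%N)%:num = 1.
Context (c0 H : R) (hc0 : 1 <= c0) (hH : 1 <= H).
Hypotheses (M2 : cond_M2 c0 H M) (A2 : cond_M2 c0 H A) (A6 : cond_M6 A).
Context (h' h : {posnum R}) (hh : h%:num = 2 * d%:R * H * h'%:num).

(** A functional is indexed by one element of T per coordinate: the order of
    differentiation, the corner of the cube and the midpoint coefficient. *)
Local Notation T := (nat * int * (nat * nat))%type.
Local Notation I := {ffun 'I_d -> T}.

Let al (x : I) (i : 'I_d) : nat := (x i).1.1.
Let kk (x : I) (i : 'I_d) : int := (x i).1.2.
Let cc (x : I) (i : 'I_d) : nat * nat := (x i).2.
Let kr (k : 'I_d -> int) (i : 'I_d) : R := (k i)%:~R.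

Let b (t : T) : R :=
  2^-1 ^+ t.1.1 * ((`|t.1.2|%N%:R + 1) ^+ 2)^-1 * decay R t.2.

Let b0 t : 0 <= b t.
Proof.
rewrite /b mulr_ge0 ?decay_ge0// mulr_ge0 ?exprn_ge0//.
Qed.

Let b_fsum : fsum b.
Proof.
pose b1 (n : nat) : R := 2^-1 ^+ n.
pose b2 (k : int) : R := ((`|k|%N%:R + 1) ^+ 2)^-1.
have b1_ge0 n : 0 <= b1 n by rewrite exprn_ge0.
have b2_ge0 k : 0 <= b2 k by rewrite invr_ge0 exprn_ge0// addr_ge0.
apply: (@fsum_prod _ _ _ (fun x => b1 x.1 * b2 x.2) (@decay R)).
- by move=> x; rewrite mulr_ge0.
- exact: decay_ge0.
- apply: fsum_prod => //.
    apply: fsum_nat => //; apply: geometric_bsum => //.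
    by rewrite invf_lt1// ltr1n.
  apply: (fsum_absz (u := fun n => ((n%:R + 1) ^+ 2)^-1)).
    by move=> n; rewrite invr_ge0 exprn_ge0// addr_ge0.
  apply: fsum_nat; last exact: inverse_squares_bsum.
  by move=> n; rewrite invr_ge0 exprn_ge0// addr_ge0.
- exact: decay_fsum.
Qed.

Let factor (n : nat) : R := h'%:num ^+ n / (M n)%:num.
Let factor_gt0 n : 0 < factor n.
Proof. by rewrite divr_gt0// exprn_gt0. Qed.

Let order_const : R := \sum_(s < (2 * d).+1) c0 * H ^+ s * (M s)%:num / h%:num ^+ s.

(** By [cond_M2], M_(s+a) is at most c0 H^(s+a) M_s M_a, and h^a contains the
    factor (2 H h')^a. *)
Let order_ratio a s : (s <= 2 * d)%N ->
  factor a * ((M (s + a)%N)%:num / h%:num ^+ (s + a)) <= order_const * 2^-1 ^+ a.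
Proof.
move=> sd.
have c00 : 0 <= c0 by exact: le_trans hc0.
have H0 : 0 < H by exact: lt_le_trans hH.
have d0 : 0 < d%:R :> R by rewrite ltr0n.
have hs : 0 < h%:num ^+ s by rewrite exprn_gt0.
have ha : 0 < h'%:num ^+ a by rewrite exprn_gt0.
have Ha : 0 < H ^+ a by rewrite exprn_gt0.
have da : 0 < d%:R ^+ a :> R by rewrite exprn_gt0.
apply: (@le_trans _ _ (c0 * H ^+ s * (M s)%:num / h%:num ^+ s * 2^-1 ^+ a)); last first.
  rewrite ler_wpM2r ?exprn_ge0// /order_const.
  rewrite (bigD1 (Ordinal (sd : (s < (2 * d).+1)%N)))//= lerDl sumr_ge0// => i _.
  by rewrite divr_ge0 ?exprn_ge0// !mulr_ge0 ?exprn_ge0// ltW.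
apply: (@le_trans _ _ (factor a * (c0 * H ^+ (s + a) * ((M s)%:num * (M a)%:num) /
    h%:num ^+ (s + a)))).
  rewrite ler_wpM2l ?(ltW (factor_gt0 a))// ler_pM2r ?invr_gt0 ?exprn_gt0//.
  exact: cond_M2_add (ltW H0) M2.
have -> : factor a * (c0 * H ^+ (s + a) * ((M s)%:num * (M a)%:num) /
    h%:num ^+ (s + a)) =
    c0 * H ^+ s * (M s)%:num / h%:num ^+ s * (2^-1 ^+ a / d%:R ^+ a).
  rewrite /factor !exprD {2}hh !exprMn exprVn.
  have m0 : (M a)%:num != 0 by rewrite gt_eqF.
  have p2 : 2 ^+ a != 0 :> R by rewrite expf_neq0.
  by field; rewrite m0 p2 ?gt_eqF.
rewrite ler_wpM2l//; last first.
  by rewrite ler_pdivrMr// ler_peMr ?exprn_ge0// exprn_ege1// ler1n.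
by rewrite divr_ge0 ?(ltW hs)// !mulr_ge0 ?exprn_ge0// ltW.
Qed.

Let order_const_ge0 : 0 <= order_const.
Proof.
rewrite sumr_ge0// => i _; rewrite divr_ge0 ?exprn_ge0// !mulr_ge0 ?exprn_ge0//.
- exact: le_trans hc0.
- exact: le_trans hH.
Qed.

(** W is the weight of [cube_weight]: W_ge bounds the weight of scale h' on a cube
    from above, W_le bounds the weight of scale h from below with a margin
    whose inverse is summable over k. *)
Section bounds.
Context (W : ('I_d -> int) -> R) (c1 : R).
Hypotheses (c10 : 0 <= c1) (W1 : forall k, 1 <= W k)
  (W_ge : forall k p x, in_box (kr k) x ->
      (h'%:num * eucl x) ^+ p / (A p)%:num <= W k)
  (W_le : forall k x U, in_box (kr k) x ->
      (forall p, (h%:num * eucl x) ^+ p / (A p)%:num <= U) ->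
      W k * (\prod_(i < d) (`|(k i)%:~R| + 1) ^+ 2) <= c1 * U).

Let W0 k : 0 < W k. Proof. exact: lt_le_trans (W1 k). Qed.

Let corner (k : 'I_d -> int) : 'rV[R]_d := \row_i kr k i.

Let corner_in k : in_box (kr k) (corner k).
Proof. by move=> i; rewrite mxE lexx/= lerDl. Qed.

(** The factor 5^d is the loss in [box_coef_sup]. *)
Let scale (x : I) : R := 5 ^+ d * (factor (multi_abs (al x)) * W (kk x)).

Let gfun (x : I) (phi : 'rV[R]_d -> C) : C :=
  (scale x)%:C * box_coef (kr (kk x)) (cc x) (enum 'I_d) (mpartial (al x) phi)
    (corner (kk x)).

Let gfun_le (x : I) phi S : smooth phi -> 0 <= S ->
  (gs_norm M A h phi <= S%:E)%E ->
  rn (gfun x phi) <= (5 ^+ d * c1 * order_const) * (\prod_i b (x i)) * S.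
Proof.
move=> sphi S0 phiS.
pose k := kk x; pose a := multi_abs (al x).
pose P : R := \prod_(i < d) (`|(k i)%:~R| + 1) ^+ 2.
have P0 : 0 < P by rewrite prodr_gt0// => i _; rewrite exprn_gt0// ltr_wpDl.
have fW : 0 < factor a * W k by rewrite mulr_gt0.
pose B0 := c1 * order_const * S * 2^-1 ^+ a / P / (factor a * W k).
have B00 : 0 <= B0.
  by rewrite !divr_ge0 ?(ltW fW) ?(ltW P0)// !mulr_ge0 ?exprn_ge0.
have bound r y : (size r <= 2 * size (enum 'I_d))%N -> in_box (kr k) y ->
    rn (partials r (mpartial (al x) phi) y) <= B0.
  rewrite size_enum_ord => rd yk.
  have [be [beE ->]] := partials_mpartial r (al x) sphi.
  rewrite -rn_mD; set v := rn _.
  have [->//|v0] := eqVneq v 0.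
  have {}v0 : 0 < v by rewrite lt_def v0 rn_ge0.
  pose q := (M (multi_abs be))%:num / h%:num ^+ multi_abs be.
  have q0 : 0 < q by rewrite divr_gt0// exprn_gt0.
  have key : W k * P <= c1 * (S * q / v).
    apply: (W_le yk) => p.
    have := (gs_norm_leP M A0 h phi S0).1 phiS be y p; rewrite -/v => h1.
    rewrite ler_pdivlMr// -ler_pdivrMr// mulrC.
    by rewrite /q invf_div mulrA.
  have qE : factor a * q <= order_const * 2^-1 ^+ a.
    by rewrite /q beE; exact: order_ratio.
  rewrite /B0 ler_pdivlMr// ler_pdivlMr//.
  apply: (@le_trans _ _ (c1 * S * (factor a * q))); last first.
    apply: (@le_trans _ _ (c1 * S * (order_const * 2^-1 ^+ a))).
      by rewrite ler_wpM2l// mulr_ge0.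
    by rewrite le_eqVlt; apply/orP; left; apply/eqP; ring.
  have -> : v * (factor a * W k) * P = factor a * v * (W k * P) by ring.
  apply: (@le_trans _ _ (factor a * v * (c1 * (S * q / v)))).
    by rewrite ler_wpM2l// mulr_ge0 ?(ltW (factor_gt0 a))// ltW.
  by rewrite le_eqVlt; apply/orP; left; apply/eqP; field; rewrite gt_eqF.
have sal : smooth (mpartial (al x) phi).
  by rewrite mpartial_seq; exact: smooth_partials.
have := box_coef_le (cc x) (enum_uniq 'I_d) sal bound (corner_in k).
rewrite big_enum/= => h1.
have s0 : 0 <= scale x by rewrite mulr_ge0 ?exprn_ge0// ltW.
rewrite /gfun rnM rn_real ger0_norm//.
apply: (@le_trans _ _ (scale x * (\prod_(i < d) decay R (cc x i) * B0))).
  by rewrite ler_wpM2l.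
have -> : \prod_i b (x i) = 2^-1 ^+ a * P^-1 * \prod_(i < d) decay R (cc x i).
  rewrite /b !big_split/=; congr (_ * _ * _).
    by rewrite /a /multi_abs -prodrXr.
  rewrite /P -prodfV; apply: eq_bigr => i _; congr ((_ + 1) ^+ 2)^-1.
  by rewrite natr_absz intr_norm.
rewrite le_eqVlt; apply/orP; left; apply/eqP.
rewrite /scale /B0 -/a -/k.
by field; rewrite ?mulf_neq0 ?gt_eqF.
Qed.

Let gfun_sup phi B : smooth phi -> 0 <= B ->
  (forall x, rn (gfun x phi) <= B) -> (gs_norm M A h' phi <= B%:E)%E.
Proof.
move=> sphi B0 gB; apply/(gs_norm_leP M A0 h' phi B0) => a x p.
pose k i := Num.floor (x 0 i).
have xk : in_box (kr k) x.
  move=> i; rewrite /kr /k; apply/andP; split; first exact: floor_le.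
  by have := floorD1_gt (x 0 i); rewrite intrD => /ltW.
pose n := multi_abs a.
have fW : 0 < factor n * W k by rewrite mulr_gt0.
apply: (@le_trans _ _ (factor n * W k * rn (mD a phi x))).
  rewrite ler_wpM2r ?rn_ge0// ler_wpM2l ?(ltW (factor_gt0 n))//.
  exact: W_ge.
have p5 : 0 < 5 ^+ d :> R by rewrite exprn_gt0.
have sa : smooth (mpartial a phi).
  by rewrite mpartial_seq; exact: smooth_partials.
rewrite rn_mD mulrC -ler_pdivlMr//.
have := @box_coef_sup R d (kr k) (enum 'I_d) (mpartial a phi)
  (B / (5 ^+ d * (factor n * W k))) (enum_uniq _) sa.
rewrite size_enum_ord => /(_ _ _ _ xk) h1.
have E : 5 ^+ d * (B / (5 ^+ d * (factor n * W k))) = B / (factor n * W k).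
  by field; rewrite !gt_eqF.
rewrite -E; apply: h1.
  by rewrite divr_ge0// mulr_ge0 ?ltW.
move=> c y yk.
pose xi : I := [ffun i => (a i, k i, c i)].
have aE : al xi = a by apply/funext => i; rewrite /al ffunE.
have kE : kk xi = k by apply/funext => i; rewrite /kk ffunE.
have cE : cc xi = c by apply/funext => i; rewrite /cc ffunE.
have := gB xi; rewrite /gfun aE kE cE rnM rn_real ger0_norm; last first.
  by rewrite mulr_ge0 ?exprn_ge0// ltW// mulr_gt0.
rewrite (@box_coef_indep R d (kr k) c (enum 'I_d) _ y (corner k)); last first.
  by move=> j; rewrite mem_enum.
by rewrite /scale aE kE -/n ler_pdivlMr ?mulr_gt0// mulrC.
Qed.

Context (V : lmodType C) (iota : V -> 'rV[R]_d -> C) (n n' : V -> R).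
Hypotheses (iotaP : forall a u v,
    iota (a *: u + v) = (fun x => a * iota u x + iota v x))
  (iota_smooth : forall v, smooth (iota v))
  (n0 : forall v, 0 <= n v)
  (n_ge : forall v, (gs_norm M A h (iota v) <= (n v)%:E)%E)
  (n'_le : forall v B, 0 <= B -> (gs_norm M A h' (iota v) <= B%:E)%E -> n' v <= B).

Let box_coef_linear (k : 'I_d -> R) c s a f g :
  box_coef k c s (fun x => a * f x + g x) =
  (fun x => a * box_coef k c s f x + box_coef k c s g x).
Proof.
elim: s => [//|i s IH].
rewrite -[LHS]/(coord_coef (k i) i (c i) (box_coef k c s _)) IH.
apply/funext => x; rewrite /= /coord_coef /coef mulr_sumr -big_split/=.
by apply: eq_bigr => p _; rewrite mulrDr mulrCA.
Qed.

Let gfun_linear x : linear (fun v : V => gfun x (iota v) : C^o).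
Proof.
move=> a u v; rewrite iotaP /gfun mpartial_seq partials_linear//.
by rewrite box_coef_linear -!mpartial_seq mulrDr mulrCA.
Qed.

Lemma summing_gs_of_weights : summing n' n.
Proof.
have K0 : 0 <= 5 ^+ d * c1 * order_const.
  by rewrite !mulr_ge0// exprn_ge0.
apply: (@summing_countable _ {ffun 'I_d -> T} _ _ _
  (fun x => linear_of (gfun_linear x))
  (fun x : I => (5 ^+ d * c1 * order_const) * (\prod_i b (x i)))).
- by move=> x; rewrite mulr_ge0// prodr_ge0.
- by apply: fsumZ => //; exact: fsum_ffun b0 b_fsum.
- by move=> x v; exact: gfun_le.
- move=> v B B0 gB; apply: n'_le => //.
  by apply: gfun_sup => // x; exact: gB.
Qed.

End bounds.

(** The space V is arbitrary so that the statement applies both to the Beurling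
    space and to the steps of the Roumieu space. *)
Theorem summing_gs (V : lmodType C) (iota : V -> 'rV[R]_d -> C) (n n' : V -> R) :
  (forall a u v, iota (a *: u + v) = (fun x => a * iota u x + iota v x)) ->
  (forall v, smooth (iota v)) -> (forall v, 0 <= n v) ->
  (forall v, (gs_norm M A h (iota v) <= (n v)%:E)%E) ->
  (forall v B, 0 <= B -> (gs_norm M A h' (iota v) <= B%:E)%E -> n' v <= B) ->
  summing n' n.
Proof.
have [W [c1 [c10 W1 Wge Wle]]] := cube_weight hd A0 hc0 hH A2 A6 (gt0 h') hh.
exact: summing_gs_of_weights c10 W1 Wge Wle _ _ _ _.
Qed.

End step_lemma.

(** * Continuous seminorms of locally convex topologies *)

Section summing_tools.
Context (R : realType).
Local Notation C := R[i].
Context (E : lmodType C).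
Implicit Types p q : E -> R.

Lemma summing_le p p' q q' (c c' : R) : 0 <= c -> 0 <= c' ->
  (forall x, p x <= c * p' x) -> (forall x, q x <= c' * q' x) ->
  summing p' q -> summing p q'.
Proof.
move=> c0 c'0 pp' qq' [f [a [a0 aS fa pf]]].
pose k := c + 1; have k0 : 0 < k by rewrite ltr_wpDl.
have lin i : linear (fun x => k%:C * f i x : C^o).
  by move=> b x y; rewrite linearP/= mulrDr mulrCA.
exists (fun i => linear_of (lin i)), (fun i => (k * c') * a i); split.
- by move=> i; rewrite !mulr_ge0// ltW.
- by apply: bsumZ => //; rewrite mulr_ge0// ltW.
- move=> i x; rewrite /= rnM rn_real gtr0_norm// -!mulrA ler_pM2l//.
  by apply: (le_trans (fa i x)); rewrite mulrCA ler_wpM2l.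
move=> x B fB.
have h : p' x <= B / k.
  apply: pf => i; have := fB i; rewrite /= rnM rn_real gtr0_norm// mulrC.
  by rewrite ler_pdivlMr.
have B0 : 0 <= B by exact: le_trans (rn_ge0 _) (fB 0%N).
apply: (le_trans (pp' x)); apply: (@le_trans _ _ (c * (B / k))).
  by rewrite ler_wpM2l.
by rewrite mulrA ler_pdivrMr// mulrC ler_wpM2l// lerDl.
Qed.

(** N is the l^2 norm of the functionals, which lies between their supremum and
    their sum. *)
Lemma hilbertian_of_summing p q : (forall x, 0 <= q x) -> summing p q ->
  exists N : E -> R, [/\ hilbertian N, forall x, p x <= N x &
    exists2 c, 0 <= c & forall x, N x <= c * q x].
Proof.
move=> q0 [f [a [a0 aS fa pf]]].
have fH i := functional_hilbertian (f i).
have fq i x : rn (f i x : C) ^+ 2 <= (a i * q x) ^+ 2.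
  by rewrite sq_le ?rn_ge0.
have fin x : bsum (fun i => rn (f i x : C) ^+ 2).
  exact: bsum_le (fun i => fq i x) (bsum_sqr a0 aS (q x)).
exists (l2norm (fun i x => rn (f i x : C))); split.
- exact: l2norm_hilbertian fH fin.
- by move=> x; apply: pf => i; exact: (le_l2norm fH fin).
have [A hA] := aS.
have A0 : 0 <= A by have := hA 0%N; rewrite big_ord0.
exists A => // x; apply: (l2norm_le fH fin) => [|m]; first by rewrite mulr_ge0.
apply: (@le_trans _ _ (\sum_(i < m) (a i * q x) ^+ 2)).
  by apply: ler_sum => i _; exact: fq.
apply: (@le_trans _ _ ((\sum_(i < m) a i) ^+ 2 * q x ^+ 2)); last first.
  by rewrite exprMn ler_wpM2r ?sqr_ge0// sq_le// sumr_ge0.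
under eq_bigr do rewrite exprMn; rewrite -mulr_suml ler_wpM2r ?sqr_ge0//.
elim: m => [|m IH]; first by rewrite !big_ord0 expr0n.
rewrite !big_ord_recr/= sqrrD; apply: lerD => //.
by rewrite (le_trans IH)// lerDl mulrn_wge0// mulr_ge0// sumr_ge0.
Qed.

(** Homogeneity turns an inclusion of unit balls into an inequality. *)
Lemma seminorm_le_of_ball p q (c : R) : rseminorm p -> rseminorm q -> 0 < c ->
  (forall x, c * q x < 1 -> p x < 1) -> forall x, p x <= c * q x.
Proof.
move=> pP qP c0 qp x; apply/ler_addgt0Pr => e e0.
have q0 := rseminorm_ge0 qP x.
pose t := c * q x + e; have t0 : 0 < t.
  by rewrite ltr_wpDl// mulr_ge0// ltW.
have tN : rn (t^-1)%:C = t^-1 by rewrite rn_real gtr0_norm ?invr_gt0.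
have := qp ((t^-1)%:C *: x); rewrite pP.2 qP.2 tN mulrCA.
rewrite !(mulrC t^-1) !ltr_pdivrMr// !mul1r => h.
by rewrite -/t ltW// h// /t ltrDl.
Qed.

End summing_tools.

Section topologies.
Context (R : realType).
Local Notation C := R[i].
Let K : numFieldType := R[i].

Lemma continuous_seminorm_bounded (V : normedModType C) (q : seminorm V) :
  continuous (q : V -> K) ->
  exists2 c, 0 < c & forall x, real_part q x <= c * rn x.
Proof.
move=> cq; have qP := real_part_seminorm q.
have /cvgrPdist_lt/(_ 1 ltr01)/nbhs_ballP[_ /complex_gt0[e e0 ->] qe] := cq 0.
exists e^-1; first by rewrite invr_gt0.
apply: (seminorm_le_of_ball qP (@rn_seminorm R V)); first by rewrite invr_gt0.
move=> x; rewrite mulrC ltr_pdivrMr// mul1r => xe.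
have := qe x; rewrite -ball_normE/= sub0r normrN rnE ltcR => /(_ xe).
rewrite seminorm0 sub0r normrN real_partE -/((1 : R)%:C) => h.
have : `|real_part q x| < 1 by rewrite -ltcR -rn_real -rnE.
by apply: le_lt_trans; exact: ler_norm.
Qed.

Lemma bounded_seminorm_continuous (V : normedModType C) (q : seminorm V) (c : R) :
  (forall x, real_part q x <= c * rn x) -> continuous (q : V -> K).
Proof.
move=> qc x; apply/cvgrPdist_lt => _ /complex_gt0[e e0 ->].
have c0 : 0 < `|c| + 1 by rewrite ltr_wpDl.
have e1 : 0 < (e / (`|c| + 1))%:C :> C by rewrite ltcR divr_gt0.
have := nbhsx_ballx x _ e1; apply: filterS => y.
rewrite -ball_normE/= rnE ltcR ltr_pdivlMr// => xy.
rewrite !real_partE -rmorphB/= rnE rn_real ltcR.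
apply: le_lt_trans (rseminorm_abs (real_part_seminorm q) x y) _.
apply: le_lt_trans (qc _) (le_lt_trans _ xy).
rewrite mulrC ler_wpM2l ?rn_ge0// (le_trans (ler_norm c))//.
by rewrite lerDl.
Qed.

Section lcs.
Context (E : lmodType C) (P : set (seminorm E)).

Lemma lcs_continuous_ball (p : seminorm E) : continuous (p : lcs P -> K) ->
  exists2 s : seq (seminorm E * C), (forall q, q \in s -> P q.1 /\ 0 < q.2) &
  forall x, (forall q, q \in s -> q.1 x < q.2) -> real_part p x < 1.
Proof.
move=> cp; have /cvgrPdist_lt/(_ 1 ltr01)[D [Dfin DP] Dp] := cp 0.
have [s sE] := (finite_seqP D).1 Dfin.
exists s => [q qs|x xs].
  by apply: DP; rewrite sE.
have := Dp x; rewrite /= seminorm0 sub0r normrN.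
have -> : `|p x| = (real_part p x)%:C by rewrite ger0_norm ?seminorm_ge0// real_partE.
rewrite -/((1 : R)%:C) ltcR; apply.
by move=> q; rewrite sE /= subr0 => qs; exact: xs.
Qed.

Lemma lcs_dominated_continuous (p q : seminorm E) (c : R) : P q ->
  (forall x, real_part p x <= c * real_part q x) -> continuous (p : lcs P -> K).
Proof.
move=> Pq pq x S /nbhs_ballP[_ /complex_gt0[e e0 ->] eS].
have c0 : 0 < `|c| + 1 by rewrite ltr_wpDl.
have e1 : 0 < (e / (`|c| + 1))%:C :> C by rewrite ltcR divr_gt0.
have [D iD Dq] := lcs_near x Pq e1; exists D => // y /Dq /=.
rewrite real_partE ltcR ltr_pdivlMr// => xy.
apply: eS; rewrite -ball_normE/= !real_partE -rmorphB/= rnE rn_real ltcR distrC.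
apply: le_lt_trans (rseminorm_abs (real_part_seminorm p) y x) _.
apply: le_lt_trans (pq _) (le_lt_trans _ xy).
rewrite mulrC ler_wpM2l ?(rseminorm_ge0 (real_part_seminorm q))//.
by rewrite (le_trans (ler_norm c))// lerDl.
Qed.

Lemma lcs_hausdorff : (forall x : E, x != 0 -> exists2 q, P q & q x != 0) ->
  hausdorff_space (lcs P).
Proof.
move=> sep x y xy; apply: contrapT => /eqP nxy.
have [q Pq q0] : exists2 q, P q & q (x - y : E) != 0.
  by apply: sep; rewrite subr_eq0.
have {}q0 : 0 < q (x - y : E) by rewrite lt_def q0 seminorm_ge0.
have r0 : 0 < q (x - y : E) / 2 by rewrite divr_gt0.
have [z [/= zx zy]] := xy _ _ (lcs_near x Pq r0) (lcs_near y Pq r0).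
have : q (x - y : E) < q (x - y : E).
  rewrite [X in _ < X]splitr -[X in q X < _](subrKA (z : E)).
  apply: le_lt_trans (seminormD _ _ _) _.
  by rewrite ltrD// seminormB.
by rewrite ltxx.
Qed.

Lemma lcs_nuclear : (forall x : E, x != 0 -> exists2 q, P q & q x != 0) ->
  (forall p : seminorm (lcs P), continuous (p : lcs P -> K) ->
    exists q : seminorm (lcs P), [/\ continuous (q : lcs P -> K),
      forall x, p x <= q x & nuclear_link q p]) ->
  nuclear_space (lcs P).
Proof.
move=> sep link; split; first exact: lcs_hausdorff.
by move=> p cp; have [q [cq pq lk]] := link p cp; exists q.
Qed.

End lcs.
End topologies.

(** * The Gelfand-Shilov spaces *)

Section spaces.
Context (R : realType) (d : nat) (M A : nat -> {posnum R}).
Local Notation C := R[i].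
Implicit Types h : {posnum R}.

Definition finite_norm h (phi : 'rV[R]_d -> C) : R := fine (gs_norm M A h phi).

Lemma gs_norm_fin_num h (phi : 'rV[R]_d -> C) : (gs_norm M A h phi < +oo)%E ->
  gs_norm M A h phi \is a fin_num.
Proof.
by move=> f; rewrite ge0_fin_numE; [exact: f|exact: gs_norm_ge0].
Qed.

Lemma finite_normE h phi : (gs_norm M A h phi < +oo)%E ->
  (finite_norm h phi)%:E = gs_norm M A h phi.
Proof. by move=> f; apply: fineK; exact: gs_norm_fin_num f. Qed.

Lemma finite_norm_ge0 h phi : 0 <= finite_norm h phi.
Proof. by rewrite fine_ge0// gs_norm_ge0. Qed.

Lemma finite_norm_mono h h' phi : h%:num <= h'%:num ->
  (gs_norm M A h' phi < +oo)%E -> finite_norm h phi <= finite_norm h' phi.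
Proof.
move=> hh' f'; have f := le_lt_trans (le_gs_norm M A phi hh') f'.
apply: fine_le; last exact: le_gs_norm.
- exact: gs_norm_fin_num f.
- exact: gs_norm_fin_num f'.
Qed.

Definition step_val h (v : gs_step d M A h) : 'rV[R]_d -> C := subspace_val v.

Lemma step_valP h (v : gs_step d M A h) :
  smooth (step_val v) /\ (gs_norm M A h (step_val v) < +oo)%E.
Proof. by case: v => phi phiB; have /asboolP := phiB. Qed.

Lemma step_val_linear h a (u v : gs_step d M A h) :
  step_val (a *: u + v) = (fun x => a * step_val u x + step_val v x).
Proof. by []. Qed.

Lemma rn_step h (v : gs_step d M A h) : rn v = finite_norm h (step_val v).
Proof. by []. Qed.

Lemma step_widen h h' (v : gs_step d M A h') : h%:num <= h'%:num ->
  exists w : gs_step d M A h, step_val w = step_val v.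
Proof.
move=> hh'; have [sv fv] := step_valP v.
have w : step_val v \in in_step (d := d) M A h.
  by apply/asboolP; split; [exact: sv|exact: le_lt_trans (le_gs_norm _ _ _ hh') fv].
by exists (SubspaceOf w).
Qed.

Definition beurling : Type := subspace_of (@in_beurling R d M A).
HB.instance Definition _ := GRing.Lmodule.on beurling.

Definition beurling_val (v : beurling) : 'rV[R]_d -> C := subspace_val v.

Lemma beurling_valP (v : beurling) : smooth (beurling_val v) /\
  forall h, (gs_norm M A h (beurling_val v) < +oo)%E.
Proof. by case: v => phi phiB; have /asboolP := phiB. Qed.

Lemma beurling_val_linear a (u v : beurling) :
  beurling_val (a *: u + v) =
  (fun x => a * beurling_val u x + beurling_val v x).
Proof. by []. Qed.

Definition beurling_step h : {linear beurling -> gs_step d M A h} :=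
  inclusion (@in_beurling_step R d M A h).

Lemma rn_beurling_step h v :
  rn (beurling_step h v) = finite_norm h (beurling_val v).
Proof. by []. Qed.

Lemma beurling_seminorm h :
  rseminorm (fun v : beurling => finite_norm h (beurling_val v)).
Proof.
have [rD rZ] := @rn_seminorm R (gs_step d M A h).
split=> [x y|a x]; rewrite -!rn_beurling_step.
  by rewrite linearD; exact: rD.
by rewrite linearZ; exact: rZ.
Qed.

Definition roumieu : Type := subspace_of (@in_roumieu R d M A).
HB.instance Definition _ := GRing.Lmodule.on roumieu.

Definition roumieu_val (v : roumieu) : 'rV[R]_d -> C := subspace_val v.

Lemma roumieu_valP (v : roumieu) : smooth (roumieu_val v) /\
  exists h, (gs_norm M A h (roumieu_val v) < +oo)%E.
Proof. by case: v => phi phiB; have /asboolP := phiB. Qed.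

Definition step_roumieu h : {linear gs_step d M A h -> roumieu} :=
  inclusion (@in_step_roumieu R d M A h).

Lemma roumieu_val_inj : injective roumieu_val.
Proof. by move=> u v uv; apply/val_inj; exact: uv. Qed.

Section nuclearity.
Let K : numFieldType := R[i].
Context (hd : (0 < d)%N).
Hypotheses (A0 : (A 0%N)%:num = 1).
Context (c0 H : R) (hc0 : 1 <= c0) (hH : 1 <= H).
Hypotheses (M2 : cond_M2 c0 H M) (A2 : cond_M2 c0 H A) (A6 : cond_M6 A).

Let kappa : R := 2 * d%:R * H.

Let kappa_ge1 : 1 <= kappa.
Proof.
have d1 : 1 <= d%:R :> R by rewrite ler1n.
by have h := hH; rewrite /kappa; nra.
Qed.

Let kappa_gt0 : 0 < kappa. Proof. exact: lt_le_trans kappa_ge1. Qed.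

Let smaller_scale h : exists h', h%:num = kappa * h'%:num.
Proof.
have p : 0 < h%:num / kappa by rewrite divr_gt0.
by exists (PosNum p); rewrite /= mulrC divfK// gt_eqF.
Qed.

Let larger_scale h : exists h', h'%:num = kappa * h%:num.
Proof.
have p : 0 < kappa * h%:num by rewrite mulr_gt0.
by exists (PosNum p).
Qed.

Let scale_le h h' : h'%:num = kappa * h%:num -> h%:num <= h'%:num.
Proof. by move=> ->; rewrite ler_peMl. Qed.

(** p is summing with respect to the norm of scale h1, and a hilbertian seminorm
    fits between the norms of scales h1 and h2. *)
Lemma hilbertian_link (V : lmodType C) (iota : V -> 'rV[R]_d -> C)
    (p : V -> R) (h0 h1 h2 : {posnum R}) (c : R) :
  h1%:num = 2 * d%:R * H * h0%:num -> h2%:num = 2 * d%:R * H * h1%:num ->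
  (forall a u v, iota (a *: u + v) = (fun x => a * iota u x + iota v x)) ->
  (forall v, smooth (iota v)) ->
  (forall v, (gs_norm M A h2 (iota v) < +oo)%E) ->
  0 <= c -> (forall v, p v <= c * finite_norm h0 (iota v)) ->
  exists N : V -> R, [/\ hilbertian N, summing p N &
    exists2 k, 0 <= k & forall v, N v <= k * finite_norm h2 (iota v)].
Proof.
move=> h01 h12 iotaP ism fin2 c00 pc.
have fin1 v := le_lt_trans (le_gs_norm M A (iota v) (scale_le h12)) (fin2 v).
have fin0 v := le_lt_trans (le_gs_norm M A (iota v) (scale_le h01)) (fin1 v).
have le_norm h v B : (gs_norm M A h (iota v) < +oo)%E -> 0 <= B ->
    (gs_norm M A h (iota v) <= B%:E)%E -> finite_norm h (iota v) <= B.
  by move=> f _ fB; rewrite -lee_fin (finite_normE f); exact: fB.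
have S01 : summing (fun v => finite_norm h0 (iota v)) (fun v => finite_norm h1 (iota v)).
  apply: (summing_gs hd A0 hc0 hH M2 A2 A6 h01 iotaP ism).
  - by move=> v; exact: finite_norm_ge0.
  - by move=> v; rewrite (finite_normE (fin1 v)).
  - by move=> v B; exact: (le_norm h0 v B (fin0 v)).
have S12 : summing (fun v => finite_norm h1 (iota v)) (fun v => finite_norm h2 (iota v)).
  apply: (summing_gs hd A0 hc0 hH M2 A2 A6 h12 iotaP ism).
  - by move=> v; exact: finite_norm_ge0.
  - by move=> v; rewrite (finite_normE (fin2 v)).
  - by move=> v B; exact: (le_norm h1 v B (fin1 v)).
have [N [NH N1 N2]] := hilbertian_of_summing (fun v => finite_norm_ge0 h2 (iota v)) S12.
exists N; split; [exact: NH| |exact: N2].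
apply: summing_le c00 ler01 pc _ S01.
by move=> v; rewrite mul1r; exact: N1.
Qed.

Definition step_seminorm h : seminorm (gs_step d M A h) :=
  seminorm_of (@rn_seminorm R (gs_step d M A h)).

Lemma step_seminorm_continuous h :
  continuous (step_seminorm h : gs_step d M A h -> K).
Proof.
apply: (@bounded_seminorm_continuous R (gs_step d M A h) (step_seminorm h) 1).
by move=> v; rewrite mul1r.
Qed.

(** Finitely many of the defining seminorms bound p, and the norms increase with
    the scale, so the largest scale suffices. *)
Let beurling_bounded (p : seminorm beurling) :
  continuous (p : beurling_space d M A -> K) ->
  exists h (c : R), 0 <= c /\
    forall v : beurling, real_part p v <= c * finite_norm h (beurling_val v).
Proof.
move=> cp; have [s sP sp] := lcs_continuous_ball cp.
suff [h [c [c00 hc]]] : exists h (c : R), 0 < c /\ forall v : beurling,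
    c * finite_norm h (beurling_val v) < 1 -> forall q, q \in s -> q.1 v < q.2.
  exists h, c; split; first exact: ltW.
  apply: (seminorm_le_of_ball (real_part_seminorm p) (beurling_seminorm h) c00).
  by move=> v /hc; exact: sp.
elim: s sP {sp} => [|[q e] s IH] sP; first by exists 1%:pos, 1.
have [|h [c [c00 hc]]] := IH.
  by move=> q' q's; apply: sP; rewrite in_cons q's orbT.
have [[h' [q' [cq' qE]]] e0] := sP _ (mem_head _ _).
have [e' e'0 eE] := complex_gt0 e0.
have [c' c'0 q'c] := continuous_seminorm_bounded cq'.
have c20 : 0 < c' / e' by rewrite divr_gt0.
have [m [mh mh']] : exists m : {posnum R}, h%:num <= m%:num /\ h'%:num <= m%:num.
  by have [hh|/ltW hh] := leP h%:num h'%:num; [exists h'|exists h].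
exists m, (c + c' / e'); split; first exact: addr_gt0.
move=> v vm q0; rewrite in_cons.
have m0 := finite_norm_ge0 m (beurling_val v).
have l1 := finite_norm_mono mh ((beurling_valP v).2 m).
have l2 := finite_norm_mono mh' ((beurling_valP v).2 m).
case/orP=> [/eqP ->|q0s]; last first.
  apply: hc q0s; apply: le_lt_trans vm.
  apply: (@le_trans _ _ (c * finite_norm m (beurling_val v))).
    by rewrite ler_pM2l; [exact: l1|exact: c00].
  by rewrite ler_wpM2r// lerDl ltW.
move: qE eE => /= -> ->; rewrite real_partE ltcR.
have := q'c (beurling_step h' v); rewrite rn_beurling_step => h1.
apply: (@le_lt_trans _ _ (c' * finite_norm m (beurling_val v))).
  by apply: le_trans h1 _; rewrite ler_pM2l; [exact: l2|exact: c'0].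
move: vm; rewrite mulrDl mulrAC => vm.
have : c' * finite_norm m (beurling_val v) / e' < 1.
  by apply: le_lt_trans vm; rewrite lerDr mulr_ge0// ltW.
by rewrite ltr_pdivrMr// mul1r.
Qed.

Let beurling_continuous (q : seminorm beurling) h (c : R) :
  (forall v, real_part q v <= c * finite_norm h (beurling_val v)) ->
  continuous (q : beurling_space d M A -> K).
Proof.
move=> qc.
apply: (lcs_dominated_continuous
  (q := seminorm_comp (step_seminorm h) (beurling_step h)) (c := c)).
  by exists h, (step_seminorm h); split; [exact: step_seminorm_continuous|].
by move=> v; exact: qc.
Qed.

Let beurling_link (p : seminorm beurling) :
  continuous (p : beurling_space d M A -> K) ->
  exists q : seminorm beurling, [/\ continuous (q : beurling_space d M A -> K),
    forall v, p v <= q v & nuclear_link q p].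
Proof.
move=> cp; have [h0 [c [c00 pc]]] := beurling_bounded cp.
have [h1 h01] := larger_scale h0; have [h2 h12] := larger_scale h1.
have [N [NH pN [k k0 Nk]]] := hilbertian_link h01 h12 beurling_val_linear
  (fun v => (beurling_valP v).1) (fun v => (beurling_valP v).2 h2) c00 pc.
have [q [qP [pq qN lk]]] := @inductive_nuclear_link R (fun _ => beurling) beurling
  (fun _ => idfun) (fun _ => N) p (fun _ => NH)
  (fun y => ex_intro _ 0%N (ex_intro _ y erefl)) (fun _ => pN).
exists (seminorm_of qP); split; [|exact: pq|exact: lk].
have [c' c'0 qc'] := qN 0%N.
apply: (@beurling_continuous _ h2 (c' * k)) => v.
apply: le_trans (qc' v) _; rewrite -mulrA; apply: ler_wpM2l; first exact: c'0.
exact: Nk.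
Qed.

Theorem beurling_nuclear : nuclear_space (beurling_space d M A).
Proof.
apply: lcs_nuclear => [x x0|p cp]; last exact: (beurling_link cp).
exists (seminorm_comp (step_seminorm 1%:pos) (beurling_step 1%:pos)).
  exists 1%:pos, (step_seminorm 1%:pos).
  by split; [exact: step_seminorm_continuous|].
apply: contra_neq x0 => /complexI/rn0_eq0 ux0.
by apply/val_inj; exact: (congr1 (@step_val _) ux0).
Qed.

Let roumieu_bounded (p : seminorm roumieu) :
  continuous (p : roumieu_space d M A -> K) ->
  forall h, exists2 c : R, 0 <= c &
    forall v : gs_step d M A h, real_part p (step_roumieu h v) <= c * rn v.
Proof.
move=> cp h; have [s sP sp] := lcs_continuous_ball cp.
suff [c c00 hc] : exists2 c : R, 0 < c & forall v : gs_step d M A h,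
    c * rn v < 1 -> forall q, q \in s -> q.1 (step_roumieu h v) < q.2.
  exists c; first exact: ltW.
  have pP := real_part_seminorm (seminorm_comp p (step_roumieu h)).
  apply: (seminorm_le_of_ball pP (@rn_seminorm R (gs_step d M A h)) c00).
  by move=> v /hc; exact: sp.
elim: s sP {sp} => [|[q e] s IH] sP; first by exists 1.
have [|c c00 hc] := IH.
  by move=> q' q's; apply: sP; rewrite in_cons q's orbT.
have [cq e0] := sP _ (mem_head _ _).
have [e' e'0 eE] := complex_gt0 e0.
have [c' c'0 q'c] := @continuous_seminorm_bounded R (gs_step d M A h)
  (seminorm_comp q (step_roumieu h)) (cq h).
have c20 : 0 < c' / e' by rewrite divr_gt0.
exists (c + c' / e'); first exact: addr_gt0.
move=> v vm q0; rewrite in_cons; have m0 := rn_ge0 v.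
case/orP=> [/eqP ->|q0s]; last first.
  apply: hc q0s; apply: le_lt_trans vm.
  by rewrite ler_wpM2r// lerDl ltW.
move: eE => /= ->; rewrite real_partE ltcR.
apply: (le_lt_trans (q'c v)).
move: vm; rewrite mulrDl mulrAC => vm.
have : c' * rn v / e' < 1.
  by apply: le_lt_trans vm; rewrite lerDr mulr_ge0// ltW.
by rewrite ltr_pdivrMr// mul1r.
Qed.

(** The coefficient of order 0 in the norm, with weight 1 / M_0. *)
Let step_eval h (v : gs_step d M A h) y :
  rn (step_val v y) <= (M 0%N)%:num * rn v.
Proof.
have [sv fv] := step_valP v.
have v0 : 0 <= rn v by exact: rn_ge0.
have /(gs_norm_leP M A0 h (step_val v) v0) : (gs_norm M A h (step_val v) <= (rn v)%:E)%E.
  by rewrite rn_step (finite_normE fv).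
move=> /(_ (fun=> 0%N) y 0%N); rewrite rn_mD.
have -> : multi_abs (fun _ : 'I_d => 0%N) = 0%N by rewrite /multi_abs big1.
have -> : mpartial (fun=> 0%N) (step_val v) = step_val v.
  by rewrite /mpartial; elim: (enum 'I_d).
by rewrite !expr0 A0 divr1 mulr1 div1r mulrC ler_pdivrMr// mulrC.
Qed.

Let roumieu_step_eq h h' (v : gs_step d M A h) (w : gs_step d M A h') :
  step_val v = step_val w -> step_roumieu h v = step_roumieu h' w.
Proof. by move=> vw; apply: roumieu_val_inj; exact: vw. Qed.

Let roumieu_continuous (q : seminorm roumieu) :
  (forall h, exists c : R, forall v : gs_step d M A h,
    real_part q (step_roumieu h v) <= c * rn v) ->
  [set p : seminorm roumieu | forall h,
    continuous (fun v : gs_step d M A h => p (step_roumieu h v) : K)] q.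
Proof.
move=> qc h; have [c hc] := qc h.
exact: (@bounded_seminorm_continuous R (gs_step d M A h)
  (seminorm_comp q (step_roumieu h)) c hc).
Qed.

Let scale (k : nat) : {posnum R} :=
  PosNum (eq_ind_r is_true (ltr0Sn R k) (invr_gt0 (k.+1%:R : R))).

Let scale_small h : exists k, (scale k)%:num <= h%:num.
Proof.
have [N HN] := small_harmonic (gt0 h).
by exists N; rewrite ltW// HN.
Qed.

Let roumieu_link (p : seminorm roumieu) :
  continuous (p : roumieu_space d M A -> K) ->
  exists q : seminorm roumieu, [/\ continuous (q : roumieu_space d M A -> K),
    forall v, p v <= q v & nuclear_link q p].
Proof.
move=> cp; have [s1 s1P] := choice (fun k => smaller_scale (scale k)).
have [s0 s0P] := choice (fun k => smaller_scale (s1 k)).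
have s0_le k : (s0 k)%:num <= (scale k)%:num.
  exact: le_trans (scale_le (s0P k)) (scale_le (s1P k)).
have HN k : {N : gs_step d M A (scale k) -> R | [/\ hilbertian N,
    summing (fun v => real_part p (step_roumieu (scale k) v)) N &
    exists2 c, 0 <= c & forall v, N v <= c * finite_norm (scale k) (step_val v)]}.
  apply: cid; have [c c00 pc] := roumieu_bounded cp (s0 k).
  apply: (hilbertian_link (iota := @step_val (scale k)) (s0P k) (s1P k) _ _ _ c00).
  - exact: step_val_linear.
  - by move=> v; exact: (step_valP v).1.
  - by move=> v; exact: (step_valP v).2.
  - move=> v; have [w wv] := step_widen v (s0_le k).
    have nw : rn w = finite_norm (s0 k) (step_val v) by rewrite -wv.
    have h := pc w; have E := roumieu_step_eq wv.
    rewrite E in h; rewrite nw in h; exact h.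
have NH k : hilbertian (projT1 (HN k)) by have [] := projT2 (HN k).
have pN k : summing (fun v => real_part p (step_roumieu (scale k) v)) (projT1 (HN k)).
  by have [] := projT2 (HN k).
have surj (y : roumieu) : exists k v, step_roumieu (scale k) v = y.
  have [sy [h fy]] := roumieu_valP y; have [k kh] := scale_small h.
  have yk : roumieu_val y \in in_step (d := d) M A (scale k).
    apply/asboolP; split; first exact: sy.
    exact: le_lt_trans (le_gs_norm _ _ _ kh) fy.
  by exists k, (SubspaceOf yk); exact: roumieu_val_inj.
have [q [qP [pq qN lk]]] := @inductive_nuclear_link R (fun k => gs_step d M A (scale k))
  roumieu (fun k => step_roumieu (scale k)) (fun k => projT1 (HN k)) p NH surj pN.
exists (seminorm_of qP); split; [|exact: pq|exact: lk].
have qin := @roumieu_continuous (seminorm_of qP).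
apply: (lcs_dominated_continuous (q := seminorm_of qP) (c := 1)); last first.
  by move=> v; rewrite mul1r.
apply: qin => h; have [k kh] := scale_small h.
have [c c00 qc] := qN k; have [_ _ [c' c'0 Nc]] := projT2 (HN k).
exists (c * c') => v; have [w wv] := step_widen v kh.
rewrite (roumieu_step_eq (esym wv)) rn_step.
apply: le_trans (qc w) _; rewrite -mulrA; apply: ler_wpM2l; first exact: c00.
apply: le_trans (Nc w) _; apply: ler_wpM2l; first exact: c'0.
by rewrite wv; exact: (finite_norm_mono kh (step_valP v).2).
Qed.

(** The space is Hausdorff because point evaluations are continuous. *)
Theorem roumieu_nuclear : nuclear_space (roumieu_space d M A).
Proof.
apply: lcs_nuclear => [x x0|p cp]; last exact: (roumieu_link cp).
have [y xy] : exists y, roumieu_val x y <> 0.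
  apply: contrapT => nx; move/eqP: x0; apply; apply: roumieu_val_inj.
  by apply/funext => y; apply: contrapT => xy; apply: nx; exists y.
have evP : rseminorm (fun v : roumieu => rn (roumieu_val v y)).
  split=> [u v|a u]; first exact: (rnD (roumieu_val u y) (roumieu_val v y)).
  exact: (rnM a (roumieu_val u y)).
exists (seminorm_of evP); last first.
  by apply/eqP => /complexI/rn0_eq0.
apply: roumieu_continuous => h; exists (M 0%N)%:num => v.
exact: step_eval.
Qed.

End nuclearity.
End spaces.

Theorem proposition2p11 (R : realType) (d : nat) (hd : (0 < d)%N)
    (M A : nat -> {posnum R})
    (M0 : (M 0%N)%:num = 1) (M1 : (M 1%N)%:num = 1)
    (A0 : (A 0%N)%:num = 1) (A1 : (A 1%N)%:num = 1)
    (logconvexM : cond_M1 M) (logconvexA : cond_M1 A)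
    (c0 H : R) (hc0 : 1 <= c0) (hH : 1 <= H)
    (stableM : cond_M2 c0 H M) (stableA : cond_M2 c0 H A)
    (hM5 : cond_M5 M) (hA6 : cond_M6 A) :
  nuclear_space (beurling_space d M A) /\ nuclear_space (roumieu_space d M A).
Proof.
split.
- exact (beurling_nuclear hd A0 hc0 hH stableM stableA hA6).
- exact (roumieu_nuclear hd A0 hc0 hH stableM stableA hA6).
Qed.
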